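(* Let $c\in L^\infty(S^1,\mathbb{R})$ be an observation function and let the family of maps $T_\delta$ satisfy (A0), (A1) and (A2). The perturbation $\dot T\in H^4(S^1,\mathbb{R})$ that maximises the expected linear response $\int_{S^1}c(x)R(\dot T)(x)\,dx$ (that is, that solves the problem of minimising $\mathcal{J}(\dot T):=-\int_{S^1}c(x)R(\dot T)(x)\,dx$ over $\dot T\in H^4(S^1,\mathbb{R})$ subject to $\|\dot T\|_{H^4}\le 1$) is given by $\dot T=\sum_{n=-\infty}^{\infty}a_n e_n$, where $e_n(x)=\exp(2\pi i n x)$ and the coefficients $a_n$ are given by $$a_n=\frac{\displaystyle\int_{S^1} c\cdot\overline{(I-L_0)^{-1}L_0\left(\left[\frac{e_n f_0}{T_0'}\right]'\right)}\,dx}{2\nu\displaystyle\sum_{k=0}^4(4\pi^2n^2)^k},\qquad n\in\mathbb{Z},$$ where $\nu>0$ is chosen so that $\|\dot T\|_{H^4}=1$; that is, $\sum_{n=-\infty}^{\infty}\sum_{k=0}^4(4\pi^2n^2)^k|a_n|^2=1$.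
   Context: $S^1=\mathbb{R}/\mathbb{Z}$. $W^{k,p}$ is the Sobolev space of functions with weak derivatives up to order $k$ in $L^p$; $H^k=W^{k,2}$, and $\|f\|_{H^4}^2=\sum_{k=0}^4\int_{S^1}|f^{(k)}|^2dx$ (so $H^4(S^1)\subset C^3(S^1)$). For some $\bar\delta>0$, $\{T_\delta:S^1\to S^1\}_{\delta\in[0,\bar\delta)}$ is a family of $C^3$ maps. The assumptions are: (A0) $T_0\in C^4(S^1)$; (A1) there is $\alpha<1$ such that $|T_0'(x)|\ge\alpha^{-1}$ for all $x\in S^1$; (A2) $T_\delta(x)=T_0(x)+\delta\dot T(x)+F_\delta(x)$ (mod 1) with $\dot T\in C^3(S^1,\mathbb{R})$ and $\sup_{\delta\in(0,\bar\delta)}\|F_\delta\|_{C^3}/\delta^2<\infty$. The transfer operator of $T_\delta$, acting on $W^{1,1}(S^1,\mathbb{C})$, is $L_\delta f(x)=\sum_{y\in T_\delta^{-1}(x)}f(y)/|T_\delta'(y)|$. $f_\delta$ denotes the unique absolutely continuous invariant probability density of $T_\delta$, so $L_\delta f_\delta=f_\delta$. The linear response of the system to $\dot T$ is $R(\dot T)=\lim_{\delta\to0}(f_\delta-f_0)/\delta$, with the limit taken in $L^1$. The resolvent $(I-L_0)^{-1}=\sum_{j\ge0}L_0^j$ is the bounded inverse of $I-L_0$ on the zero-mean functions in $W^{1,1}(S^1)$.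
   Formalization: The printed a_n with ν>0 minimises the expected response (check T_0=2x, c=cos 2πx), so a_n is multiplied by −1; a normalising ν>0 is asserted to exist only when ∫cR(Ṫ)dx is not identically zero on H^4 (for constant c no such ν exists). *)

(* Defs.v *)
From mathcomp Require Export all_boot all_order all_algebra.
From mathcomp Require Export all_classical all_reals all_analysis.
From mathcomp.real_closed Require Export complex.
Export Order.TTheory GRing.Theory Num.Theory numFieldNormedType.Exports.

Set Implicit Arguments.
Unset Strict Implicit.
Unset Printing Implicit Defensive.

#[global] Open Scope classical_set_scope.
#[global] Open Scope ring_scope.

(* Conventions for the circle S^1 = R/Z.  Functions on S^1 are 1-periodic     *)
(* functions on the line, integrals over S^1 are Lebesgue integrals over      *)
(* [0, 1], and a continuous map S^1 -> S^1 is given by a lift R -> R, which is *)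
(* unique up to an additive integer constant.                                 *)

Notation circle_integral f :=
  (Rintegral lebesgue_measure `[0%R, 1%R] f).

Definition circle_map {R : realType} (T : R -> R) : Prop :=
  exists d : int, forall x, T (x + 1) = T x + d%:~R.

Definition class_C {R : realType} (k : nat) (f : R -> R) : Prop :=
  (forall j x, (j < k)%N -> derivable (derive1n j f) x 1) /\
  continuous (derive1n k f).

Definition C3norm {R : realType} (f : R -> R) : R :=
  \sum_(j < 4) sup (range (fun x => `|derive1n j f x|)).

Definition Lp {R : realType} (p : \bar R) (f : R -> R) : Prop :=
  periodic f 1 /\ (f \_ `[0%R, 1%R]) \in Lfun (@lebesgue_measure R) p.

(* [g] is the [k]-th weak derivative of [f] on the circle.                    *)
Definition weak_derivative {R : realType} (k : nat) (f g : R -> R) : Prop :=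
  forall phi : R -> R, periodic phi 1 -> (forall m, class_C m phi) ->
    circle_integral (fun x => f x * derive1n k phi x) =
    (-1) ^+ k * circle_integral (fun x => g x * phi x).

(* W^{k,p}(S^1, R) for k >= 1.  Every class then contains exactly one         *)
(* continuous function, and it is this representative that is considered.    *)
Definition sobolev {R : realType} (k : nat) (p : \bar R) (f : R -> R) : Prop :=
  [/\ continuous f, periodic f 1 &
      forall j, (j <= k)%N -> exists2 g, Lp p g & weak_derivative j f g].

Definition H4 {R : realType} (f : R -> R) : Prop := sobolev 4 2%:E f.

(* Determined up to equality almost everywhere when it exists.                *)
Definition wderiv {R : realType} (k : nat) (f : R -> R) : R -> R :=
  xget (fun=> 0) [set g | Lp 1%:E g /\ weak_derivative k f g].

Definition H4norm {R : realType} (f : R -> R) : R :=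
  Num.sqrt (\sum_(k < 5) circle_integral (fun x => `|wderiv k f x| ^+ 2)).

Definition complex_W11 {R : realType} (h : R -> R[i]) : Prop :=
  sobolev 1 1%:E (fun x => complex.Re (h x)) /\
  sobolev 1 1%:E (fun x => complex.Im (h x)).

Definition complex_integral {R : realType} (h : R -> R[i]) : R[i] :=
  Complex (circle_integral (fun x => complex.Re (h x)))
          (circle_integral (fun x => complex.Im (h x))).

Definition complex_derive {R : realType} (h : R -> R[i]) (x : R) : R[i] :=
  Complex (derive1 (fun y => complex.Re (h y)) x)
          (derive1 (fun y => complex.Im (h y)) x).

(* The points of T^{-1}(x) are listed by their representatives in [0, 1).     *)
Definition preimages {R : realType} (T : R -> R) (x : R) : set R :=
  [set y | 0 <= y < 1 /\ exists m : int, T y = x + m%:~R].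

Definition transfer {R : realType} (T : R -> R) (f : R -> R[i]) (x : R) : R[i] :=
  \sum_(y \in preimages T x) f y / (`|derive1 T y|)%:C%C.

(* The measure f dx is an invariant probability measure of T; subsets of the  *)
(* circle are 1-periodic subsets of the line.                                 *)
Definition invariant_density {R : realType} (T f : R -> R) : Prop :=
  [/\ forall x, 0 <= f x,
      (\int[lebesgue_measure]_(x in `[0%R, 1%R]) (f x)%:E = 1)%E &
      forall A : set R, measurable A -> (forall x, A (x + 1) <-> A x) ->
        (\int[lebesgue_measure]_(x in `[0%R, 1%R] `&` T @^-1` A) (f x)%:E =
         \int[lebesgue_measure]_(x in `[0%R, 1%R] `&` A) (f x)%:E)%E].

(* The absolutely continuous invariant probability density of T, in its       *)
(* continuous W^{1,1} representative.                                         *)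
Definition acip {R : realType} (T : R -> R) : R -> R :=
  xget (fun=> 0) [set f | sobolev 1 1%:E f /\ invariant_density T f].

Definition expanding {R : realType} (T : R -> R) : Prop :=
  exists alpha : R, 0 < alpha < 1 /\ forall x, alpha^-1 <= `|derive1 T x|.

(* The family is (T delta) for 0 <= delta < dbar; the integer [m] expresses   *)
(* equality mod 1 for lifts.                                                  *)
Definition perturbed_family {R : realType} (T0 Tdot : R -> R)
    (dbar : R) (T : R -> R -> R) : Prop :=
  [/\ 0 < dbar, T 0 = T0,
      forall delta, 0 <= delta < dbar ->
        circle_map (T delta) /\ class_C 3 (T delta),
      periodic Tdot 1 /\ class_C 3 Tdot &
      exists F : R -> R -> R,
        [/\ forall delta, 0 < delta < dbar ->
              periodic (F delta) 1 /\ class_C 3 (F delta),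
            forall delta x, 0 < delta < dbar -> exists m : int,
              T delta x = T0 x + delta * Tdot x + F delta x + m%:~R &
            exists M : R, forall delta, 0 < delta < dbar ->
              C3norm (F delta) / delta ^+ 2 <= M]].

(* The quotients (f_delta - f_0) / delta tend to [r] in L^1 as delta -> 0, for *)
(* any family with unperturbed map T0 and direction Tdot: the limit does not  *)
(* depend on the remainder F.                                                 *)
Definition is_linear_response {R : realType} (T0 Tdot r : R -> R) : Prop :=
  Lp 1%:E r /\
  forall (dbar : R) (T : R -> R -> R), perturbed_family T0 Tdot dbar T ->
    (\int[lebesgue_measure]_(x in `[0%R, 1%R])
       (`|(acip (T delta) x - acip T0 x) / delta - r x|)%:E)%E
      @[delta --> 0^'+] --> 0%E.

(* R(Tdot), determined up to equality almost everywhere.                      *)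
Definition linear_response {R : realType} (T0 Tdot : R -> R) : R -> R :=
  xget (fun=> 0) [set r | is_linear_response T0 Tdot r].

Definition objective {R : realType} (T0 c Tdot : R -> R) : R :=
  - circle_integral (fun x => c x * linear_response T0 Tdot x).

Definition is_minimiser {R : realType} (T0 c Tdot : R -> R) : Prop :=
  [/\ H4 Tdot, H4norm Tdot <= 1 &
      forall S, H4 S -> H4norm S <= 1 ->
        objective T0 c Tdot <= objective T0 c S].

(* (I - L)^{-1} g, where L is the transfer operator of T and I - L acts on the *)
(* zero-mean functions of W^{1,1}(S^1, C).                                    *)
Definition resolvent {R : realType} (T : R -> R) (g : R -> R[i]) : R -> R[i] :=
  xget (fun=> 0) [set h | [/\ complex_W11 h, complex_integral h = 0 &
                              forall x, h x - transfer T h x = g x]].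

Definition fourier_mode {R : realType} (n : int) (x : R) : R[i] :=
  Complex (cos (2 * pi * n%:~R * x)) (sin (2 * pi * n%:~R * x)).

Definition H4weight {R : realType} (n : int) : R :=
  \sum_(k < 5) (4 * pi ^+ 2 * n%:~R ^+ 2) ^+ k.

(* The minus sign is that of the response formula                             *)
(*   R(Tdot) = - (I - L_0)^{-1} L_0 ([f_0 Tdot / T_0']'),                     *)
(* so that this is the maximiser of the integral of c R(Tdot), and not its    *)
(* opposite, when nu > 0.                                                     *)
Definition optimal_coef {R : realType} (T0 c : R -> R) (nu : R) (n : int) :
    R[i] :=
  - (complex_integral (fun x => (c x)%:C%C *
       (resolvent T0 (transfer T0 (complex_derive
          (fun y => fourier_mode n y * (acip T0 y)%:C%C / (derive1 T0 y)%:C%C)))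
        x)^* ))
  / (2 * nu * H4weight n)%:C%C.

(* f = sum over n in Z of a_n e_n, as the limit of the symmetric partial sums.*)
Definition fourier_sum {R : realType} (a : int -> R[i]) (f : R -> R) : Prop :=
  forall x, (\sum_(k < N.*2.+1)
      a (k%:Z - N%:Z) * fourier_mode (k%:Z - N%:Z) x : R[i]^o)
    @[N --> \oo] --> ((f x)%:C%C : R[i]^o).

Definition coef_normalised {R : realType} (a : int -> R[i]) : Prop :=
  (\esum_(n in [set: int])
     (H4weight n * Normc.normc (a n) ^+ 2)%:E = 1)%E.

(* Main.v *)
Require Import Defs.
From mathcomp Require Import measurable_realfun ess_sup_inf ring lra zify.

(** The optimal perturbation is a Riesz representative. For a direction [S] of
class C^3 the linear response is [r = - (I - L0)^-1 L0 ((f0 S / T0')')], which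
depends linearly on [S] and is bounded in the sup norm by the C^2 norm of [S]
([direction_response_lin], [direction_response_bound]). Hence the expected
response [ell S = \int c r] is a linear functional which acts termwise on
Fourier series that converge in C^2; functions in H^4 have such Fourier series
([H4_fourier], [ell_H4]). In the coordinates given by Fourier coefficients the
norm of H^4 is a weighted l^2 norm, and the coefficients in the theorem are
the values of [ell] on the conjugates of the modes [e_n], divided by twice the
multiplier and by the weight ([optimal_coefE]). Completing the square
([ell_gap]) shows that, for normalised coefficients, [ell <= 2 nu] on the unit
ball, with equality only at the function with these coefficients, which is of
class C^4 since these values are [O(n^2)] and the weight is of order [n^8]. A
multiplier exists as soon as [ell] does not vanish on H^4
([normalising_multiplier]).

The analysis is in the formula for the response, and it is carried out on real
functions with explicit derivatives and sup norms. An expanding map of class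
C^3 has, through the inverse [psi] of a lift, the transfer operator
[L f x = \sum_(j < D) |psi' (x + j)| f (psi (x + j))] ([transferE]). It
contracts the cone of nonnegative functions with bounded logarithmic
derivative, with room to subtract a constant from each density; two densities
lose the same constant, so their images approach each other exponentially fast
([cone_gap]). Writing a zero-mean function as a multiple of a difference of
densities gives exponential decay in C^1 and C^2 ([decay1], [decay2]), and so
the Neumann series for the resolvent ([resolvent1], [resolvent2]) and the
invariant density as a limit of iterates of the constant one
([invariant_spec]). These agree with [resolvent] and [acip] by uniqueness: a
continuous zero-mean fixed point of [L] vanishes, because it is a uniform
limit of smooth zero-mean functions, its Fejer means ([fixed_point_eq0],
[smooth_approx]); and being an invariant density means being fixed by [L], by
duality and a monotone class argument from continuous functions to periodic
sets ([invariant_densityP]).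

For a perturbed family the difference quotient of the densities minus the
candidate response, [e], satisfies [e - L_del e = p], where [p] is O(del)
uniformly and bounded in C^1, by a first order expansion of the inverse
branches ([O_branch], [O_density], [O_residual]). Since the spectral gap is
uniform for small [del], the first terms of the Neumann series for [e] are
small by the sup norm of [p] and the others by exponential decay
([inverse_bound]), so that [e] tends to zero uniformly ([response_limit]). *)

Set Implicit Arguments.
Unset Strict Implicit.
Unset Printing Implicit Defensive.

(** * Functions with an explicit derivative *)

Section RealAnalysis.
Variable R : realType.
Implicit Types (f g F : R -> R) (x y : R).

(** Derivatives are carried along as explicit functions, because the bounds in
the cones below relate [f1] to [f] pointwise. *)
Definition has_deriv f f1 := forall x, is_derive x (1 : R) f (f1 x).

Lemma has_deriv_continuous f f1 : has_deriv f f1 -> continuous f.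
Proof.
by move=> hf x; apply/differentiable_continuous/derivable1_diffP; case: (hf x).
Qed.

Lemma has_deriv_derive1 f f1 : has_deriv f f1 -> derive1 f = f1.
Proof. by move=> hf; apply/funext => x; rewrite derive1E; case: (hf x). Qed.

Lemma has_deriv_uniq f f1 f2 : has_deriv f f1 -> has_deriv f f2 -> f1 = f2.
Proof. by move=> /has_deriv_derive1 <- /has_deriv_derive1 <-. Qed.

Lemma has_deriv_cst k : has_deriv (fun=> k) (fun=> 0).
Proof. by move=> x; exact: is_derive_cst. Qed.

Lemma has_deriv_id : has_deriv (fun x => x) (fun=> 1).
Proof. by move=> x; exact: is_derive_id. Qed.

Lemma has_derivD f f1 g g1 : has_deriv f f1 -> has_deriv g g1 ->
  has_deriv (fun x => f x + g x) (fun x => f1 x + g1 x).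
Proof. by move=> hf hg x; exact: is_deriveD. Qed.

Lemma has_derivN f f1 : has_deriv f f1 ->
  has_deriv (fun x => - f x) (fun x => - f1 x).
Proof. by move=> hf x; exact: is_deriveN. Qed.

Lemma has_derivB f f1 g g1 : has_deriv f f1 -> has_deriv g g1 ->
  has_deriv (fun x => f x - g x) (fun x => f1 x - g1 x).
Proof. by move=> hf hg x; exact: is_deriveB. Qed.

Lemma has_derivM f f1 g g1 : has_deriv f f1 -> has_deriv g g1 ->
  has_deriv (fun x => f x * g x) (fun x => f1 x * g x + f x * g1 x).
Proof.
move=> hf hg x; have := @is_deriveM _ _ f g x 1 _ _ (hf x) (hg x).
by move/is_derive_eq; apply; rewrite /GRing.scale /=; ring.
Qed.

Lemma has_derivZ k f f1 : has_deriv f f1 ->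
  has_deriv (fun x => k * f x) (fun x => k * f1 x).
Proof.
move=> hf; have := has_derivM (has_deriv_cst k) hf.
by congr has_deriv; apply/funext => x; rewrite mul0r add0r.
Qed.

Lemma has_deriv_comp f f1 g g1 : has_deriv f f1 -> has_deriv g g1 ->
  has_deriv (fun x => f (g x)) (fun x => f1 (g x) * g1 x).
Proof. by move=> hf hg x; exact: is_derive1_comp. Qed.

Lemma has_deriv_shift k f f1 : has_deriv f f1 ->
  has_deriv (fun x => f (x + k)) (fun x => f1 (x + k)).
Proof.
move=> hf.
have := has_deriv_comp hf (has_derivD has_deriv_id (has_deriv_cst k)).
by congr has_deriv; apply/funext => x; rewrite addr0 mulr1.
Qed.

Lemma has_derivV f f1 : has_deriv f f1 -> (forall x, f x != 0) ->
  has_deriv (fun x => (f x)^-1) (fun x => - f1 x / f x ^+ 2).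
Proof.
move=> hf f0 x; have := @is_deriveV _ f x _ 1 (f0 x) (hf x).
by move/is_derive_eq; apply; rewrite /GRing.scale /= !mulNr mulrC.
Qed.

Lemma has_deriv_sum n (f f1 : 'I_n -> R -> R) :
  (forall i, has_deriv (f i) (f1 i)) ->
  has_deriv (fun x => \sum_(i < n) f i x) (fun x => \sum_(i < n) f1 i x).
Proof.
move=> hf x; have /= := @is_derive_sum _ _ _ n f x 1 (fun i => f1 i x)
  (fun i => hf i x).
congr is_derive.
by apply/funext => y; rewrite fct_sumE.
Qed.

Lemma has_deriv_ext f f1 g g1 : has_deriv f f1 -> f =1 g -> f1 =1 g1 ->
  has_deriv g g1.
Proof. by move=> h /funext <- /funext <-. Qed.

Lemma mvt_between f f1 x y : has_deriv f f1 ->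
  exists2 c, `|c - x| <= `|y - x| & f y - f x = f1 c * (y - x).
Proof.
move=> hf; have cf := continuous_subspaceT (has_deriv_continuous hf).
case: (leP x y) => xy.
  have [c] := MVT_segment xy (fun z _ => hf z) (cf _).
  rewrite in_itv /= => /andP[c1 c2] ->; exists c => //.
  by rewrite !ger0_norm ?subr_ge0 // lerB.
have [c] := MVT_segment (ltW xy) (fun z _ => hf z) (cf _).
rewrite in_itv /= => /andP[c1 c2] e; exists c; last by rewrite -opprB e; ring.
by rewrite distrC [leRHS]distrC !ger0_norm ?subr_ge0 // ?(ltW xy) // lerB.
Qed.

Lemma has_deriv_mvt f f1 x y : has_deriv f f1 ->
  exists c, f y - f x = f1 c * (y - x).
Proof. by move=> hf; have [c _ e] := mvt_between x y hf; exists c. Qed.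

Lemma has_deriv_lip f f1 B : has_deriv f f1 -> (forall x, `|f1 x| <= B) ->
  forall x y, `|f x - f y| <= B * `|x - y|.
Proof.
move=> hf hB x y; have [c ->] := has_deriv_mvt y x hf.
by rewrite normrM ler_wpM2r.
Qed.

Lemma has_deriv_nondecr f f1 : has_deriv f f1 -> (forall x, 0 <= f1 x) ->
  forall x y, x <= y -> f x <= f y.
Proof.
move=> hf h x y xy; have [c e] := has_deriv_mvt x y hf.
by rewrite -subr_ge0 e mulr_ge0 ?subr_ge0.
Qed.

(** Only the derivatives need to converge uniformly: by the mean value theorem
the difference quotients of [u n] lie within [e n] of values of [U1] near [x],
and this survives the pointwise limit of the quotients. *)
Lemma has_deriv_lim (u u1 : nat -> R -> R) U U1 (e : nat -> R) :
  (forall n, has_deriv (u n) (u1 n)) ->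
  (forall x, u ^~ x @ \oo --> U x) ->
  (forall n x, `|u1 n x - U1 x| <= e n) -> e @ \oo --> 0 ->
  continuous U1 -> has_deriv U U1.
Proof.
move=> hu hU hU1 he cU1 x.
suff : (fun h => h^-1 * (U (h + x) - U x)) @ 0^' --> U1 x.
  move=> hl; apply: DeriveDef.
    apply/cvg_ex; exists (U1 x); apply: cvg_trans hl.
    apply: near_eq_cvg; near=> h.
    by rewrite /GRing.scale /= mulr1.
  apply/cvg_lim => //; apply: cvg_trans hl.
  apply: near_eq_cvg; near=> h.
  by rewrite /GRing.scale /= mulr1.
apply/cvgrPdist_le => eps eps0.
have eps2 : 0 < eps / 2 by lra.
have /cvgrPdist_lt /(_ _ eps2) /nbhs_ballP [d /= d0 hd] := cU1 x.
have slope (h : R) : `|h| < d -> h != 0 ->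
    `|U1 x - h^-1 * (U (h + x) - U x)| <= eps / 2.
  move=> hh h0.
  have hn n : `|U1 x - h^-1 * (u n (h + x) - u n x)| <= eps / 2 + e n.
    have [c hc] : exists2 c, `|x - c| < d & u n (h + x) - u n x = u1 n c * h.
      have [c cx ->] := mvt_between x (h + x) (hu n); rewrite addrK in cx *.
      by exists c => //; rewrite distrC; exact: le_lt_trans cx hh.
    move=> ->; rewrite mulrCA mulVf // mulr1.
    rewrite -(subrKA (U1 c)); apply: le_trans (ler_normD _ _) _.
    by apply: lerD; [exact/ltW/hd|rewrite distrC].
  have L : (fun n => eps / 2 + e n) @ \oo --> eps / 2 + 0 by apply: cvgD => //; exact: cvg_cst.
  rewrite addr0 in L.
  apply: (ler_cvg_to _ L); last by near=> n; exact: hn.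
  apply: cvg_norm; apply: cvgB; first exact: cvg_cst.
  by apply: cvgM; [exact: cvg_cst|apply: cvgB; exact: hU].
near=> h.
apply: le_trans (slope h _ _) _; last by lra.
- near: h; apply: dnbhs0_lt; exact: d0.
- by near: h; exact: nbhs_dnbhs_neq.
Unshelve. all: by end_near. Qed.

(** The integer in the definition of a circle map disappears on
differentiating. *)
Lemma circle_map_deriv_periodic (T T1 : R -> R) (d : int) : has_deriv T T1 ->
  (forall x, T (x + 1) = T x + d%:~R) -> periodic T1 1.
Proof.
move=> hT hd; have h1 := has_deriv_shift 1 hT.
have h2 := has_derivD hT (has_deriv_cst (d%:~R : R)).
have e : (fun x => T (x + 1)) = (fun x => T x + d%:~R) by apply/funext.
rewrite e in h1; have := has_deriv_uniq h1 h2.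
by move=> /[swap] y /(congr1 (fun g => g y)); rewrite addr0.
Qed.

End RealAnalysis.


(** * Integrals and periodic functions *)

Section CircleIntegral.
Variable R : realType.
Implicit Types (f g F : R -> R) (x y : R).

Local Notation mu := (@lebesgue_measure R).
Local Notation I01 := (`[0%R, 1%R]%classic : set R).

Definition circle_integrable f := mu.-integrable I01 (EFin \o f).

Lemma measurable_I01 : measurable (I01 : set (measurableTypeR R)).
Proof. by []. Qed.
Local Hint Resolve measurable_I01 : core.

Lemma lebesgue_I01 : mu I01 = 1%E.
Proof. by rewrite lebesgue_measure_itv /= lte_fin ltr01 oppr0 adde0. Qed.

Lemma integrable_itv f (a b : R) : continuous f -> mu.-integrable `[a, b] (EFin \o f).
Proof.
move=> cf; apply: continuous_compact_integrable; first exact: segment_compact.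
exact: continuous_subspaceT.
Qed.

Lemma continuous_integrable f : continuous f -> circle_integrable f.
Proof. exact: integrable_itv. Qed.

Lemma circle_integrableD f g : circle_integrable f -> circle_integrable g ->
  circle_integrable (fun x => f x + g x).
Proof. by move=> hf hg; exact: (integrableD measurable_I01 hf hg). Qed.

Lemma circle_integrableZ k f : circle_integrable f ->
  circle_integrable (fun x => k * f x).
Proof. by move=> hf; exact: (integrableZl measurable_I01 k hf). Qed.

Lemma circle_integrableB f g : circle_integrable f -> circle_integrable g ->
  circle_integrable (fun x => f x - g x).
Proof.
move=> hf hg; have := circle_integrableD hf (circle_integrableZ (-1) hg).
by congr circle_integrable; apply/funext => x; rewrite mulN1r.
Qed.

Lemma circle_integrable_norm f : circle_integrable f ->
  circle_integrable (fun x => `|f x|).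
Proof. exact: integrable_norm. Qed.

Lemma continuous_bounded f : continuous f ->
  exists2 B, 0 <= B & forall x, 0 <= x <= 1 -> `|f x| <= B.
Proof.
move=> cf.
have cn : {within `[0, 1], continuous (fun x => `|f x|)}.
  apply: continuous_subspaceT => x.
  by apply: continuous_comp; [exact: cf|exact: norm_continuous].
have [c _ hc] := EVT_max (@ler01 R) cn.
by exists `|f c| => // x hx; apply: hc; rewrite in_itv.
Qed.

Lemma circle_integrableM f g : circle_integrable f -> continuous g ->
  circle_integrable (fun x => f x * g x).
Proof.
move=> hf cg; have [B B0 hB] := continuous_bounded cg.
apply: (integrableMl measurable_I01 hf).
  by apply: (@measurable_funS _ _ _ _ setT) => //; exact: continuous_measurable_fun.
exists B; split; first exact: num_real.
by move=> M BM x /= xI; apply: le_trans (ltW BM); apply: hB; move: xI; rewrite in_itv.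
Qed.

Lemma circle_integralD f g : circle_integrable f -> circle_integrable g ->
  circle_integral (fun x => f x + g x) = circle_integral f + circle_integral g.
Proof. by move=> hf hg; exact: RintegralD. Qed.

Lemma circle_integralB f g : circle_integrable f -> circle_integrable g ->
  circle_integral (fun x => f x - g x) = circle_integral f - circle_integral g.
Proof. by move=> hf hg; exact: RintegralB. Qed.

Lemma circle_integralZ k f : circle_integrable f ->
  circle_integral (fun x => k * f x) = k * circle_integral f.
Proof. by move=> hf; exact: RintegralZl. Qed.

Lemma circle_integral_cst (k : R) : circle_integral (fun=> k) = k.
Proof.
rewrite Rintegral_cst; last exact: measurable_I01.
rewrite [X in _ * fine X](_ : _ = 1%E) ?mulr1 //; exact: lebesgue_I01.
Qed.

Lemma circle_integral_eq f g : (forall x, 0 <= x <= 1 -> f x = g x) ->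
  circle_integral f = circle_integral g.
Proof.
by move=> fg; apply: eq_Rintegral => x /[!inE]/= xI; apply: fg; move: xI; rewrite in_itv.
Qed.

Lemma circle_integral_le f g : circle_integrable f -> circle_integrable g ->
  (forall x, 0 <= x <= 1 -> f x <= g x) -> circle_integral f <= circle_integral g.
Proof.
move=> hf hg fg; apply: le_Rintegral => // x /=; rewrite in_itv; exact: fg.
Qed.

Lemma circle_integral_ge0 f : (forall x, 0 <= f x) -> 0 <= circle_integral f.
Proof. by move=> f0; apply: Rintegral_ge0. Qed.

Lemma circle_integral_norm f : circle_integrable f ->
  `|circle_integral f| <= circle_integral (fun x => `|f x|).
Proof. by move=> hf; exact: le_normr_Rintegral. Qed.

Lemma circle_integral_norm_le f (B : R) : circle_integrable f ->
  (forall x, 0 <= x <= 1 -> `|f x| <= B) -> `|circle_integral f| <= B.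
Proof.
move=> hf hB; apply: le_trans (circle_integral_norm hf) _.
rewrite -[leRHS]circle_integral_cst; apply: circle_integral_le => //.
  exact: circle_integrable_norm.
by apply: continuous_integrable => x; exact: cvg_cst.
Qed.

Lemma circle_integrable_sum n (f : 'I_n -> R -> R) :
  (forall i, circle_integrable (f i)) ->
  circle_integrable (fun x => \sum_(i < n) f i x).
Proof.
move=> hf; have := @integrable_sum _ _ _ mu _ measurable_I01 _ (index_enum 'I_n)
  xpredT (fun i => EFin \o f i) (fun i _ => hf i).
by congr (integrable _ _ _); apply/funext => x /=; rewrite sumEFin.
Qed.

Lemma circle_integral_sum n (f : 'I_n -> R -> R) :
  (forall i, circle_integrable (f i)) ->
  circle_integral (fun x => \sum_(i < n) f i x) =
  \sum_(i < n) circle_integral (f i).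
Proof.
elim: n f => [|n IHn] f hf.
  rewrite big_ord0 -[RHS](circle_integral_cst 0); apply: circle_integral_eq => x _.
  by rewrite big_ord0.
rewrite big_ord_recl -IHn; last by move=> i; exact: hf.
rewrite -circle_integralD //; last by apply: circle_integrable_sum => i; exact: hf.
by apply: circle_integral_eq => x _; rewrite big_ord_recl.
Qed.

Lemma FTC f F a b : a <= b -> has_deriv F f -> continuous f ->
  Rintegral mu `[a, b] f = F b - F a.
Proof.
rewrite le_eqVlt => /predU1P[->|ab] hF cf.
  by rewrite set_itv1 Rintegral_set1 subrr.
have cF := has_deriv_continuous hF.
rewrite /Rintegral (@continuous_FTC2 _ f F a b) //=.
- exact: continuous_subspaceT.
- split=> [x _| |]; first by case: (hF x).
  + exact/cvg_at_right_filter/cF.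
  + exact/cvg_at_left_filter/cF.
- by move=> x _; rewrite (has_deriv_derive1 hF).
Qed.

Lemma circle_integral_deriv f F : has_deriv F f -> continuous f ->
  circle_integral f = F 1 - F 0.
Proof. by move=> hF cf; rewrite (FTC _ hF). Qed.

Lemma has_deriv_local f f1 : (forall x, exists g, (\near x, g x = f x) /\
  is_derive x (1 : R) g (f1 x)) -> has_deriv f f1.
Proof. by move=> h x; have [g [gf hg]] := h x; exact: near_eq_is_derive hg. Qed.

(** The integral from a fixed base point is an antiderivative only to the
right of that point; differences of integrals do not depend on the base point,
so that locally it can be pushed to the left of [x]. *)
Lemma antiderivative f : continuous f -> exists F, has_deriv F f.
Proof.
move=> cf.
have [P PB PD] : exists2 P : R -> R -> R,
    forall a b x y, a <= b -> b <= x -> b <= y -> P a x - P a y = P b x - P b y &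
    forall a x, a < x -> is_derive x (1 : R) (P a) (f x).
  pose P (a x : R) := Rintegral mu `[a, x] f.
  have PB (a b x : R) : a <= b -> b <= x -> P a x - P a b = Rintegral mu `]b, x] f.
    move=> ab bx; rewrite /P (@Rintegral_itvB _ _ (BLeft a) (BRight x)) //.
    exact: integrable_itv.
  exists P => [a b x y ab bx by_|a x ax].
    have E c : c <= b -> P c x - P c y = Rintegral mu `]b, x] f - Rintegral mu `]b, y] f.
      by move=> cb; rewrite -!(PB c) // opprB [RHS]addrA subrK.
    exact: etrans (E a ab) (esym (E b (lexx b))).
  have [d1 d2] := @continuous_FTC1_closed _ f a x (x + 1) (ltr_pwDr ltr01 (lexx x))
    (integrable_itv a (x + 1) cf) ax (cf x).
  by apply: DeriveDef; [exact: d1|rewrite -derive1E].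
(* The base point moves with [x] but stays to the left of both [x] and [0]. *)
exists (fun x => P (- `|x| - 1) x - P (- `|x| - 1) 0); apply: has_deriv_local => x.
have ax : - x <= `|x| by rewrite -normrN ler_norm.
exists (fun y => P (- `|x| - 2) y - P (- `|x| - 2) 0); split.
  near=> y; have hy : `|x - y| < 1 by near: y; apply: nbhsx_ballx.
  have y1 : `|y| <= `|x| + 1.
    rewrite -lerBlDl; apply: le_trans (lerB_dist _ _) _.
    by rewrite distrC ltW.
  have y2 : - y <= `|y| by rewrite -normrN ler_norm.
  have y3 : 0 <= `|y| by [].
  by apply: PB; lra.
have ax2 : - `|x| - 2 < x by lra.
have := @is_deriveB _ _ _ _ _ x 1 _ _ (PD _ _ ax2)
  (@is_derive_cst _ R R (P (- `|x| - 2) 0) x 1).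
by rewrite subr0.
Unshelve. all: by end_near. Qed.

Lemma periodicZ f : periodic f 1 -> forall x (m : int), f (x + m%:~R) = f x.
Proof.
move=> pf x [n|n].
  elim: n x => [|n IH] x; first by rewrite addr0.
  by rewrite -addn1 PoszD intrD addrA pf IH.
rewrite NegzE; elim: n x => [|n IH] x.
  by rewrite -[LHS]pf rmorphN /= subrK.
rewrite -[LHS]pf -[RHS]IH; congr f.
by rewrite !rmorphN /= -[n.+2]addn1 PoszD intrD; ring.
Qed.

Lemma frac_bound (z : R) : 0 <= z - (Num.floor z)%:~R < 1.
Proof.
by rewrite subr_ge0 ge_floor /= ltrBlDl -{2}[1]/(1%:~R) -intrD floorD1_gt.
Qed.

Lemma periodic_reduce f : periodic f 1 ->
  forall x, exists2 y, 0 <= y < 1 & f x = f y.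
Proof.
move=> pf x; exists (x - (Num.floor x)%:~R).
  exact: frac_bound.
by rewrite -rmorphN /= periodicZ.
Qed.

Lemma periodic_bounded f : continuous f -> periodic f 1 ->
  exists2 B, 0 <= B & forall x, `|f x| <= B.
Proof.
move=> cf pf; have [B B0 hB] := continuous_bounded cf.
exists B => // x; have [y /andP[y0 y1] ->] := periodic_reduce pf x.
by apply: hB; rewrite y0 ltW.
Qed.

Lemma has_deriv_periodic f f1 : has_deriv f f1 -> periodic f 1 -> periodic f1 1.
Proof.
move=> hf pf x; have h := has_deriv_shift 1 hf.
have e : (fun x => f (x + 1)) = f by apply/funext => y; rewrite pf.
by rewrite e in h; rewrite {2}(has_deriv_uniq hf h).
Qed.

Lemma circle_integral_deriv0 f F : has_deriv F f -> continuous f ->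
  periodic F 1 -> circle_integral f = 0.
Proof.
by move=> hF cf pF; rewrite (circle_integral_deriv hF) // -{1}[1]add0r pF subrr.
Qed.

(** There are no boundary terms for periodic functions. *)
Lemma circle_by_parts f f1 g g1 : has_deriv f f1 -> has_deriv g g1 ->
  continuous f1 -> continuous g1 -> periodic f 1 -> periodic g 1 ->
  circle_integral (fun x => f x * g1 x) = - circle_integral (fun x => f1 x * g x).
Proof.
move=> hf hg cf cg pf pg.
have cf0 := has_deriv_continuous hf; have cg0 := has_deriv_continuous hg.
have c1 : continuous (fun x => f1 x * g x).
  by move=> x; apply: cvgM; [exact: cf|exact: cg0].
have c2 : continuous (fun x => f x * g1 x).
  by move=> x; apply: cvgM; [exact: cf0|exact: cg].
apply/eqP; rewrite -subr_eq0 opprK addrC -circle_integralD; try exact: continuous_integrable.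
apply/eqP; apply: (circle_integral_deriv0 (has_derivM hf hg)).
  by move=> x; apply: cvgD; [exact: c1|exact: c2].
by move=> x; rewrite pf pg.
Qed.

Lemma circle_integral_le_cst f (k : R) : continuous f ->
  (forall x, f x <= k) -> circle_integral f <= k.
Proof.
move=> cf h; rewrite -[leRHS]circle_integral_cst; apply: circle_integral_le => //.
  exact: continuous_integrable.
by apply: continuous_integrable => x; exact: cvg_cst.
Qed.

Lemma circle_integral_ge_cst f (k : R) : continuous f ->
  (forall x, k <= f x) -> k <= circle_integral f.
Proof.
move=> cf h; rewrite -[leLHS]circle_integral_cst; apply: circle_integral_le => //.
  by apply: continuous_integrable => x; exact: cvg_cst.
exact: continuous_integrable.
Qed.

End CircleIntegral.
#[global] Hint Resolve measurable_I01 : core.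


(** * Uniformly convergent series *)

Section FunctionSeries.
Variable R : realType.
Implicit Types (u : nat -> R -> R) (e : nat -> R) (x : R).

Lemma continuous_sum n (f : 'I_n -> R -> R) : (forall i, continuous (f i)) ->
  continuous (fun x => \sum_(i < n) f i x).
Proof.
elim: n f => [|n IHn] f cf.
  by under eq_fun do rewrite big_ord0; move=> x; exact: cvg_cst.
under eq_fun do rewrite big_ord_recl.
move=> x; apply: cvgD; first exact: cf.
by apply: (IHn (fun i => f (lift ord0 i))) => i; exact: cf.
Qed.

Definition fsum u x : R := limn (fun n => \sum_(k < n) u k x).

(** Bounds the remainder of a series that is dominated termwise by a series
with terms [e n]. *)
Definition tail e n : R := limn (series e) - series e n.

Definition majorised u e := (forall k x, `|u k x| <= e k) /\ cvgn (series e).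

Lemma majorised_cvg u e x : majorised u e ->
  (fun n => \sum_(k < n) u k x) @ \oo --> fsum u x.
Proof.
move=> [ue ce].
have -> : (fun n => \sum_(k < n) u k x) = series (u ^~ x).
  by apply/funext => n; rewrite /series /= big_mkord.
rewrite /fsum.
have -> : (fun n => \sum_(k < n) u k x) = series (u ^~ x).
  by apply/funext => n; rewrite /series /= big_mkord.
have e0 n : 0 <= e n := le_trans (normr_ge0 _) (ue n x).
by apply: normed_cvg; apply: series_le_cvg ce => n //=.
Qed.

Lemma majorised_tail u e n x : majorised u e ->
  `|\sum_(k < n) u k x - fsum u x| <= tail e n.
Proof.
move=> ue; have hu := majorised_cvg (x := x) ue; case: ue => ue ce.
have L1 : (fun m => `|\sum_(k < n) u k x - \sum_(k < m) u k x|) @ \oo -->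
    `|\sum_(k < n) u k x - fsum u x|.
  by apply: cvg_norm; apply: cvgB hu; exact: cvg_cst.
have L2 : (fun m => series e m - series e n) @ \oo --> tail e n.
  by apply: cvgB; [exact: ce|exact: cvg_cst].
apply: (ler_cvg_to L1 L2); near=> m.
have nm : (n <= m)%N by near: m; exact: nbhs_infty_ge.
rewrite /series /= -!(big_mkord xpredT (u ^~ x)).
rewrite !(@big_cat_nat _ _ _ n 0%N m) //= opprD addrA subrr add0r normrN.
rewrite [leRHS]addrAC subrr add0r.
by apply: le_trans (ler_norm_sum _ _ _) _; apply: ler_sum => k _; exact: ue.
Unshelve. all: by end_near. Qed.

Lemma tail_cvg0 u e : majorised u e -> tail e @ \oo --> 0.
Proof.
move=> [_ ce]; rewrite -(subrr (limn (series e))).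
by apply: cvgB; [exact: cvg_cst|exact: ce].
Qed.

Lemma fsum_bound u e x : majorised u e -> `|fsum u x| <= limn (series e).
Proof.
move=> /(@majorised_tail _ _ 0 x); rewrite big_ord0 sub0r normrN /tail.
by rewrite /series /= big_geq // subr0.
Qed.

Lemma uniform_limit_continuous_real (S : nat -> R -> R) U e :
  (forall n, continuous (S n)) -> (forall n x, `|S n x - U x| <= e n) ->
  e @ \oo --> 0 -> continuous U.
Proof.
move=> cS SU e0 x; apply/cvgrPdist_le => eps eps0.
have eps3 : 0 < eps / 3 by lra.
have /cvgrPdist_le /(_ _ eps3) [n _ hn] := e0.
have {hn} en : e n <= eps / 3.
  by have := hn n (leqnn n); rewrite /= sub0r normrN => /(le_trans (ler_norm _)).
have /cvgrPdist_le /(_ _ eps3) hx := cS n x.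
near=> y.
have h1 := SU n x; have h2 := SU n y.
have h3 : `|S n x - S n y| <= eps / 3 by near: y; exact: hx.
have -> : U x - U y = (S n x - S n y) - (S n x - U x) + (S n y - U y) by ring.
apply: le_trans (ler_normD _ _) _.
apply: le_trans (lerD (ler_normB _ _) (lexx _)) _.
lra.
Unshelve. all: by end_near. Qed.

Lemma fsum_continuous u e : majorised u e -> (forall k, continuous (u k)) ->
  continuous (fsum u).
Proof.
move=> ue cu; apply: (uniform_limit_continuous_real _ (fun n x => majorised_tail n x ue)).
  by move=> n; apply: continuous_sum.
exact: tail_cvg0 ue.
Qed.

(** Termwise differentiation, by the Weierstrass test for both series. *)
Lemma fsum_deriv u u1 e e1 : majorised u e -> majorised u1 e1 ->
  (forall k, has_deriv (u k) (u1 k)) -> (forall k, continuous (u1 k)) ->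
  has_deriv (fsum u) (fsum u1).
Proof.
move=> ue ue1 hu cu1.
apply: (@has_deriv_lim _ (fun n x => \sum_(k < n) u k x)
  (fun n x => \sum_(k < n) u1 k x) _ _ (tail e1)).
- by move=> n; apply: has_deriv_sum => k; exact: hu.
- by move=> x; exact: majorised_cvg ue.
- by move=> n x; exact: majorised_tail ue1.
- exact: tail_cvg0 ue1.
- exact: fsum_continuous ue1 cu1.
Qed.

Lemma fsum_periodic u : (forall k, periodic (u k) 1) -> periodic (fsum u) 1.
Proof.
move=> pu x; rewrite /fsum; congr (limn _); apply/funext => n.
by apply: eq_bigr => k _; exact: pu.
Qed.

Lemma uniform_circle_integral (S : nat -> R -> R) U e :
  (forall n, continuous (S n)) -> (forall n x, `|S n x - U x| <= e n) ->
  e @ \oo --> 0 -> (fun n => circle_integral (S n)) @ \oo --> circle_integral U.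
Proof.
move=> cS SU e0; have cU := uniform_limit_continuous_real cS SU e0.
apply/cvgrPdist_le => eps eps0.
have /cvgrPdist_le /(_ _ eps0) he := e0.
near=> n.
have en : e n <= eps.
  apply: le_trans (ler_norm _) _; rewrite -normrN -[- e n]add0r; near: n; exact: he.
rewrite -circle_integralB; try exact: continuous_integrable.
apply: circle_integral_norm_le.
  by apply: continuous_integrable => x; apply: cvgB; [exact: cU|exact: cS].
by move=> x _; rewrite distrC; exact: le_trans (SU n x) en.
Unshelve. all: by end_near. Qed.

Lemma fsum_circle_integral u e : majorised u e -> (forall k, continuous (u k)) ->
  (fun n => \sum_(k < n) circle_integral (u k)) @ \oo --> circle_integral (fsum u).
Proof.
move=> ue cu.
have cS n : continuous (fun x => \sum_(k < n) u k x).
  by apply: continuous_sum.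
have -> : (fun n => \sum_(k < n) circle_integral (u k)) =
    (fun n => circle_integral (fun x => \sum_(k < n) u k x)).
  by apply/funext => n; rewrite circle_integral_sum // => i; exact/continuous_integrable/cu.
exact: uniform_circle_integral cS (fun n x => majorised_tail n x ue) (tail_cvg0 ue).
Qed.

Lemma geometric_majorised u (B th : R) : 0 <= th < 1 ->
  (forall k x, `|u k x| <= B * th ^+ k) ->
  majorised u (geometric B th) /\ limn (series (geometric B th)) = B / (1 - th).
Proof.
move=> /andP[th0 th1] hu.
have nth : `|th| < 1 by rewrite ger0_norm.
split; first by split=> //; exact: is_cvg_geometric_series.
by apply/cvg_lim => //; exact: cvg_geometric_series.
Qed.

End FunctionSeries.


(** * The transfer operator of an expanding map, and its cones *)

Section TransferOperator.
Variable R : realType.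

(** [psi] is the inverse of a lift of degree [s * D], where [s] is the
constant sign of the derivative of the lift. The points over [x] are
represented by [psi (x + j)] for [j < D]; [al] bounds the contraction of [psi]
and [K] its distortion, the ratio of [psi2] to [psi1]. *)
Record inverse_branch (D : nat) (s : R) (psi psi1 psi2 : R -> R) (al K : R) : Prop :=
  InverseBranch {
    branch_sign : s = 1 \/ s = -1;
    branch_deriv : has_deriv psi psi1;
    branch_deriv2 : has_deriv psi1 psi2;
    branch_cont2 : continuous psi2;
    branch_shift : forall x, psi (x + D%:R) = psi x + s;
    branch_gt0 : forall x, 0 < s * psi1 x;
    branch_contr : forall x, s * psi1 x <= al;
    branch_dist : forall x, `|psi2 x| <= K * (s * psi1 x);
    branch_al : al < 1 }.

Variables (D : nat) (s : R) (psi psi1 psi2 : R -> R) (al K : R).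
Hypothesis B : inverse_branch D s psi psi1 psi2 al K.
Implicit Types (f g h : R -> R) (x y : R).

Definition Lop f x : R := \sum_(j < D) (s * psi1 (x + j%:R)) * f (psi (x + j%:R)).

Let hpsi : has_deriv psi psi1 := branch_deriv B.
Let hpsi1 : has_deriv psi1 psi2 := branch_deriv2 B.
Let w_gt0 x : 0 < s * psi1 x := branch_gt0 B x.

Lemma branch_al_gt0 : 0 < al.
Proof. exact: lt_le_trans (branch_gt0 B 0) (branch_contr B 0). Qed.

Lemma branch_K_ge0 : 0 <= K.
Proof.
by have := le_trans (normr_ge0 _) (branch_dist B 0); rewrite pmulr_lge0.
Qed.

Lemma branch_norm1 x : `|psi1 x| = s * psi1 x.
Proof.
have := w_gt0 x; case: (branch_sign B) => ->; first by rewrite mul1r => /gtr0_norm.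
by rewrite mulN1r oppr_gt0 => /ltr0_norm.
Qed.

Lemma branch_shift1 x : psi1 (x + D%:R) = psi1 x.
Proof.
have h1 := has_deriv_shift D%:R hpsi.
have h2 := has_derivD hpsi (has_deriv_cst s).
have e : (fun x => psi (x + D%:R)) = (fun x => psi x + s).
  by apply/funext => y; exact: branch_shift B y.
rewrite e in h1; have := has_deriv_uniq h1 h2.
by move=> /(congr1 (fun g => g x)); rewrite addr0.
Qed.

Lemma periodic_sign f : periodic f 1 -> forall x, f (x + s) = f x.
Proof.
move=> pf x; case: (branch_sign B) => ->; first exact: pf.
by rewrite -[LHS]pf subrK.
Qed.

Lemma Lop_periodic f : periodic f 1 -> periodic (Lop f) 1.
Proof.
move=> pf x; rewrite /Lop.
pose G y := (s * psi1 y) * f (psi y).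
have GD y : G (y + D%:R) = G y.
  by rewrite /G branch_shift1 (branch_shift B) periodic_sign.
rewrite -(big_mkord xpredT (fun j => G (x + j%:R))).
rewrite -(big_mkord xpredT (fun j => G (x + 1 + j%:R))).
have e : forall n, \sum_(0 <= j < n) G (x + 1 + j%:R) + G x =
    \sum_(0 <= j < n) G (x + j%:R) + G (x + n%:R).
  elim=> [|n IHn]; first by rewrite !big_nil addr0.
  rewrite !big_nat_recr //= addrAC IHn; congr (_ + _); congr G.
  by rewrite -addrA -natr1 [1 + _]addrC.
by have := e D; rewrite GD => /addIr.
Qed.

Lemma Lop_continuous f : continuous f -> continuous (Lop f).
Proof.
move=> cf; apply: continuous_sum => j.
have c x : {for x, continuous (fun y : R => y + j%:R)}.
  by apply: cvgD; [exact: cvg_id|exact: cvg_cst].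
move=> x; apply: cvgM.
  apply: cvgM; first exact: cvg_cst.
  by apply: continuous_comp (c x) _; exact: has_deriv_continuous hpsi1 _.
apply: continuous_comp; last exact: cf.
by apply: continuous_comp (c x) _; exact: has_deriv_continuous hpsi _.
Qed.

Lemma LopD f g : Lop (fun x => f x + g x) = fun x => Lop f x + Lop g x.
Proof.
apply/funext => x; rewrite /Lop -big_split /=; apply: eq_bigr => j _.
by rewrite mulrDr.
Qed.

Lemma LopZ k f : Lop (fun x => k * f x) = fun x => k * Lop f x.
Proof.
apply/funext => x; rewrite /Lop mulr_sumr; apply: eq_bigr => j _.
by rewrite mulrCA.
Qed.

Lemma LopB f g : Lop (fun x => f x - g x) = fun x => Lop f x - Lop g x.
Proof.
apply/funext => x; rewrite /Lop -sumrB; apply: eq_bigr => j _.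
by rewrite mulrBr.
Qed.

Lemma Lop_le f g : (forall x, f x <= g x) -> forall x, Lop f x <= Lop g x.
Proof.
by move=> fg x; apply: ler_sum => j _; rewrite ler_pM2l.
Qed.

Lemma Lop_norm f x : `|Lop f x| <= Lop (fun y => `|f y|) x.
Proof.
apply: le_trans (ler_norm_sum _ _ _) _; apply: ler_sum => j _.
by rewrite normrM (gtr0_norm (w_gt0 _)).
Qed.

Lemma Lop_ge0 f : (forall x, 0 <= f x) -> forall x, 0 <= Lop f x.
Proof. by move=> f0 x; apply: sumr_ge0 => j _; rewrite mulr_ge0 // ltW. Qed.

(** Each term of [Lop f] is the derivative of [s * F (psi (x + j))] for an
antiderivative [F] of [f]. The increments over a period telescope to the
increment of [s * F] between [psi 0] and [psi D = psi 0 + s]. *)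
Lemma Lop_integral f : continuous f -> periodic f 1 ->
  circle_integral (Lop f) = circle_integral f.
Proof.
move=> cf pf; have [F hF] := antiderivative cf.
pose G y := s * F (psi y).
have hG : has_deriv G (fun y => (s * psi1 y) * f (psi y)).
  apply: has_deriv_ext (has_derivZ s (has_deriv_comp hF hpsi)) _ _ => // y.
  by rewrite mulrCA mulrC -mulrA [psi1 _ * _]mulrC mulrA mulrC mulrA.
have hL : has_deriv (fun x => \sum_(j < D) G (x + j%:R)) (Lop f).
  by apply: has_deriv_sum => j; exact: (has_deriv_shift _ hG).
rewrite (circle_integral_deriv hL (Lop_continuous cf)).
have tel : forall n, \sum_(j < n) G (1 + j%:R) - \sum_(j < n) G (0 + j%:R) = G n%:R - G 0.
  elim=> [|n IHn]; first by rewrite !big_ord0 !subrr.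
  rewrite !big_ord_recr /= opprD addrACA IHn add0r -natr1 [1 + _]addrC.
  by rewrite addrC addrA subrK.
rewrite tel /G -[D%:R]add0r (branch_shift B) -mulrBr.
have inc y : F (y + 1) - F y = circle_integral f.
  rewrite (circle_integral_deriv hF cf) -[X in F X - F 0]add0r.
  have hd : forall z, is_derive z (1 : R) (fun z => F (z + 1) - F z) 0.
    move=> z; have := has_derivB (has_deriv_shift 1 hF) hF z.
    by rewrite pf subrr.
  exact: is_derive_0_is_cst hd.
case: (branch_sign B) => ->; first by rewrite mul1r inc.
by rewrite mulN1r opprB -(inc (psi 0 - 1)) subrK.
Qed.

(** The derivative of [Lop f] when [f1] is that of [f]: the first summand
comes from the weight, the second, which carries the contraction twice, from
[f]. *)
Definition Lop1 f f1 x : R := \sum_(j < D)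
  ((s * psi2 (x + j%:R)) * f (psi (x + j%:R)) +
   (s * psi1 (x + j%:R)) * (f1 (psi (x + j%:R)) * psi1 (x + j%:R))).

Lemma has_deriv_Lop f f1 : has_deriv f f1 -> has_deriv (Lop f) (Lop1 f f1).
Proof.
move=> hf; apply: has_deriv_sum => j.
apply: (has_deriv_shift j%:R (f := fun x => s * psi1 x * f (psi x))
  (f1 := fun x => s * psi2 x * f (psi x) + s * psi1 x * (f1 (psi x) * psi1 x))).
exact: has_derivM (has_derivZ s hpsi1) (has_deriv_comp hf hpsi).
Qed.

Lemma continuous_comp_shift (k : R) f g : continuous f -> continuous g ->
  continuous (fun x => f (g (x + k))).
Proof.
move=> cf cg x; apply: (continuous_comp (f := fun y => g (y + k))); last exact: cf.
apply: (continuous_comp (f := fun y : R => y + k)); last exact: cg.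
by apply: cvgD; [exact: cvg_id|exact: cvg_cst].
Qed.

Lemma Lop1_continuous f f1 : continuous f -> continuous f1 ->
  continuous (Lop1 f f1).
Proof.
move=> cf cf1; apply: continuous_sum => j x.
have c0 := has_deriv_continuous hpsi; have c1 := has_deriv_continuous hpsi1.
have ci : continuous (fun x : R => x) by move=> y; exact: cvg_id.
have c1j := @continuous_comp_shift j%:R _ _ c1 ci.
have c2j := @continuous_comp_shift j%:R _ _ (branch_cont2 B) ci.
have cfj := @continuous_comp_shift j%:R _ _ cf c0.
have cf1j := @continuous_comp_shift j%:R _ _ cf1 c0.
apply: cvgD; apply: cvgM; try apply: cvgM; try exact: cvg_cst.
- exact: c2j.
- exact: cfj.
- exact: c1j.
- exact: cf1j.
- exact: c1j.
Qed.

(** The Lasota-Yorke inequality in cone form: the logarithmic derivative of a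
nonnegative function is contracted by [al], up to the distortion. *)
Lemma Lop1_bound a f f1 : (forall x, 0 <= f x) -> (forall x, `|f1 x| <= a * f x) ->
  forall x, `|Lop1 f f1 x| <= (a * al + K) * Lop f x.
Proof.
move=> f0 hf1 x; rewrite /Lop mulr_sumr.
apply: le_trans (ler_norm_sum _ _ _) _; apply: ler_sum => j _.
set y := x + j%:R; have w := w_gt0 y.
apply: le_trans (ler_normD _ _) _.
rewrite !normrM (ger0_norm (f0 _)) branch_norm1.
have -> : `|s| = 1 by case: (branch_sign B) => ->; rewrite ?normrN normr1.
rewrite !mul1r mulrDl addrC; apply: lerD; last first.
  by rewrite mulrA; apply: ler_wpM2r (branch_dist B y).
have -> : a * al * (s * psi1 y * f (psi y)) = (s * psi1 y) * ((a * f (psi y)) * al).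
  by ring.
rewrite ler_pM2l //.
apply: ler_pM => //; first exact: ltW.
exact: branch_contr B y.
Qed.

Lemma Lop_iterB n f g :
  iter n Lop (fun x => f x - g x) = fun x => iter n Lop f x - iter n Lop g x.
Proof. by elim: n => //= n ->; rewrite LopB. Qed.

Lemma Lop_iterZ n k f :
  iter n Lop (fun x => k * f x) = fun x => k * iter n Lop f x.
Proof. by elim: n => //= n ->; rewrite LopZ. Qed.

Lemma Lop_iterD n f g :
  iter n Lop (fun x => f x + g x) = fun x => iter n Lop f x + iter n Lop g x.
Proof. by elim: n => //= n ->; rewrite LopD. Qed.

(** Nonnegative functions with logarithmic derivative at most [a]. The cone is
parametrised by an inequality rather than by a quotient, to allow zeros. *)
Definition cone1 a f := exists f1, [/\ has_deriv f f1, continuous f1, periodic f 1,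
  forall x, 0 <= f x & forall x, `|f1 x| <= a * f x].

(** The function [f x * expR (a * x)] is nondecreasing, and any two points of
the circle have representatives at distance at most one. *)
Lemma harnack a f : 0 <= a -> cone1 a f -> forall x y, f x <= expR a * f y.
Proof.
move=> a0 [f1 [hf cf1 pf f0 hf1]].
have mono u v : u <= v -> f u * expR (a * u) <= f v * expR (a * v).
  pose G x := f x * expR (a * x).
  have hE : has_deriv (fun x => expR (a * x)) (fun x => expR (a * x) * a).
    apply: has_deriv_ext (has_deriv_comp (f := expR) (f1 := expR) _
      (has_derivZ a (@has_deriv_id R))) _ _ => // [x|x]; first exact: is_derive_expR.
    by rewrite mulr1.
  have hG := has_derivM hf hE.
  apply: (has_deriv_nondecr hG) => x.
  rewrite mulrCA mulrC -mulrDr [X in _ * X]addrC mulr_ge0 ?expR_ge0 //.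
  by have := hf1 x; rewrite ler_norml => /andP[h _]; rewrite [f x * a]mulrC; lra.
move=> x y; pose m := - Num.floor (y - x).
rewrite -(periodicZ pf y m); set z := y + _.
have /andP[zx0 zx1] : 0 <= z - x < 1.
  by rewrite /z /m addrAC rmorphN /= frac_bound.
rewrite subr_ge0 in zx0; have {}zx1 := ltW zx1.
have h := mono _ _ zx0.
have e0 : 0 < expR (a * x) := expR_gt0 _.
rewrite -(ler_pM2r e0); apply: le_trans h _.
rewrite mulrAC -expRD mulrC ler_wpM2r //.
by rewrite ler_expR -[X in _ <= X + _]mulr1 -mulrDr ler_wpM2l //; lra.
Qed.

Lemma cone1_continuous a f : cone1 a f -> continuous f.
Proof. by move=> [f1 [hf _ _ _ _]]; exact: has_deriv_continuous hf. Qed.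

Lemma cone1_ge a f : 0 <= a -> cone1 a f -> circle_integral f = 1 ->
  forall y, expR (- a) <= f y.
Proof.
move=> a0 cf If y; have cc := cone1_continuous cf.
have := circle_integral_le_cst cc (fun x => harnack a0 cf x y).
by rewrite If expRN -[_^-1]mul1r ler_pdivrMr ?expR_gt0 // mulrC.
Qed.

Lemma cone1_le a f : 0 <= a -> cone1 a f -> circle_integral f = 1 ->
  forall x, f x <= expR a.
Proof.
move=> a0 cf If x; have cc := cone1_continuous cf.
have ce : continuous (fun y => expR a * f y).
  by move=> y; apply: cvgM; [exact: cvg_cst|exact: cc].
have := circle_integral_ge_cst ce (fun y => harnack a0 cf x y).
by rewrite circle_integralZ ?If ?mulr1 //; exact: continuous_integrable.
Qed.

(** Half of the gap left by the contraction: [al + tau = 1 - tau]. The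
distortion uses up one half, the other one is left for the minorisation. *)
Definition tau : R := (1 - al) / 2.
(** A constant that can be subtracted from the image of any density of the
cone without leaving the cone. *)
Definition kappa a : R := tau * expR (- a).

Lemma tau_gt0 : 0 < tau.
Proof. by have := branch_al B; rewrite /tau; lra. Qed.

Lemma kappa_bound a : 0 <= a -> 0 < kappa a < 1.
Proof.
move=> a0; have t0 := tau_gt0; have al0 := branch_al_gt0.
rewrite /kappa mulr_gt0 ?expR_gt0 //=.
have e1 : expR (- a) <= 1 by rewrite -expR0 ler_expR oppr_le0.
apply: le_lt_trans (_ : tau * 1 < 1); first by rewrite ler_pM2l.
by rewrite /tau; lra.
Qed.

Section Cones.
Variable a : R.
Hypothesis (a_gt0 : 0 < a) (aK : K <= tau * a).

Let a_ge0 : 0 <= a := ltW a_gt0.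

(** By [Lop_cone1] the image of a density of the cone has logarithmic
derivative at most [(1 - tau) * a]; this leaves room to subtract [kappa a] and
still be in the cone after renormalising the integral to one. *)
Definition step f x := (Lop f x - kappa a) / (1 - kappa a).

Lemma step_eq f x : Lop f x = kappa a + (1 - kappa a) * step f x.
Proof.
have /andP[k0 k1] := kappa_bound a_ge0.
rewrite /step mulrCA divff ?mulr1; first by ring.
by rewrite subr_eq0 gt_eqF.
Qed.

Lemma Lop_cone1 f : cone1 a f -> cone1 a (Lop f) /\
  exists2 f1, has_deriv (Lop f) f1 & forall x, `|f1 x| <= (1 - tau) * a * Lop f x.
Proof.
move=> [f1 [hf cf1 pf f0 hf1]]; have t0 := tau_gt0; have L0 := Lop_ge0 f0.
have hb x : `|Lop1 f f1 x| <= (1 - tau) * a * Lop f x.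
  apply: le_trans (Lop1_bound f0 hf1 x) _; apply: ler_wpM2r => //.
  have -> : (1 - tau) * a = a * al + tau * a by rewrite /tau; field.
  by rewrite lerD2l.
split; last by exists (Lop1 f f1) => //; exact: has_deriv_Lop.
exists (Lop1 f f1); split => //.
- exact: has_deriv_Lop.
- by apply: Lop1_continuous => //; exact: has_deriv_continuous hf.
- exact: Lop_periodic.
move=> x; apply: le_trans (hb x) _; apply: ler_wpM2r => //.
by rewrite ler_piMl //; lra.
Qed.

Lemma step_integral f : cone1 a f -> circle_integral f = 1 ->
  circle_integral (step f) = 1.
Proof.
move=> cf If; have /andP[k0 k1] := kappa_bound a_ge0.
have cc := cone1_continuous cf; have cL := Lop_continuous cc.
have pf : periodic f 1 by case: cf => ? [].
have -> : circle_integral (step f) =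
    circle_integral (fun x => (1 - kappa a)^-1 * (Lop f x - kappa a)).
  by apply: circle_integral_eq => x _; rewrite /step mulrC.
have ck : continuous (fun _ : R => kappa a) by move=> x; exact: cvg_cst.
rewrite circle_integralZ; last by apply: circle_integrableB; exact: continuous_integrable.
rewrite circle_integralB; try exact: continuous_integrable.
by rewrite Lop_integral // If circle_integral_cst mulVf // subr_eq0 gt_eqF.
Qed.

Lemma kappa_le f : cone1 a f -> circle_integral f = 1 ->
  forall x, kappa a <= tau * Lop f x.
Proof.
move=> cf If x; have [cL _] := Lop_cone1 cf.
rewrite /kappa ler_pM2l ?tau_gt0 //; apply: cone1_ge => //.
rewrite Lop_integral //; first exact: cone1_continuous cf.
by case: cf => ? [].
Qed.

Lemma has_deriv_step f f1 : has_deriv (Lop f) f1 ->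
  has_deriv (step f) (fun x => f1 x / (1 - kappa a)).
Proof.
move=> h; apply: has_deriv_ext (has_derivZ (1 - kappa a)^-1
  (has_derivB h (has_deriv_cst (kappa a)))) _ _ => x.
  by rewrite mulrC.
by rewrite subr0 mulrC.
Qed.

Lemma step_bound f f1 (b : R) : cone1 a f -> circle_integral f = 1 -> 0 <= b ->
  (forall x, `|f1 x| <= (1 - tau) * b * Lop f x) ->
  forall x, `|f1 x / (1 - kappa a)| <= b * step f x.
Proof.
move=> cf If b0 h x; have /andP[k0 k1] := kappa_bound a_ge0.
have k2 : 0 < 1 - kappa a by rewrite subr_gt0.
rewrite normrM normfV (gtr0_norm k2) /step mulrA ler_pM2r ?invr_gt0 //.
apply: le_trans (h x) _.
have := ler_wpM2l b0 (kappa_le cf If x).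
by move=> h2; lra.
Qed.

Lemma step_ge0 f : cone1 a f -> circle_integral f = 1 -> forall x, 0 <= step f x.
Proof.
move=> cf If x; have /andP[k0 k1] := kappa_bound a_ge0.
rewrite /step divr_ge0 ?subr_ge0 ?(ltW k1) //.
apply: le_trans (kappa_le cf If x) _; rewrite ler_piMl //.
  by apply: Lop_ge0; case: cf => ? [].
by rewrite /tau; have := branch_al_gt0; lra.
Qed.

Lemma step_cone1 f : cone1 a f -> circle_integral f = 1 -> cone1 a (step f).
Proof.
move=> cf If; have [[f1 [h1 cf1 p1 _ _]] [f1' h1' b1]] := Lop_cone1 cf.
have e := has_deriv_uniq h1' h1; rewrite {}e in h1' b1.
exists (fun x => f1 x / (1 - kappa a)); split.
- exact: has_deriv_step.
- by move=> x; apply: cvgM; [exact: cf1|exact: cvg_cst].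
- by move=> x; rewrite /step p1.
- exact: step_ge0.
- exact: step_bound.
Qed.

(** Both densities lose the same constant [kappa a] at each iteration, so that
it cancels in the difference, which is thereby contracted by [1 - kappa a].
The class [C] is kept abstract so as to apply to cones of first and second
order alike. *)
Lemma cone_gap (C : (R -> R) -> Prop) :
  (forall f, C f -> circle_integral f = 1 -> C (step f) /\ circle_integral (step f) = 1) ->
  forall n f g, C f -> C g -> circle_integral f = 1 -> circle_integral g = 1 ->
  exists f' g', [/\ C f' /\ circle_integral f' = 1, C g' /\ circle_integral g' = 1 &
    forall x, iter n Lop f x - iter n Lop g x = (1 - kappa a) ^+ n * (f' x - g' x)].
Proof.
move=> hC n f g Cf Cg If Ig; elim: n => [|n [f' [g' [[Cf' If'] [Cg' Ig'] e]]]].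
  by exists f, g; split => // x; rewrite expr0 mul1r.
exists (step f'), (step g'); split; [exact: hC|exact: hC|move=> x].
have := LopB (iter n Lop f) (iter n Lop g).
rewrite /= => /(congr1 (fun h => h x)) <-.
have -> : (fun y => iter n Lop f y - iter n Lop g y) =
   (fun y => (1 - kappa a) ^+ n * (f' y - g' y)) by apply/funext.
rewrite LopZ LopB !step_eq exprS.
by ring.
Qed.

End Cones.
End TransferOperator.


(** * Exponential decay on zero-mean functions *)

Section SpectralGap.
Variable R : realType.
Variables (D : nat) (s : R) (psi psi1 psi2 : R -> R) (al K : R).
Hypothesis B : inverse_branch D s psi psi1 psi2 al K.
Implicit Types (f g h : R -> R) (x y : R).
Local Notation L := (Lop D s psi psi1).
Local Notation tau := (tau al).
Variable a : R.
Hypothesis (a_gt0 : 0 < a) (aK : K <= tau * a).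
Local Notation kap := (kappa al a).
Local Notation th := (1 - kappa al a).

Let a_ge0 : 0 <= a := ltW a_gt0.

Lemma theta_bound : 0 <= th < 1.
Proof.
have /andP[k0 k1] := kappa_bound B a_ge0.
by rewrite subr_ge0 (ltW k1) ltrBlDr ltrDl.
Qed.

(** A function [h] becomes a density of the cone when it is divided by a large
constant [m] and added to one. This reduces zero-mean functions to differences
of densities. *)
Lemma cone1_affine h h1 (A m : R) : has_deriv h h1 -> continuous h1 ->
  periodic h 1 -> 0 < m -> (forall x, `|h x| <= A) -> A <= m ->
  (forall x, `|h1 x| <= a * (m - A)) ->
  [/\ has_deriv (fun x => 1 + m^-1 * h x) (fun x => m^-1 * h1 x),
   periodic (fun x => 1 + m^-1 * h x) 1, forall x, 0 <= 1 + m^-1 * h x,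
   forall x, m^-1 * (m - A) <= 1 + m^-1 * h x & cone1 a (fun x => 1 + m^-1 * h x)].
Proof.
move=> hh ch1 ph m0 hA Am hB.
have H1 : has_deriv (fun x => 1 + m^-1 * h x) (fun x => m^-1 * h1 x).
  apply: has_deriv_ext (has_derivD (has_deriv_cst 1) (has_derivZ m^-1 hh)) _ _ => // x.
  by rewrite add0r.
have H2 : periodic (fun x => 1 + m^-1 * h x) 1 by move=> x; rewrite ph.
have H4 x : m^-1 * (m - A) <= 1 + m^-1 * h x.
  rewrite mulrBr mulVf ?gt_eqF // lerD2l -mulrN ler_pM2l ?invr_gt0 //.
  by have := hA x; rewrite ler_norml => /andP[].
have H3 x : 0 <= 1 + m^-1 * h x.
  by apply: le_trans (H4 x); rewrite mulr_ge0 ?invr_ge0 ?subr_ge0 // ltW.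
split => //; exists (fun x => m^-1 * h1 x); split => //.
  by move=> x; apply: cvgM; [exact: cvg_cst|exact: ch1].
move=> x; rewrite normrM normfV (gtr0_norm m0).
apply: le_trans (_ : m^-1 * (a * (m - A)) <= _).
  by rewrite ler_pM2l ?invr_gt0.
by rewrite mulrCA ler_pM2l.
Qed.

Lemma affine_integral h (m : R) : continuous h -> circle_integral h = 0 ->
  circle_integral (fun x => 1 + m^-1 * h x) = 1.
Proof.
move=> ch Ih; have c1 : continuous (fun _ : R => (1 : R)) by move=> x; exact: cvg_cst.
have cm : continuous (fun x => m^-1 * h x).
  by move=> x; apply: cvgM; [exact: cvg_cst|exact: ch].
rewrite circle_integralD; try exact: continuous_integrable.
by rewrite circle_integralZ ?Ih ?circle_integral_cst ?mulr0 ?addr0 //; exact: continuous_integrable.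
Qed.

Lemma cone1_one : cone1 a (fun=> 1).
Proof.
exists (fun=> 0); split => //.
- exact: has_deriv_cst.
- by move=> x; exact: cvg_cst.
- by move=> x; rewrite normr0 mulr1.
Qed.

Lemma iter_affine n h (m : R) : m != 0 ->
  iter n L h = fun x => m * (iter n L (fun y => 1 + m^-1 * h y) x - iter n L (fun=> 1) x).
Proof.
move=> m0; rewrite (Lop_iterD _ _ _ _ n (fun=> 1) (fun y => m^-1 * h y)) Lop_iterZ.
by apply/funext => x; rewrite addrAC subrr add0r mulrA divff ?mul1r.
Qed.

Lemma step_cone_pair f : cone1 a f -> circle_integral f = 1 ->
  cone1 a (step D s psi psi1 al a f) /\ circle_integral (step D s psi psi1 al a f) = 1.
Proof. by move=> cf If; split; [exact: (step_cone1 B)|exact: (step_integral B)]. Qed.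

Lemma cone1_diff f g : cone1 a f -> cone1 a g -> circle_integral f = 1 ->
  circle_integral g = 1 -> forall x, `|f x - g x| <= expR a.
Proof.
move=> cf cg If Ig x; have F := cone1_le a_ge0 cf If x.
have G := cone1_le a_ge0 cg Ig x.
have f0 : 0 <= f x by case: cf => ? [].
have g0 : 0 <= g x by case: cg => ? [].
by rewrite ler_norml; apply/andP; split; lra.
Qed.

Lemma cone_deriv_diff (f1 g1 f g : R -> R) (b : R) : 0 <= b -> cone1 a f -> cone1 a g ->
  circle_integral f = 1 -> circle_integral g = 1 ->
  (forall x, `|f1 x| <= b * f x) -> (forall x, `|g1 x| <= b * g x) ->
  forall x, `|f1 x - g1 x| <= 2 * b * expR a.
Proof.
move=> b0 cf cg If Ig hf hg x.
have F := ler_wpM2l b0 (cone1_le a_ge0 cf If x).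
have G := ler_wpM2l b0 (cone1_le a_ge0 cg Ig x).
apply: le_trans (ler_normB _ _) _.
by have := hf x; have := hg x; lra.
Qed.

(** Write [h = m * ((1 + h / m) - 1)] as a multiple of a difference of two
densities of the cone, and apply [cone_gap]. The bounds hold for the function
and for its derivative with constants that depend on [h] only through [m]. *)
Lemma decay1 h h1 (A m : R) : has_deriv h h1 -> continuous h1 ->
  periodic h 1 -> circle_integral h = 0 -> 0 < m -> (forall x, `|h x| <= A) -> A <= m ->
  (forall x, `|h1 x| <= a * (m - A)) ->
  forall n, exists u1, [/\ has_deriv (iter n L h) u1, continuous u1,
    forall x, `|iter n L h x| <= m * expR a * th ^+ n &
    forall x, `|u1 x| <= 2 * a * m * expR a * th ^+ n].
Proof.
move=> hh ch1 ph Ih m0 hA Am hB n.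
have [_ _ _ _ cf] := cone1_affine hh ch1 ph m0 hA Am hB.
have If := affine_integral m (has_deriv_continuous hh) Ih.
have [f [g [[cf' If'] [cg' Ig'] e]]] :=
  cone_gap B a_gt0 step_cone_pair n cf cone1_one If (circle_integral_cst 1).
have E : iter n L h = fun x => m * th ^+ n * (f x - g x).
  by rewrite (iter_affine _ _ (lt0r_neq0 m0)); apply/funext => x; rewrite e mulrA.
have /andP[t0 t1] := theta_bound.
have c0 : 0 <= m * th ^+ n by rewrite mulr_ge0 ?exprn_ge0 // ltW.
have := cf'; move=> [f1 [hf cf1 _ _ bf]]; have := cg'; move=> [g1 [hg cg1 _ _ bg]].
exists (fun x => m * th ^+ n * (f1 x - g1 x)); split.
- by rewrite E; exact: (has_derivZ _ (has_derivB hf hg)).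
- by move=> x; apply: cvgM; [exact: cvg_cst|apply: cvgB; [exact: cf1|exact: cg1]].
- move=> x; rewrite E normrM (ger0_norm c0) [leRHS]mulrAC; apply: ler_wpM2l => //.
  exact: cone1_diff.
- move=> x; rewrite normrM (ger0_norm c0).
  apply: le_trans (ler_wpM2l c0 (cone_deriv_diff a_ge0 cf' cg' If' Ig' bf bg x)) _.
  by rewrite [leLHS](_ : _ = 2 * a * m * expR a * th ^+ n) //; ring.
Qed.

(** By positivity it is enough to bound the iterates of the constant one,
which stay in the cone and have integral one. *)
Lemma iter_sup n f (e : R) : 0 <= e -> (forall x, `|f x| <= e) ->
  forall x, `|iter n L f x| <= expR a * e.
Proof.
move=> e0 fe x.
have h1 : forall k x, `|iter k L f x| <= iter k L (fun=> e * 1) x.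
  elim=> [|k IHk] y /=; first by rewrite mulr1.
  by apply: le_trans (Lop_norm B _ _) _; apply: (Lop_le B).
apply: le_trans (h1 n x) _; rewrite Lop_iterZ mulrC ler_wpM2r //.
have h2 : cone1 a (iter n L (fun=> 1)) /\ circle_integral (iter n L (fun=> 1)) = 1.
  elim: n {h1} => [|n [IH1 IH2]]; first by split; [exact: cone1_one|exact: circle_integral_cst].
  split; first by have [] := Lop_cone1 B a_gt0 aK IH1.
  rewrite /= (Lop_integral B) //; first exact: cone1_continuous IH1.
  by case: IH1 => ? [].
by apply: cone1_le h2.2 x => //; exact: h2.1.
Qed.

Section SecondOrder.
Variables (psi3 : R -> R) (K2 b : R).
Hypotheses (hpsi3 : has_deriv psi2 psi3) (cpsi3 : continuous psi3)
  (bpsi3 : forall x, `|psi3 x| <= K2 * (s * psi1 x))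
  (b_ge0 : 0 < b) (bK : 3 * a * K * al + K2 <= tau * b).

Definition cone2 f := cone1 a f /\ exists f1 f2, [/\ has_deriv f f1, has_deriv f1 f2,
  continuous f2 & forall x, `|f2 x| <= b * f x].

(** The second derivative of [Lop f]; the third one of the branch enters. *)
Definition Lop2 f f1 f2 x : R := \sum_(j < D)
  let y := x + j%:R in let z := psi y in
  (s * psi3 y * f z + 3 * (s * psi2 y) * (f1 z * psi1 y) +
   s * psi1 y * (f2 z * psi1 y ^+ 2)).

Lemma has_deriv_Lop1 f f1 f2 : has_deriv f f1 -> has_deriv f1 f2 ->
  has_deriv (Lop1 D s psi psi1 psi2 f f1) (Lop2 f f1 f2).
Proof.
move=> hf hf1; apply: has_deriv_sum => j.
have hp := branch_deriv B; have hp1 := branch_deriv2 B.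
apply: (has_deriv_shift j%:R
  (f := fun x => s * psi2 x * f (psi x) + s * psi1 x * (f1 (psi x) * psi1 x))
  (f1 := fun x => s * psi3 x * f (psi x) + 3 * (s * psi2 x) * (f1 (psi x) * psi1 x) +
   s * psi1 x * (f2 (psi x) * psi1 x ^+ 2))).
apply: has_deriv_ext (has_derivD
  (has_derivM (has_derivZ s hpsi3) (has_deriv_comp hf hp))
  (has_derivM (has_derivZ s hp1) (has_derivM (has_deriv_comp hf1 hp) hp1))) _ _ => // x.
by ring.
Qed.

(** The second derivative of [f] is multiplied by [al ^+ 2]; everything else
is controlled by the cone of first order and absorbed by a large [b]. *)
Lemma Lop2_bound f f1 f2 : (forall x, 0 <= f x) -> (forall x, `|f1 x| <= a * f x) ->
  (forall x, `|f2 x| <= b * f x) ->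
  forall x, `|Lop2 f f1 f2 x| <= (1 - tau) * b * L f x.
Proof.
move=> f0 hf1 hf2 x; rewrite /Lop mulr_sumr.
apply: le_trans (ler_norm_sum _ _ _) _; apply: ler_sum => j _ /=.
set y := x + j%:R; set z := psi y; have w := branch_gt0 B y.
set W := s * psi1 y in w *.
have Wal : W <= al := branch_contr B y.
have al0 := branch_al_gt0 B; have al1 := branch_al B.
have ns : `|s| = 1 by case: (branch_sign B) => ->; rewrite ?normrN normr1.
have n3 : `|(3 : R)| = 3 by rewrite ger0_norm.
have fz := f0 z; have w0 : 0 <= s * psi1 y := ltW w.
apply: le_trans (_ : (K2 * W) * f z + 3 * (K * W) * (a * f z * al) +
    W * (b * f z * (al * al)) <= _).
  apply: le_trans (ler_normD _ _) _; apply: lerD.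
    apply: le_trans (ler_normD _ _) _; apply: lerD.
      by rewrite !normrM ns mul1r (ger0_norm fz); apply: ler_wpM2r => //; exact: bpsi3.
    rewrite !normrM ns n3 mul1r (branch_norm1 B).
    have q1 : 0 <= 3 * `|psi2 y| by rewrite mulr_ge0.
    have q2 : 0 <= `|f1 z| * (s * psi1 y) by exact: mulr_ge0.
    apply: (ler_pM q1 q2).
      by rewrite ler_pM2l //; exact: branch_dist B y.
    by apply: ler_pM => //; exact: hf1.
  rewrite normrM (gtr0_norm w) ler_pM2l // normrM normrX (branch_norm1 B).
  apply: (ler_pM (normr_ge0 _) (exprn_ge0 2 w0)); first exact: hf2.
  by rewrite expr2; exact: ler_pM.
have -> : K2 * W * f z + 3 * (K * W) * (a * f z * al) + W * (b * f z * (al * al)) =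
   (3 * a * K * al + K2 + b * (al * al)) * (W * f z) by ring.
apply: ler_wpM2r; first by rewrite mulr_ge0 // ltW.
have h1 : b * (al * al) <= b * al.
  by rewrite ler_pM2l // -[leRHS]mulr1 ler_pM2l // ltW.
have -> : (1 - tau) * b = tau * b + b * al by rewrite /tau; field.
exact: lerD.
Qed.

Lemma Lop2_continuous f f1 f2 : continuous f -> continuous f1 -> continuous f2 ->
  continuous (Lop2 f f1 f2).
Proof.
move=> cf cf1 cf2; apply: continuous_sum => j x /=.
have cp := has_deriv_continuous (branch_deriv B).
have cp1 := has_deriv_continuous (branch_deriv2 B).
have ci : continuous (fun x : R => x) by move=> y; exact: cvg_id.
have c1j := @continuous_comp_shift _ j%:R _ _ cp1 ci.
have c2j := @continuous_comp_shift _ j%:R _ _ (branch_cont2 B) ci.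
have c3j := @continuous_comp_shift _ j%:R _ _ cpsi3 ci.
have cfj := @continuous_comp_shift _ j%:R _ _ cf cp.
have cf1j := @continuous_comp_shift _ j%:R _ _ cf1 cp.
have cf2j := @continuous_comp_shift _ j%:R _ _ cf2 cp.
apply: cvgD; first apply: cvgD.
- by apply: cvgM; [apply: cvgM; [exact: cvg_cst|exact: c3j]|exact: cfj].
- apply: cvgM; last by apply: cvgM; [exact: cf1j|exact: c1j].
  by apply: cvgM; [exact: cvg_cst|apply: cvgM; [exact: cvg_cst|exact: c2j]].
- apply: cvgM; first by apply: cvgM; [exact: cvg_cst|exact: c1j].
  by apply: cvgM; [exact: cf2j|apply: cvgM; exact: c1j].
Qed.

Lemma step_cone2 f : cone2 f -> circle_integral f = 1 ->
  cone2 (step D s psi psi1 al a f) /\ circle_integral (step D s psi psi1 al a f) = 1.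
Proof.
move=> [cf [f1 [f2 [hf hf1 cf2 bf2]]]] If.
have [cs Is] := step_cone_pair cf If; split => //; split => //.
have hL := has_deriv_Lop B hf; have hL1 := has_deriv_Lop1 hf hf1.
have [g1 [hg1 _ _ f0 bf1]] := cf; have eg := has_deriv_uniq hg1 hf.
rewrite {}eg in hg1 bf1.
exists (fun x => Lop1 D s psi psi1 psi2 f f1 x / (1 - kap)), (fun x => Lop2 f f1 f2 x / (1 - kap)).
split.
- exact: has_deriv_step.
- by apply: has_deriv_ext (has_derivZ (1 - kap)^-1 hL1) _ _ => x; rewrite mulrC.
- move=> x; apply: cvgM; last exact: cvg_cst.
  apply: Lop2_continuous => //; first exact: has_deriv_continuous hf.
  exact: has_deriv_continuous hf1.
- apply: (step_bound B a_gt0 aK cf If (ltW b_ge0)).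
  exact: Lop2_bound.
Qed.

Lemma cone2_one : cone2 (fun=> 1).
Proof.
split; first exact: cone1_one.
exists (fun=> 0), (fun=> 0); split.
- exact: has_deriv_cst.
- exact: has_deriv_cst.
- by move=> x; exact: cvg_cst.
- by move=> x; rewrite normr0 mulr1 ltW.
Qed.

(** The argument of [decay1] in the cone of second order. *)
Lemma decay2 h h1 h2 (A m : R) : has_deriv h h1 -> has_deriv h1 h2 -> continuous h2 ->
  periodic h 1 -> circle_integral h = 0 -> 0 < m -> (forall x, `|h x| <= A) -> A <= m ->
  (forall x, `|h1 x| <= a * (m - A)) -> (forall x, `|h2 x| <= b * (m - A)) ->
  forall n, exists u1 u2, [/\ has_deriv (iter n L h) u1, has_deriv u1 u2, continuous u2 &
    [/\ forall x, `|iter n L h x| <= m * expR a * th ^+ n,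
    forall x, `|u1 x| <= 2 * a * m * expR a * th ^+ n &
    forall x, `|u2 x| <= 2 * b * m * expR a * th ^+ n]].
Proof.
move=> hh hh1 ch2 ph Ih m0 hA Am hB hB2 n.
have ch1 := has_deriv_continuous hh1.
have [H1 H2 H3 H4 cf] := cone1_affine hh ch1 ph m0 hA Am hB.
have If := affine_integral m (has_deriv_continuous hh) Ih.
have C2f : cone2 (fun x => 1 + m^-1 * h x).
  split => //; exists (fun x => m^-1 * h1 x), (fun x => m^-1 * h2 x); split => //.
  - exact: has_derivZ.
  - by move=> x; apply: cvgM; [exact: cvg_cst|exact: ch2].
  - move=> x; rewrite normrM normfV (gtr0_norm m0).
    apply: le_trans (_ : m^-1 * (b * (m - A)) <= _).
      by rewrite ler_pM2l ?invr_gt0.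
    by rewrite mulrCA ler_pM2l.
have [f [g [[[cf' [f1 [f2 [hf hf1 cf2 bf2]]]] If'] [[cg' [g1 [g2 [hg hg1 cg2 bg2]]]] Ig'] e]]] :=
  cone_gap B a_gt0 step_cone2 n C2f cone2_one If (circle_integral_cst 1).
have E : iter n L h = fun x => m * th ^+ n * (f x - g x).
  by rewrite (iter_affine _ _ (lt0r_neq0 m0)); apply/funext => x; rewrite e mulrA.
have /andP[t0 t1] := theta_bound.
have c0 : 0 <= m * th ^+ n by rewrite mulr_ge0 ?exprn_ge0 // ltW.
have := cf'; move=> [f1' [hf' _ _ _ bf]]; have := cg'; move=> [g1' [hg' _ _ _ bg]].
have ef := has_deriv_uniq hf' hf; have eg := has_deriv_uniq hg' hg.
rewrite {}ef in bf; rewrite {}eg in bg.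
exists (fun x => m * th ^+ n * (f1 x - g1 x)), (fun x => m * th ^+ n * (f2 x - g2 x)); split.
- by rewrite E; exact: (has_derivZ _ (has_derivB hf hg)).
- exact: (has_derivZ _ (has_derivB hf1 hg1)).
- by move=> x; apply: cvgM; [exact: cvg_cst|apply: cvgB; [exact: cf2|exact: cg2]].
split=> x.
- rewrite E normrM (ger0_norm c0) [leRHS]mulrAC; apply: ler_wpM2l => //.
  exact: cone1_diff.
- rewrite normrM (ger0_norm c0).
  apply: le_trans (ler_wpM2l c0 (cone_deriv_diff a_ge0 cf' cg' If' Ig' bf bg x)) _.
  by rewrite [leLHS](_ : _ = 2 * a * m * expR a * th ^+ n) //; ring.
- rewrite normrM (ger0_norm c0).
  apply: le_trans (ler_wpM2l c0 (cone_deriv_diff (ltW b_ge0) cf' cg' If' Ig' bf2 bg2 x)) _.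
  by rewrite [leLHS](_ : _ = 2 * b * m * expR a * th ^+ n) //; ring.
Qed.

End SecondOrder.
End SpectralGap.


(** * The resolvent as a Neumann series *)

Section Resolvent.
Variable R : realType.
Variables (D : nat) (s : R) (psi psi1 psi2 : R -> R) (al K : R).
Hypothesis B : inverse_branch D s psi psi1 psi2 al K.
Implicit Types (f g h q : R -> R) (x y : R).
Local Notation L := (Lop D s psi psi1).
Local Notation tau := (tau al).
Variable a : R.
Hypothesis (a_gt0 : 0 < a) (aK : K <= tau * a).
Local Notation th := (1 - kappa al a).

Let th0 : 0 <= th. Proof. by case/andP: (theta_bound B a_gt0). Qed.
Let th1 : th < 1. Proof. by case/andP: (theta_bound B a_gt0). Qed.

Lemma Lop_iter_integral n f : continuous f -> periodic f 1 ->
  [/\ continuous (iter n L f), periodic (iter n L f) 1 &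
      circle_integral (iter n L f) = circle_integral f].
Proof.
move=> cf pf; elim: n => [//|n [c p e]] /=; split.
- exact: Lop_continuous B _ c.
- exact: Lop_periodic B _ p.
- by rewrite (Lop_integral B).
Qed.

Definition neumann q := fsum (fun n => iter n L q).

(** Termwise application of the operator is allowed because a sum over
finitely many branches is continuous for pointwise convergence. *)
Lemma neumann_eq q e : majorised (fun n => iter n L q) e ->
  forall x, neumann q x - L (neumann q) x = q x.
Proof.
move=> me x.
pose S n y := \sum_(k < n) iter k L q y.
have SC y : S ^~ y @ \oo --> neumann q y by exact: majorised_cvg me.
have LS n y : L (S n) y = S n.+1 y - q y.
  rewrite /S big_ord_recl /= addrAC subrr add0r [LHS]/Lop.
  by rewrite [RHS]exchange_big; apply: eq_bigr => j _; rewrite mulr_sumr.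
have h1 : (fun n => L (S n) x) @ \oo --> L (neumann q) x.
  apply: cvg_big; first exact: add_continuous.
  by move=> j _; apply: cvgM; [exact: cvg_cst|exact: SC].
have h2 : (fun n => L (S n) x) @ \oo --> neumann q x - q x.
  under eq_fun do rewrite LS.
  by apply: cvgB; [rewrite (cvg_shiftS (S ^~ x)); exact: SC|exact: cvg_cst].
by rewrite (cvg_unique _ h1 h2) // opprB addrC subrK.
Qed.

Lemma neumann_integral q e : majorised (fun n => iter n L q) e -> continuous q ->
  periodic q 1 -> circle_integral q = 0 -> circle_integral (neumann q) = 0.
Proof.
move=> me cq pq Iq.
have ci n : continuous (iter n L q) by have [] := Lop_iter_integral n cq pq.
have := fsum_circle_integral me ci.
have -> : (fun n => \sum_(k < n) circle_integral (iter k L q)) = fun=> 0.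
  apply/funext => n; rewrite big1 // => k _.
  by have [_ _ ->] := Lop_iter_integral k cq pq.
by move=> hc; apply: (cvg_unique _ hc (cvg_cst _)).
Qed.

(** Provides the constant [m] that puts [1 + q / m] in the cone: the margin
[m - A] absorbs the derivative. *)
Lemma decay_scale q (q1 : R -> R) : has_deriv q q1 -> continuous q1 -> periodic q 1 ->
  exists m A : R, [/\ 0 < m, A <= m, forall x, `|q x| <= A &
    forall x, `|q1 x| <= a * (m - A)].
Proof.
move=> hq cq pq.
have [A A0 hA] := periodic_bounded (has_deriv_continuous hq) pq.
have [A1 A10 hA1] := periodic_bounded cq (has_deriv_periodic hq pq).
exists (A + A1 / a + 1), A.
have Aa : 0 <= A1 / a by rewrite divr_ge0 // ltW.
split => //; try lra.
move=> x; apply: le_trans (hA1 x) _.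
have -> : a * (A + A1 / a + 1 - A) = A1 + a by field; rewrite gt_eqF.
by rewrite lerDl ltW.
Qed.

Lemma resolvent1 q (q1 : R -> R) (A m : R) : has_deriv q q1 -> continuous q1 ->
  periodic q 1 -> circle_integral q = 0 -> 0 < m -> (forall x, `|q x| <= A) -> A <= m ->
  (forall x, `|q1 x| <= a * (m - A)) ->
  [/\ exists2 h1, has_deriv (neumann q) h1 & continuous h1,
      periodic (neumann q) 1, circle_integral (neumann q) = 0,
      forall x, neumann q x - L (neumann q) x = q x &
      forall x, `|neumann q x| <= m * expR a / (1 - th)].
Proof.
move=> hq cq1 pq Iq m0 qA Am q1A.
have dec := decay1 B a_gt0 aK hq cq1 pq Iq m0 qA Am q1A.
have /choice [u1 hu1] := dec.
have t01 : 0 <= th < 1 by rewrite th0 th1.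
have cq := has_deriv_continuous hq.
have m1 : forall n x, `|iter n L q x| <= m * expR a * th ^+ n.
  by move=> n x; have [_ _ h _] := hu1 n; exact: h.
have m2 : forall n x, `|u1 n x| <= 2 * a * m * expR a * th ^+ n.
  by move=> n x; have [_ _ _ h] := hu1 n; exact: h.
have [M1 E1] := geometric_majorised t01 m1.
have [M2 _] := geometric_majorised t01 m2.
split.
- exists (fsum u1).
    by apply: fsum_deriv M1 M2 _ _ => k; have [] := hu1 k.
  by apply: fsum_continuous M2 _ => k; have [] := hu1 k.
- by apply: fsum_periodic => k; have [] := Lop_iter_integral k cq pq.
- exact: neumann_integral M1 cq pq Iq.
- exact: neumann_eq M1.
- by move=> x; rewrite -E1; exact: fsum_bound.
Qed.

Lemma resolvent2 (psi3 : R -> R) (K2 : R) q (q1 q2 : R -> R) :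
  has_deriv psi2 psi3 -> continuous psi3 ->
  (forall x, `|psi3 x| <= K2 * (s * psi1 x)) ->
  has_deriv q q1 -> has_deriv q1 q2 -> continuous q2 ->
  periodic q 1 -> circle_integral q = 0 ->
  exists h1 h2, [/\ has_deriv (neumann q) h1, has_deriv h1 h2 & continuous h2].
Proof.
move=> hp3 cp3 bp3 hq hq1 cq2 pq Iq.
have K2_ge0 : 0 <= K2.
  have := le_trans (normr_ge0 _) (bp3 0).
  by rewrite pmulr_lge0 //; exact: branch_gt0 B 0.
have t0 := tau_gt0 B; have al0 := branch_al_gt0 B; have K0 := branch_K_ge0 B.
(* Large enough for the cone of second order to be mapped into itself with a
margin. *)
pose b := (3 * a * K * al + K2) / tau + 1.
have q0 : 0 <= 3 * a * K * al + K2.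
  by rewrite addr_ge0 // !mulr_ge0 // ltW.
have b0 : 0 < b by rewrite /b ltr_wpDl // divr_ge0 // ltW.
have bK : 3 * a * K * al + K2 <= tau * b.
  by rewrite /b mulrDr mulrCA divff ?gt_eqF // !mulr1 lerDl ltW.
have cq1 := has_deriv_continuous hq1; have cq := has_deriv_continuous hq.
have pq1 := has_deriv_periodic hq pq.
have [A A0 hA] := periodic_bounded cq pq.
have [A1 A10 hA1] := periodic_bounded cq1 pq1.
have [A2 A20 hA2] := periodic_bounded cq2 (has_deriv_periodic hq1 pq1).
pose m := A + A1 / a + A2 / b + 1.
have Aa : 0 <= A1 / a by rewrite divr_ge0 // ltW.
have Ab : 0 <= A2 / b by rewrite divr_ge0 // ltW.
have m0 : 0 < m by rewrite /m; lra.
have Am : A <= m by rewrite /m; lra.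
have hB1 x : `|q1 x| <= a * (m - A).
  apply: le_trans (hA1 x) _.
  have -> : A1 = a * (A1 / a) by rewrite mulrCA divff ?mulr1 ?gt_eqF.
  by rewrite ler_pM2l // /m; lra.
have hB2 x : `|q2 x| <= b * (m - A).
  apply: le_trans (hA2 x) _.
  have -> : A2 = b * (A2 / b) by rewrite mulrCA divff ?mulr1 ?gt_eqF.
  by rewrite ler_pM2l // /m; lra.
have dec := decay2 B a_gt0 aK hp3 cp3 bp3 b0 bK hq hq1 cq2 pq Iq m0 hA Am hB1 hB2.
have t01 : 0 <= th < 1 by rewrite th0 th1.
have /choice [u1 /choice [u2 hu]] := dec.
have m0' : forall n x, `|iter n L q x| <= m * expR a * th ^+ n.
  by move=> n x; have [_ _ _ [h _ _]] := hu n; exact: h.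
have m1 : forall n x, `|u1 n x| <= 2 * a * m * expR a * th ^+ n.
  by move=> n x; have [_ _ _ [_ h _]] := hu n; exact: h.
have m2 : forall n x, `|u2 n x| <= 2 * b * m * expR a * th ^+ n.
  by move=> n x; have [_ _ _ [_ _ h]] := hu n; exact: h.
have [M0 _] := geometric_majorised t01 m0'.
have [M1 _] := geometric_majorised t01 m1.
have [M2 _] := geometric_majorised t01 m2.
have cu1 k : continuous (u1 k).
  by have [_ h _ _] := hu k; exact: has_deriv_continuous h.
exists (fsum u1), (fsum u2); split.
- by apply: fsum_deriv M0 M1 _ cu1 => k; have [] := hu k.
- by apply: fsum_deriv M1 M2 _ _ => k; have [] := hu k.
- by apply: fsum_continuous M2 _ => k; have [] := hu k.
Qed.

Lemma telescope_iter f n x : continuous f ->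
  f x = \sum_(k < n) iter k L (fun y => f y - L f y) x + iter n L f x.
Proof.
move=> cf; elim: n => [|n IHn]; first by rewrite big_ord0 add0r.
rewrite big_ord_recr /= {1}IHn -addrA; congr (_ + _).
by rewrite Lop_iterB -iterSr /= subrK.
Qed.

(** If [f - L f] is small in the sup norm and merely bounded in C^1, then [f]
is small: the first [N] terms of the Neumann series are controlled by the sup
norm through [iter_sup], the others by exponential decay in C^1. This is how
an estimate of the residual in the sup norm is turned into convergence of the
response. *)
Lemma inverse_bound f (f1 p1 : R -> R) (eps A m : R) N : has_deriv f f1 ->
  continuous f1 -> periodic f 1 -> circle_integral f = 0 ->
  has_deriv (fun y => f y - L f y) p1 -> continuous p1 ->
  (forall x, `|f x - L f x| <= eps) ->
  0 < m -> (forall x, `|f x - L f x| <= A) -> A <= m ->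
  (forall x, `|p1 x| <= a * (m - A)) ->
  forall x, `|f x| <= N%:R * (expR a * eps) + m * expR a * th ^+ N / (1 - th).
Proof.
move=> hf cf1 pf If hp cp1 peps m0 pA Am p1A x.
have cf := has_deriv_continuous hf.
have e0 : 0 <= eps := le_trans (normr_ge0 _) (peps 0).
set p := fun y => _ in hp.
have pp : periodic p 1 by move=> y; rewrite /p pf (Lop_periodic B pf).
have Ip : circle_integral p = 0.
  rewrite /p circle_integralB ?(Lop_integral B) ?subrr //; apply: continuous_integrable => //.
  exact: Lop_continuous B _ cf.
have dec := decay1 B a_gt0 aK hp cp1 pp Ip m0 pA Am p1A.
have [m' [A' [m'0 A'm' fA' f1A']]] := decay_scale hf cf1 pf.
have dec' := decay1 B a_gt0 aK hf cf1 pf If m'0 fA' A'm' f1A'.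
set C := N%:R * _ + _.
(* [f] is the sum of [N + M] terms of the Neumann series of [f - L f] and of a
remainder which vanishes as [M] grows. *)
have key M : `|f x| <= C + m' * expR a * th ^+ (N + M).
  rewrite {1}(telescope_iter (N + M) x cf) -/p.
  apply: le_trans (ler_normD _ _) _; apply: lerD; last first.
    by have [u [_ _ h _]] := dec' (N + M)%N; exact: h.
  rewrite big_split_ord /=; apply: le_trans (ler_normD _ _) _; apply: lerD.
    apply: le_trans (ler_norm_sum _ _ _) _.
    apply: le_trans (_ : \sum_(k < N) (expR a * eps) <= _); last first.
      by rewrite sumr_const card_ord mulr_natl.
    by apply: ler_sum => k _; apply: (iter_sup B).
  apply: le_trans (ler_norm_sum _ _ _) _.
  apply: le_trans (_ : \sum_(k < M) (m * expR a * th ^+ N) * th ^+ k <= _).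
    apply: ler_sum => k _; have [u [_ _ h _]] := dec (N + k)%N.
    by rewrite -mulrA -exprD; exact: h.
  rewrite -mulr_sumr; apply: ler_wpM2l.
    by rewrite mulr_ge0 ?exprn_ge0 // mulr_ge0 ?expR_ge0 // ltW.
  have t1 : 0 < 1 - th by rewrite subr_gt0.
  rewrite -[leRHS]mul1r ler_pdivlMr // mulrC -opprB mulNr -subrX1 opprB.
  by rewrite gerBl exprn_ge0.
have lim : (fun M => C + m' * expR a * th ^+ (N + M)) @ \oo -->
    C + m' * expR a * (th ^+ N * 0).
  apply: cvgD; first exact: cvg_cst.
  apply: cvgM; first exact: cvg_cst.
  under eq_fun do rewrite exprD.
  by apply: cvgM; [exact: cvg_cst|apply: cvg_expr; rewrite ger0_norm].
rewrite !mulr0 addr0 in lim.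
by apply: (cvgr_to_ge lim); near=> M; exact: key.
Unshelve. all: by end_near. Qed.

(** The iterates of the approximants decay, while the iterates of the error
stay of the size of the error. *)
Lemma fixed_point_eq0 f : (forall x, L f x = f x) ->
  (forall eps : R, 0 < eps -> exists g g1, [/\ has_deriv g g1, continuous g1,
     periodic g 1, circle_integral g = 0 & forall x, `|f x - g x| <= eps]) ->
  forall x, f x = 0.
Proof.
move=> Lf app x; apply/eqP; rewrite -normr_le0; apply/ler_addgt0Pr => eps eps0.
rewrite add0r; have ea := expR_gt0 a.
have d0 : 0 < eps / expR a by rewrite divr_gt0.
have [g [g1 [hg cg1 pg Ig fg]]] := app _ d0.
have [m [A [m0 Am gA g1A]]] := decay_scale hg cg1 pg.
have dec := decay1 B a_gt0 aK hg cg1 pg Ig m0 gA Am g1A.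
have Lfn n : iter n L f = f by elim: n => //= n ->; apply/funext.
have key n : `|f x| <= eps + m * expR a * th ^+ n.
  have -> : f x = iter n L (fun y => f y - g y) x + iter n L g x.
    by rewrite Lop_iterB Lfn subrK.
  apply: le_trans (ler_normD _ _) _; apply: lerD.
    have := iter_sup B a_gt0 aK n (ltW d0) fg x.
    by rewrite mulrCA divff ?mulr1 ?gt_eqF.
  by have [u [_ _ h _]] := dec n; exact: h.
have lim : (fun n => eps + m * expR a * th ^+ n) @ \oo --> eps + m * expR a * 0.
  apply: cvgD; first exact: cvg_cst.
  apply: cvgM; first exact: cvg_cst.
  by apply: cvg_expr; rewrite ger0_norm.
rewrite mulr0 addr0 in lim.
by apply: (cvgr_to_ge lim); near=> M; exact: key.
Unshelve. all: by end_near. Qed.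

End Resolvent.


(** * Inverse of an expanding lift *)

Section ExpandingLift.
Variable R : realType.

(** [s] is the sign of [T1], which is constant, and [d] the degree. The bound
[C] on the second derivative gives the distortion of the inverse. *)
Record expanding_lift (T T1 T2 : R -> R) (d : int) (s al C : R) : Prop :=
  ExpandingLift {
    lift_deriv : has_deriv T T1;
    lift_deriv2 : has_deriv T1 T2;
    lift_cont2 : continuous T2;
    lift_shift : forall x, T (x + 1) = T x + d%:~R;
    lift_sign : s = 1 \/ s = -1;
    lift_al0 : 0 < al;
    lift_al1 : al < 1;
    lift_exp : forall x, al^-1 <= s * T1 x;
    lift_bound2 : forall x, `|T2 x| <= C }.

Variables (T T1 T2 : R -> R) (d : int) (s al C : R).
Hypothesis E : expanding_lift T T1 T2 d s al C.
Implicit Types x y : R.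

Let al0 : 0 < al := lift_al0 E.
Let al1 : al < 1 := lift_al1 E.

Lemma lift_sign_norm : `|s| = 1.
Proof. by case: (lift_sign E) => ->; rewrite ?normrN normr1. Qed.

Lemma lift_sign_sqr : s * s = 1.
Proof. by case: (lift_sign E) => ->; rewrite ?mulr1 // mulrNN mulr1. Qed.

Lemma lift_norm1 x : `|T1 x| = s * T1 x.
Proof.
have h : 0 < s * T1 x by apply: lt_le_trans (lift_exp E x); rewrite invr_gt0.
by rewrite -(gtr0_norm h) normrM lift_sign_norm mul1r.
Qed.

Lemma lift_neq0 x : T1 x != 0.
Proof.
rewrite -normr_gt0 lift_norm1; apply: lt_le_trans (lift_exp E x).
by rewrite invr_gt0.
Qed.

Lemma lift_expands x y : x <= y -> al^-1 * (y - x) <= s * T y - s * T x.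
Proof.
move=> xy; have [c ->] := has_deriv_mvt x y (has_derivZ s (lift_deriv E)).
by apply: ler_wpM2r; rewrite ?subr_ge0 //; exact: lift_exp E c.
Qed.

Lemma lift_expands_norm x y : al^-1 * `|x - y| <= `|T x - T y|.
Proof.
wlog xy : x y / y <= x.
  move=> W; case: (leP y x) => [/W //|/ltW /W].
  by rewrite distrC [X in _ <= X]distrC.
rewrite ger0_norm ?subr_ge0 //; apply: le_trans (lift_expands xy) _.
by rewrite -mulrBr; apply: le_trans (ler_norm _) _; rewrite normrM lift_sign_norm mul1r.
Qed.

Lemma lift_inj x y : T x = T y -> x = y.
Proof.
move=> e; have := lift_expands_norm x y; rewrite e subrr normr0 => h.
apply/eqP; rewrite -subr_eq0 -normr_le0.
by move: h; rewrite pmulr_rle0 // invr_gt0.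
Qed.

(** By expansion [s * T] covers at least the interval of radius [M] around
[s * T 0] on an interval of radius [M] around [0]. *)
Lemma lift_surj y : exists x, T x = y.
Proof.
pose M := `|y - T 0| + 1.
have M0 : 0 <= M by rewrite addr_ge0.
have li : 1 <= al^-1 by rewrite invf_ge1 // ltW.
have c1 : continuous (fun x => s * T x).
  exact: has_deriv_continuous (has_derivZ s (lift_deriv E)).
have sy : `|s * y - s * T 0| <= M.
  by rewrite -mulrBr normrM lift_sign_norm mul1r /M lerDl.
have [x _ hx] : exists2 x, x \in `[- M, M] & s * T x = s * y.
  apply: IVT; first by lra.
    exact: continuous_subspaceT.
  have h1 := lift_expands M0.
  have h2 : al^-1 * (0 - - M) <= s * T 0 - s * T (- M) by apply: lift_expands; lra.
  have h3 : M <= al^-1 * M by rewrite ler_peMl.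
  move: sy; rewrite ler_norml => /andP[sy1 sy2].
  rewrite subr0 in h1; rewrite sub0r opprK in h2.
  by rewrite ge_min le_max; apply/andP; split; apply/orP; [left|right]; lra.
exists x; have := congr1 (fun z => s * z) hx.
by rewrite !mulrA lift_sign_sqr !mul1r.
Qed.

Definition lift_inv y : R := xget 0 [set x | T x = y].
Local Notation psi := lift_inv.

Lemma lift_invK y : T (psi y) = y.
Proof. by have [x hx] := lift_surj y; rewrite /lift_inv; case: xgetP => [z _ //|/(_ x)]. Qed.

Lemma liftK x : psi (T x) = x.
Proof. by apply: lift_inj; rewrite lift_invK. Qed.

Definition inv1 y : R := (T1 (psi y))^-1.
Definition inv2 y : R := - (T2 (psi y) * inv1 y ^+ 3).

Lemma lift_inv_deriv : has_deriv psi inv1.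
Proof.
move=> y; rewrite -{1}(lift_invK y).
apply: (@is_derive_inverse _ T psi (T1 (psi y)) (psi y)).
- by near=> x; exact: liftK.
- by near=> x; exact: has_deriv_continuous (lift_deriv E) x.
- exact: lift_deriv E _.
- exact: lift_neq0.
Unshelve. all: by end_near. Qed.

Lemma inv1_deriv : has_deriv inv1 inv2.
Proof.
have h := has_deriv_comp (lift_deriv2 E) lift_inv_deriv.
apply: has_deriv_ext (has_derivV h (fun y => lift_neq0 (psi y))) _ _ => // y.
rewrite /inv2 -/(inv1 y) /inv1; have := lift_neq0 (psi y).
by move: (T1 _) (T2 _) => u v u0; field.
Qed.

Lemma inv2_continuous : continuous inv2.
Proof.
have c0 := has_deriv_continuous lift_inv_deriv.
have c1 := has_deriv_continuous inv1_deriv.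
move=> y; apply: cvgN; apply: cvgM.
  by apply: continuous_comp; [exact: c0|exact: lift_cont2 E _].
by apply: cvgM; [|apply: cvgM]; exact: c1.
Qed.

(** The degree has the sign [s], since [s * T] increases. *)
Lemma lift_degree : d%:~R = s * `|d|%N%:R.
Proof.
have h : al^-1 * (1 - 0) <= s * T 1 - s * T 0 := lift_expands ler01.
have e : s * T 1 - s * T 0 = s * d%:~R.
  by rewrite -{1}[1]add0r (lift_shift E); ring.
rewrite e subr0 mulr1 in h.
have h0 : 0 < s * d%:~R by apply: lt_le_trans h; rewrite invr_gt0.
have : `|d%:~R| = s * d%:~R :> R.
  by rewrite -(gtr0_norm h0) normrM lift_sign_norm mul1r.
rewrite -intr_norm -abszE => h1.
by rewrite -[X in s * X]/((`|d|%N%:Z)%:~R) h1 mulrA lift_sign_sqr mul1r.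
Qed.

Lemma lift_shift_sign x : T (x + s) = T x + s * d%:~R.
Proof.
case: (lift_sign E) => ->; first by rewrite mul1r (lift_shift E).
by rewrite -[in RHS](subrK 1 x) (lift_shift E) mulN1r addrK.
Qed.

Lemma inv1_sign y : s * inv1 y = `|T1 (psi y)|^-1.
Proof.
rewrite lift_norm1 /inv1 invfM.
by case: (lift_sign E) => ->; rewrite ?invr1 // invrN invr1.
Qed.

(** The distortion constant: [psi'' = - T'' * psi'^3], and two of the factors
[psi'] are at most [al]. *)
Lemma inv_branch : inverse_branch `|d|%N s psi inv1 inv2 al (C * al ^+ 2).
Proof.
have w0 y : 0 < s * inv1 y by rewrite inv1_sign invr_gt0 normr_gt0 lift_neq0.
have wal y : s * inv1 y <= al.
  rewrite inv1_sign -[al]invrK lef_pV2 ?posrE ?invr_gt0 ?normr_gt0 ?lift_neq0 //.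
  by rewrite lift_norm1; exact: lift_exp E _.
have n1 y : `|inv1 y| = s * inv1 y.
  by rewrite -(gtr0_norm (w0 y)) normrM lift_sign_norm mul1r.
split.
- exact: lift_sign E.
- exact: lift_inv_deriv.
- exact: inv1_deriv.
- exact: inv2_continuous.
- move=> y; apply: lift_inj; rewrite lift_shift_sign !lift_invK.
  by rewrite lift_degree mulrA lift_sign_sqr mul1r.
- exact: w0.
- exact: wal.
- move=> y; rewrite /inv2 normrN normrM normrX n1.
  have {n1} := wal y; have {w0} := w0 y; move: (s * inv1 y) => w w0 wal_.
  have -> : `|T2 (psi y)| * w ^+ 3 = `|T2 (psi y)| * w ^+ 2 * w by ring.
  have C0 : 0 <= C := le_trans (normr_ge0 _) (lift_bound2 E 0).
  rewrite ler_pM2r //.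
  apply: (ler_pM (normr_ge0 _) (exprn_ge0 2 (ltW w0))); first exact: (lift_bound2 E _).
  by rewrite lerXn2r ?nnegrE // ltW.
- exact: al1.
Qed.

(** Needed to differentiate the image under the transfer operator twice. *)
Lemma inv_third (T3 : R -> R) (C3 : R) : has_deriv T2 T3 -> continuous T3 ->
  (forall x, `|T3 x| <= C3) -> exists psi3 K2, [/\ has_deriv inv2 psi3,
    continuous psi3 & forall x, `|psi3 x| <= K2 * (s * inv1 x)].
Proof.
move=> h3 c3 b3; have IB := inv_branch.
have h := has_derivN (has_derivM (has_deriv_comp h3 lift_inv_deriv)
  (has_derivM inv1_deriv (has_derivM inv1_deriv inv1_deriv))).
exists (fun y => - (T3 (psi y) * inv1 y ^+ 4 + 3 * T2 (psi y) * inv1 y ^+ 2 * inv2 y)).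
exists (C3 * al ^+ 3 + 3 * C * al ^+ 2 * (C * al ^+ 2)).
have w0 y := branch_gt0 IB y; have wal y := branch_contr IB y.
have w2 y := branch_dist IB y.
have n1 y := branch_norm1 IB y.
have C0 : 0 <= C := le_trans (normr_ge0 _) (lift_bound2 E 0).
have C30 : 0 <= C3 := le_trans (normr_ge0 _) (b3 0).
split.
- apply: has_deriv_ext h _ _ => y; first by rewrite /inv2; ring.
  by ring.
- have c0 := has_deriv_continuous lift_inv_deriv.
  have c1 := has_deriv_continuous inv1_deriv.
  have cT3 : continuous (fun y => T3 (psi y)).
    by move=> y; apply: continuous_comp; [exact: c0|exact: c3].
  have cT2 : continuous (fun y => T2 (psi y)).
    by move=> y; apply: continuous_comp; [exact: c0|exact: lift_cont2 E _].
  move=> y; apply: cvgN; apply: cvgD.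
    by apply: cvgM; [exact: cT3|rewrite /continuous_at; repeat apply: cvgM; exact: c1].
  apply: cvgM; last exact: inv2_continuous.
  apply: cvgM; last by apply: cvgM; exact: c1.
  by apply: cvgM; [exact: cvg_cst|exact: cT2].
- move=> y; rewrite normrN; apply: le_trans (ler_normD _ _) _.
  rewrite [leRHS]mulrDl; apply: lerD.
    rewrite normrM normrX n1.
    have -> : `|T3 (psi y)| * (s * inv1 y) ^+ 4 =
       `|T3 (psi y)| * (s * inv1 y) ^+ 3 * (s * inv1 y) by ring.
    rewrite ler_pM2r //.
    apply: (ler_pM (normr_ge0 _) (exprn_ge0 3 (ltW (w0 y)))); first exact: b3.
    by rewrite lerXn2r ?nnegrE // ltW.
  rewrite !normrM n1 (ger0_norm (ler0n R 3)) -expr2 -[leRHS]mulrA.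
  have q1 : 0 <= 3 * `|T2 (psi y)| by rewrite mulr_ge0.
  have q2 : 0 <= (s * inv1 y) ^+ 2 := exprn_ge0 2 (ltW (w0 y)).
  apply: ler_pM; rewrite ?(mulr_ge0 q1 q2) //.
  apply: (ler_pM q1 q2); first by rewrite ler_pM2l //; exact: lift_bound2 E _.
  by rewrite lerXn2r ?nnegrE // ltW.
Qed.

End ExpandingLift.


(** * The transfer operator as a sum over inverse branches *)

Section TransferBranches.
Variable R : realType.
Variables (T T1 T2 : R -> R) (d : int) (s al C : R).
Hypothesis E : expanding_lift T T1 T2 d s al C.
Implicit Types x y : R.
Local Notation psi := (lift_inv T).
Local Notation inv1 := (inv1 T T1).
Local Notation D := `|d|%N.
Local Notation L := (Lop D s psi inv1).

Lemma lift_shiftZ x (m : int) : T (x + m%:~R) = T x + (m * d)%:~R.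
Proof.
have h : periodic (fun y => T y - y * d%:~R) 1.
  by move=> y; rewrite (lift_shift E); ring.
have := periodicZ h x m; rewrite intrM => e.
by rewrite -[LHS](subrK ((x + m%:~R) * d%:~R)) e; ring.
Qed.

Lemma Re_sum n (f : 'I_n -> R[i]) :
  \sum_(j < n) f j = Complex (\sum_(j < n) complex.Re (f j)) (\sum_(j < n) complex.Im (f j)).
Proof.
elim: n f => [|n IHn] f; first by rewrite !big_ord0.
by rewrite !big_ord_recl IHn; case: (f ord0).
Qed.

Lemma divCr (z : R[i]) (r : R) : z / (r%:C%C) = Complex (complex.Re z / r) (complex.Im z / r).
Proof.
case: z => u v; have [->|r0] := eqVneq r 0.
  by rewrite !invr0 !mulr0.
have -> : (r%:C%C)^-1 = (r^-1)%:C%C.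
  by rewrite [RHS]fmorphV.
by rewrite /GRing.mul /= !mulr0 subr0 add0r.
Qed.

Definition frac_branch x (j : 'I_D) : R :=
  psi (x + j%:R) - (Num.floor (psi (x + j%:R)))%:~R.

(** Two points [psi (x + i)], [psi (x + j)] differ by an integer only if
[i - j] is a multiple of [d]; conversely a point with [T y = x + m] is found
at the index [m modulo d]. *)
Lemma frac_branch_bij x : set_bij [set: 'I_D] (preimages T x) (frac_branch x).
Proof.
have IB := inv_branch E.
split.
- move=> j _; rewrite /preimages /= /frac_branch; split.
    exact: frac_bound.
  exists (j%:Z - Num.floor (psi (x + j%:R)) * d).
  by rewrite -rmorphN /= lift_shiftZ (lift_invK E) mulNr -addrA intrD.
- move=> i j _ _; rewrite /frac_branch => e.
  set a := Num.floor (psi (x + i%:R)) in e; set b := Num.floor (psi (x + j%:R)) in e.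
  have e1 : psi (x + i%:R) = psi (x + j%:R) + (a - b)%:~R.
    by rewrite rmorphB /= addrA addrAC -e subrK.
  have := congr1 T e1; rewrite lift_shiftZ !(lift_invK E) => e2.
  have e3 : (i%:Z)%:~R = (j%:Z + (a - b) * d)%:~R :> R.
    by rewrite intrD; apply: (addrI x); rewrite e2 -addrA.
  have {}e3 : i%:Z = j%:Z + (a - b) * d by exact: (@intr_inj R).
  apply/val_inj => /=; have := ltn_ord i; have := ltn_ord j.
  have [h|h] := eqVneq (a - b) 0; first by move: e3; rewrite h mul0r addr0 => -[].
  move=> li lj; exfalso.
  have h1 : (`|((a - b) * d)%R| < D)%N by move: ((a - b) * d) e3 => c e3; lia.
  by move: h1; rewrite abszM -{2}[D]mul1n ltn_mul2r ltnS leqn0 absz_eq0 (negPf h) andbF.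
- move=> y /= [/andP[y0 y1] [m hm]].
  have D0 : (0 < D)%N.
    rewrite absz_gt0; apply/eqP => d0.
    have := branch_shift IB 0; rewrite d0 absz0 addr0 => /eqP.
    rewrite -subr_eq0 opprD addrA subrr sub0r oppr_eq0 => /eqP s0.
    by have := lift_sign_norm E; rewrite s0 normr0 => /esym/eqP; rewrite oner_eq0.
  have d0 : d != 0 by rewrite -absz_gt0.
  pose j0 := `|(m %% d)%Z|%N.
  have j0z : j0%:Z = (m %% d)%Z by rewrite abszE ger0_norm // modz_ge0.
  have jD : (j0 < D)%N by rewrite -ltz_nat j0z abszE ltz_mod.
  (* Translating by the quotient of [m] by [d] brings [psi (x + m)] to an
  index below [D]. *)
  exists (Ordinal jD) => //; rewrite /frac_branch /=.
  have e : psi (x + j0%:R) = y + (- (m %/ d)%Z)%:~R.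
    apply: (lift_inj E); rewrite (lift_invK E) lift_shiftZ hm -addrA; congr (_ + _).
    rewrite -intrD {1}(divz_eq m d) -[j0%:R]/(j0%:Z%:~R) j0z; congr (_%:~R); ring.
  rewrite e.
  have -> : Num.floor (y + (- (m %/ d)%Z)%:~R) = - (m %/ d)%Z.
    apply/eqP; rewrite floor_eq intrD -[1%:~R]/(1 : R).
    by apply/andP; split; lra.
  by rewrite rmorphN /= opprK subrK.
Qed.

Lemma frac_branchE (A : Type) x j (f : R -> A) : (forall y (m : int), f (y + m%:~R) = f y) ->
  f (frac_branch x j) = f (psi (x + j%:R)).
Proof. by move=> hf; rewrite /frac_branch -rmorphN /= hf. Qed.

(** A complex sum over a set of preimages in the interval from 0 to 1 becomes
a real sum over indices, acting separately on real and imaginary parts. *)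
Lemma transferE (f : R -> R[i]) x : (forall y, f (y + 1) = f y) ->
  transfer T f x = Complex (L (fun y => complex.Re (f y)) x) (L (fun y => complex.Im (f y)) x).
Proof.
move=> pf.
have pr : periodic (fun y => complex.Re (f y)) 1 by move=> y; rewrite pf.
have pi : periodic (fun y => complex.Im (f y)) 1 by move=> y; rewrite pf.
have pT := circle_map_deriv_periodic (lift_deriv E) (lift_shift E).
rewrite /transfer (has_deriv_derive1 (lift_deriv E)) (@reindex_fsbig _ _ _ _ _ (frac_branch x)
  [set: 'I_D] _ _ (frac_branch_bij x)).
have -> : [set: 'I_D] = [set` index_enum 'I_D].
  by apply/seteqP; split => j //= _; rewrite mem_index_enum.
rewrite -fsbig_seq ?index_enum_uniq //.
rewrite Re_sum; congr Complex; apply: eq_bigr => j _; rewrite divCr /= (inv1_sign E) mulrC.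
  by rewrite (@frac_branchE _ x j T1 (periodicZ pT)) (@frac_branchE _ x j (fun y => complex.Re (f y)) (periodicZ pr)).
by rewrite (@frac_branchE _ x j T1 (periodicZ pT)) (@frac_branchE _ x j (fun y => complex.Im (f y)) (periodicZ pi)).
Qed.

End TransferBranches.


(** * Fejer means *)

Section Trigonometric.
Variable R : realType.
Implicit Types (f g : R -> R) (x y t : R) (n m : int).

Definition freq n : R := 2 * pi * n%:~R.
Definition cos_mode n x : R := cos (freq n * x).
Definition sin_mode n x : R := sin (freq n * x).

Lemma freqD n m : freq (n + m) = freq n + freq m.
Proof. by rewrite /freq intrD mulrDr. Qed.

Lemma freqN n : freq (- n) = - freq n.
Proof. by rewrite /freq rmorphN /= mulrN. Qed.

Lemma freqB n m : freq (n - m) = freq n - freq m.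
Proof. by rewrite freqD freqN. Qed.

Lemma cos_mode_deriv n : has_deriv (cos_mode n) (fun x => - freq n * sin_mode n x).
Proof.
have h : has_deriv (cos : R -> R) (fun x => - sin x) by move=> x; exact: is_derive_cos.
apply: has_deriv_ext (has_deriv_comp h (has_derivZ (freq n) (@has_deriv_id R))) _ _ => // x.
by rewrite mulr1 mulNr mulrC mulNr.
Qed.

Lemma sin_mode_deriv n : has_deriv (sin_mode n) (fun x => freq n * cos_mode n x).
Proof.
have h : has_deriv (sin : R -> R) cos by move=> x; exact: is_derive_sin.
apply: has_deriv_ext (has_deriv_comp h (has_derivZ (freq n) (@has_deriv_id R))) _ _ => // x.
by rewrite mulr1 mulrC.
Qed.

Lemma cos_mode_continuous n : continuous (cos_mode n).
Proof. exact: has_deriv_continuous (cos_mode_deriv n). Qed.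

Lemma sin_mode_continuous n : continuous (sin_mode n).
Proof. exact: has_deriv_continuous (sin_mode_deriv n). Qed.

Lemma cos_mode_periodic n : periodic (cos_mode n) 1.
Proof.
have p1 : periodic (fun u : R => cos (2 * pi * u)) 1.
  move=> u; have -> : 2 * pi * (u + 1) = 2 * pi * u + pi *+ 2 :> R by ring.
  by rewrite cosD2pi.
have E y : cos_mode n y = cos (2 * pi * (n%:~R * y)) by rewrite /cos_mode /freq mulrA.
by move=> x; rewrite !E [_ * (x + 1)]mulrDr mulr1; exact: periodicZ p1 (n%:~R * x) n.
Qed.

Lemma sin_mode_periodic n : periodic (sin_mode n) 1.
Proof.
have p1 : periodic (fun u : R => sin (2 * pi * u)) 1.
  move=> u; have -> : 2 * pi * (u + 1) = 2 * pi * u + pi *+ 2 :> R by ring.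
  by rewrite sinD2pi.
have E y : sin_mode n y = sin (2 * pi * (n%:~R * y)) by rewrite /sin_mode /freq mulrA.
by move=> x; rewrite !E [_ * (x + 1)]mulrDr mulr1; exact: periodicZ p1 (n%:~R * x) n.
Qed.

Lemma freq_eq0 n : (freq n == 0) = (n == 0).
Proof. by rewrite /freq mulf_eq0 intr_eq0 gt_eqF ?orFb // mulr_gt0 // pi_gt0. Qed.

Lemma freq0 : freq 0 = 0. Proof. by rewrite /freq mulr0. Qed.

Lemma cos_mode0 x : cos_mode 0 x = 1. Proof. by rewrite /cos_mode freq0 mul0r cos0. Qed.
Lemma sin_mode0 x : sin_mode 0 x = 0. Proof. by rewrite /sin_mode freq0 mul0r sin0. Qed.

Lemma cos_mode_integral n : circle_integral (cos_mode n) = (n == 0)%:R.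
Proof.
have [->|n0] := eqVneq n 0.
  by rewrite -[RHS](@circle_integral_cst R 1); apply: circle_integral_eq => x _; rewrite cos_mode0.
have fn0 : freq n != 0 by rewrite freq_eq0.
have h : has_deriv (fun x => (freq n)^-1 * sin_mode n x) (cos_mode n).
  apply: has_deriv_ext (has_derivZ (freq n)^-1 (sin_mode_deriv n)) _ _ => // x.
  by rewrite mulrA mulVf // mul1r.
apply: (circle_integral_deriv0 h (@cos_mode_continuous n)).
by move=> x; rewrite sin_mode_periodic.
Qed.

Lemma sin_mode_integral n : circle_integral (sin_mode n) = 0.
Proof.
have [->|n0] := eqVneq n 0.
  by rewrite -[RHS](@circle_integral_cst R 0); apply: circle_integral_eq => x _; rewrite sin_mode0.
have fn0 : freq n != 0 by rewrite freq_eq0.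
have h : has_deriv (fun x => - (freq n)^-1 * cos_mode n x) (sin_mode n).
  apply: has_deriv_ext (has_derivZ (- (freq n)^-1) (cos_mode_deriv n)) _ _ => // x.
  by rewrite mulrA mulrNN mulVf // mul1r.
apply: (circle_integral_deriv0 h (@sin_mode_continuous n)).
by move=> x; rewrite cos_mode_periodic.
Qed.

Lemma cos_mode_le1 n x : `|cos_mode n x| <= 1. Proof. exact: cos_max. Qed.
Lemma sin_mode_le1 n x : `|sin_mode n x| <= 1. Proof. exact: sin_max. Qed.

Lemma cos_modeB n x y : cos_mode n (x - y) = cos_mode n x * cos_mode n y + sin_mode n x * sin_mode n y.
Proof. by rewrite /cos_mode mulrBr cosB. Qed.

Lemma cos_mode_shift_integral n x : circle_integral (fun t => cos_mode n (x - t)) = (n == 0)%:R.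
Proof.
have -> : circle_integral (fun t => cos_mode n (x - t)) =
    circle_integral (fun t => cos_mode n x * cos_mode n t + sin_mode n x * sin_mode n t).
  by apply: circle_integral_eq => t _; rewrite cos_modeB.
have c1 := continuous_integrable (@cos_mode_continuous n); have c2 := continuous_integrable (@sin_mode_continuous n).
rewrite circle_integralD; try exact: circle_integrableZ.
rewrite !circle_integralZ // cos_mode_integral sin_mode_integral mulr0 addr0.
by case: eqVneq => [->|]; rewrite ?cos_mode0 ?mulr1 ?mulr0.
Qed.

(** Written as a squared modulus, which makes it nonnegative. *)
Definition fejer_kernel N x : R :=
  N%:R^-1 * ((\sum_(j < N) cos_mode j%:Z x) ^+ 2 + (\sum_(j < N) sin_mode j%:Z x) ^+ 2).

Lemma fejer_kernel_ge0 N x : 0 <= fejer_kernel N x.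
Proof. by rewrite mulr_ge0 ?invr_ge0 // addr_ge0 // sqr_ge0. Qed.

Lemma fejer_kernelE N x : fejer_kernel N x =
  N%:R^-1 * \sum_(j < N) \sum_(l < N) cos_mode (j%:Z - l%:Z) x.
Proof.
rewrite /fejer_kernel; congr (_ * _).
rewrite !expr2 !big_distrlr /= -big_split; apply: eq_bigr => j _ /=.
rewrite -big_split; apply: eq_bigr => l _ /=.
by rewrite /cos_mode /sin_mode freqB mulrBl cosB.
Qed.

Lemma cos_mode_flip_continuous n x : continuous (fun t => cos_mode n (x - t)).
Proof.
move=> t; apply: (continuous_comp (f := fun t => x - t)); last exact: cos_mode_continuous.
by apply: cvgB; [exact: cvg_cst|exact: cvg_id].
Qed.

Lemma sum_double_integral N (F : 'I_N -> 'I_N -> R -> R) :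
  (forall j l, circle_integrable (F j l)) ->
  circle_integral (fun t => \sum_(j < N) \sum_(l < N) F j l t) =
  \sum_(j < N) \sum_(l < N) circle_integral (F j l).
Proof.
move=> hF; rewrite circle_integral_sum; last by move=> j; exact: circle_integrable_sum.
by apply: eq_bigr => j _; rewrite circle_integral_sum.
Qed.

Lemma fejer_continuous N x : continuous (fun t => fejer_kernel N (x - t)).
Proof.
under eq_fun do rewrite fejer_kernelE.
move=> t; apply: cvgM; first exact: cvg_cst.
move: t; apply: continuous_sum => j; apply: continuous_sum => l.
exact: cos_mode_flip_continuous.
Qed.

Lemma sum_diag N (c : nat -> R) :
  \sum_(j < N) \sum_(l < N) ((j : nat) == l)%:R * c j = \sum_(j < N) c j.
Proof.
apply: eq_bigr => j _; rewrite (bigD1 j) //= eqxx mul1r big1 ?addr0 // => l lj.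
by rewrite [_ == _]eq_sym (negPf (lj : (l : nat) != j)) mul0r.
Qed.

Lemma fejer_integral N x : circle_integral (fun t => fejer_kernel N.+1 (x - t)) = 1.
Proof.
have -> : circle_integral (fun t => fejer_kernel N.+1 (x - t)) = circle_integral
   (fun t => N.+1%:R^-1 * \sum_(j < N.+1) \sum_(l < N.+1) cos_mode (j%:Z - l%:Z) (x - t)).
  by apply: circle_integral_eq => t _; rewrite fejer_kernelE.
have cc (j l : 'I_N.+1) : circle_integrable (fun t => cos_mode (j%:Z - l%:Z) (x - t)).
  by apply: continuous_integrable; exact: cos_mode_flip_continuous.
rewrite circle_integralZ; last first.
  by apply: circle_integrable_sum => j; apply: circle_integrable_sum => l.
rewrite sum_double_integral //.
have -> : \sum_(j < N.+1) \sum_(l < N.+1) circle_integral (fun t => cos_mode (j%:Z - l%:Z) (x - t))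
    = \sum_(j < N.+1) \sum_(l < N.+1) ((j : nat) == l)%:R * 1.
  apply: eq_bigr => j _; apply: eq_bigr => l _.
  by rewrite cos_mode_shift_integral mulr1 subr_eq0.
by rewrite (sum_diag _ (fun=> 1)) sumr_const card_ord mulVf ?pnatr_eq0.
Qed.

Lemma cos_modeM n m x : cos_mode n x * cos_mode m x = 2^-1 * (cos_mode (n - m) x + cos_mode (n + m) x).
Proof. by rewrite /cos_mode freqB freqD mulrBl mulrDl cosB cosD; field. Qed.

Lemma sin_modeM n m x : sin_mode n x * sin_mode m x = 2^-1 * (cos_mode (n - m) x - cos_mode (n + m) x).
Proof. by rewrite /cos_mode /sin_mode freqB freqD mulrBl mulrDl cosB cosD; field. Qed.

Lemma cos_sin_modeM n m x : cos_mode n x * sin_mode m x = 2^-1 * (sin_mode (m + n) x + sin_mode (m - n) x).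
Proof. by rewrite /cos_mode /sin_mode freqB freqD mulrBl mulrDl sinB sinD; field. Qed.

Lemma sum_superdiag N : \sum_(j < N.+1) \sum_(l < N.+1) ((j : nat) == l.+1)%:R = N%:R :> R.
Proof.
rewrite exchange_big /= big_ord_recr /= [X in _ + X]big1 ?addr0; last first.
  by move=> j _; rewrite ltn_eqF.
have -> : N%:R = \sum_(l < N) 1 :> R by rewrite sumr_const card_ord.
apply: eq_bigr => l _.
have lN : (l.+1 < N.+1)%N by rewrite ltnS ltn_ord.
rewrite (bigD1 (Ordinal lN)) //= eqxx big1 ?addr0 // => j /negPf.
by rewrite -val_eqE /= => ->.
Qed.

(** The mass that the kernel puts away from the diagonal, as measured by
[1 - cos]: the Fourier coefficient of order one of the kernel is
[N / (N + 1)]. *)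
Lemma fejer_first N x :
  circle_integral (fun t => fejer_kernel N.+1 (x - t) * (1 - cos_mode 1 (x - t))) = N.+1%:R^-1.
Proof.
pose F (j l : 'I_N.+1) t := cos_mode (j%:Z - l%:Z) (x - t) * cos_mode 1 (x - t).
have cF j l : circle_integrable (F j l).
  apply: continuous_integrable => t; apply: cvgM; exact: cos_mode_flip_continuous.
have IF j l : circle_integral (F j l) = 2^-1 * (((j : nat) == l.+1)%:R + ((l : nat) == j.+1)%:R).
  have -> : circle_integral (F j l) = circle_integral (fun t =>
      2^-1 * (cos_mode (j%:Z - l%:Z - 1) (x - t) + cos_mode (j%:Z - l%:Z + 1) (x - t))).
    by apply: circle_integral_eq => t _; rewrite /F cos_modeM.
  have c1 := continuous_integrable (@cos_mode_flip_continuous (j%:Z - l%:Z - 1) x).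
  have c2 := continuous_integrable (@cos_mode_flip_continuous (j%:Z - l%:Z + 1) x).
  rewrite circle_integralZ ?circle_integralD ?cos_mode_shift_integral //; last exact: circle_integrableD.
  by congr (_ * (_%:R + _%:R)); lia.
have ck := continuous_integrable (@fejer_continuous N.+1 x).
have -> : circle_integral (fun t => fejer_kernel N.+1 (x - t) * (1 - cos_mode 1 (x - t))) =
  circle_integral (fun t => fejer_kernel N.+1 (x - t) -
     N.+1%:R^-1 * (\sum_(j < N.+1) \sum_(l < N.+1) F j l t)).
  apply: circle_integral_eq => t _; rewrite mulrBr mulr1; congr (_ - _).
  rewrite fejer_kernelE -mulrA; congr (_ * _); rewrite mulr_suml; apply: eq_bigr => j _.
  by rewrite mulr_suml.
have cs : circle_integrable (fun t => \sum_(j < N.+1) \sum_(l < N.+1) F j l t).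
  by apply: circle_integrable_sum => j; exact: circle_integrable_sum.
rewrite (circle_integralB ck (circle_integrableZ _ cs)) (circle_integralZ _ cs).
rewrite fejer_integral (sum_double_integral cF).
have -> : \sum_(j < N.+1) \sum_(l < N.+1) circle_integral (F j l) = N%:R.
  under eq_bigr do under eq_bigr do rewrite IF.
  under eq_bigr do rewrite -mulr_sumr big_split /=.
  rewrite -mulr_sumr big_split /= sum_superdiag exchange_big /= sum_superdiag.
  by field.
have N0 : N.+1%:R != 0 :> R by rewrite pnatr_eq0.
by move: N0; rewrite -natr1; move: (N%:R) => u u0; field.
Qed.

(** Uniform continuity on the line of a continuous periodic function, from
compactness of a period. *)
Lemma heine f : continuous f -> periodic f 1 -> forall eps : R, 0 < eps ->
  exists2 del : R, 0 < del & forall x t, `|x - t| < del -> `|f x - f t| <= eps.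
Proof.
move=> cf pf eps eps0.
have /compact_near_coveringP cov := @segment_compact R 0 1.
have eps2 : 0 < eps / 2 by lra.
have key : \forall del \near (0 : R)^'+, `[0%R, 1%R] `<=`
    (fun x => forall t, `|x - t| < del -> `|f x - f t| <= eps).
  apply: cov => x _.
  have /cvgrPdist_le /(_ _ eps2) /nbhs_ballP [r /= r0 hr] := cf x.
  have r2 : 0 < r / 2 by lra.
  exists (ball x (r / 2), [set del | del <= r / 2]); first split.
  - exact: nbhsx_ballx.
  - exact: nbhs_right_le.
  move=> [y del] /= [xy dr] t yt.
  have h1 : `|f x - f y| <= eps / 2.
    by apply: hr; apply: lt_le_trans xy _; lra.
  have h2 : `|f x - f t| <= eps / 2.
    apply: hr; rewrite /ball /= -(subrKA y); apply: le_lt_trans (ler_normD _ _) _.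
    by move: xy; rewrite /ball /=; lra.
  rewrite distrC in h1; rewrite -(subrKA (f x)); apply: le_trans (ler_normD _ _) _; lra.
have [del [d0 hd]] : exists del : R, 0 < del /\ (`[0%R, 1%R] `<=`
    (fun x => forall t, `|x - t| < del -> `|f x - f t| <= eps)).
  near (0 : R)^'+ => del; exists del; split => //.
  by near: del.
exists del => // x t xt.
pose m := - Num.floor x.
have hx : 0 <= x + m%:~R < 1 by rewrite /m rmorphN /= frac_bound.
rewrite -(periodicZ pf x m) -(periodicZ pf t m); apply: hd.
  by rewrite /= in_itv /=; lra.
by rewrite opprD addrACA subrr addr0.
Unshelve. all: by end_near. Qed.

(** Away from the diagonal [1 - cos] is bounded below, so that a continuous
function oscillates at most by a multiple of it, up to [eps]. With a positive
kernel this makes [1 - cos] the only test function needed. *)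
Lemma korovkin_bound f : continuous f -> periodic f 1 -> forall eps : R, 0 < eps ->
  exists2 C : R, 0 <= C & forall x t, `|f x - f t| <= eps + C * (1 - cos_mode 1 (x - t)).
Proof.
move=> cf pf eps eps0; have [del0 del00 hdel0] := heine cf pf eps0.
have [B B0 hB] := periodic_bounded cf pf.
pose del := Order.min del0 2^-1.
have del_gt0 : 0 < del by rewrite lt_min del00 invr_gt0 ltr0n.
have del2 : del <= 2^-1 by rewrite ge_min lexx orbT.
have hdel x t : `|x - t| < del -> `|f x - f t| <= eps.
  by move=> h; apply: hdel0; apply: lt_le_trans h _; rewrite ge_min lexx.
have p0 : 0 < pi :> R := pi_gt0 R.
have freq1 : freq 1 = 2 * pi by rewrite /freq mulr1.
pose c := cos (2 * pi * del).
have c1 : c < 1.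
  rewrite -(@cos0 R) ltr_cos ?in_itv /=.
  - by rewrite !mulr_gt0.
  - by rewrite lexx pi_ge0.
  - rewrite !mulr_ge0 ?pi_ge0 ?(ltW del_gt0) //=.
    have -> : 2 * pi * del = pi * (2 * del) by ring.
    by rewrite -[leRHS]mulr1 ler_pM2l //; lra.
exists (2 * B / (1 - c)).
  by rewrite divr_ge0 ?mulr_ge0 // subr_ge0 ltW.
move=> x t; pose m := Num.floor (x - t + 2^-1).
have mb := frac_bound (x - t + 2^-1); rewrite -/m in mb.
(* The representative of [x - t] between [-1/2] and [1/2], an interval on
which the cosine is monotone in the distance to zero. *)
pose u := x - t - m%:~R.
have u2 : `|u| <= 2^-1 by rewrite ler_norml /u; lra.
have tcu : cos_mode 1 (x - t) = cos_mode 1 u.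
  by rewrite -(periodicZ (@cos_mode_periodic 1) (x - t) (- m)) rmorphN.
have ftu : f t = f (x - u).
  have -> : x - u = t + m%:~R by rewrite /u; ring.
  by rewrite periodicZ.
rewrite tcu ftu; have tcle : 0 <= 1 - cos_mode 1 u by rewrite subr_ge0; exact: cos_le1.
have [ud|ud] := ltP `|u| del.
  apply: le_trans (hdel _ _ _) _; first by rewrite opprB addrC subrK.
  by rewrite lerDl mulr_ge0 // divr_ge0 ?mulr_ge0 // subr_ge0 ltW.
have tcc : cos_mode 1 u <= c.
  rewrite /cos_mode freq1 -cos_norm normrM (ger0_norm (_ : 0 <= 2 * pi)); last first.
    by rewrite mulr_ge0 ?pi_ge0.
  have h (v : R) : 0 <= v -> v <= 2^-1 -> 2 * pi * v \in `[0, pi].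
    move=> v0 v2; rewrite in_itv /= !mulr_ge0 ?pi_ge0 //=.
    have -> : 2 * pi * v = pi * (2 * v) by ring.
    by rewrite -[leRHS]mulr1 ler_pM2l //; lra.
  rewrite leNgt /c ltr_cos ?h ?(ltW del_gt0) // -leNgt ler_pM2l // mulr_gt0 //.
have h2 : `|f x - f (x - u)| <= 2 * B.
  apply: le_trans (ler_normB _ _) _; rewrite mulr_natl mulr2n; exact: lerD.
apply: le_trans h2 _; apply: le_trans (_ : 2 * B / (1 - c) * (1 - c) <= _).
  by rewrite divfK // subr_eq0 gt_eqF.
rewrite -[leLHS]add0r; apply: lerD; first exact: ltW.
apply: ler_wpM2l; last by lra.
by rewrite divr_ge0 ?mulr_ge0 // subr_ge0 ltW.
Qed.

Definition fejer f N x : R := circle_integral (fun t => f t * fejer_kernel N.+1 (x - t)).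

(** Integrate [korovkin_bound] against the kernel: the error is at most
[eps / 2 + C / (N + 1)]. *)
Lemma fejer_approx f : continuous f -> periodic f 1 -> forall eps : R, 0 < eps ->
  exists N, forall x, `|f x - fejer f N x| <= eps.
Proof.
move=> cf pf eps eps0; have eps2 : 0 < eps / 2 by lra.
have [C C0 hC] := korovkin_bound cf pf eps2.
pose N := Num.bound (C / (eps / 2)).
have hN : C * N.+1%:R^-1 <= eps / 2.
  rewrite ler_pdivrMr ?ltr0n // mulrC -ler_pdivrMr //.
  have C2 : 0 <= C / (eps / 2) by rewrite divr_ge0 // ltW.
  apply: ltW; apply: lt_trans (archi_boundP C2) _.
  by rewrite ltr_nat.
exists N => x.
have ck := @fejer_continuous N.+1 x.
have cfk : continuous (fun t => f t * fejer_kernel N.+1 (x - t)).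
  by move=> t; apply: cvgM; [exact: cf|exact: ck].
have e1 : f x = circle_integral (fun t => f x * fejer_kernel N.+1 (x - t)).
  by rewrite circle_integralZ ?fejer_integral ?mulr1 //; exact: continuous_integrable.
have cxk : continuous (fun t => f x * fejer_kernel N.+1 (x - t)).
  by move=> t; apply: cvgM; [exact: cvg_cst|exact: ck].
rewrite {1}e1 /fejer -circle_integralB; try exact: continuous_integrable.
have cd : continuous (fun t => f x * fejer_kernel N.+1 (x - t) - f t * fejer_kernel N.+1 (x - t)).
  by move=> t; apply: cvgB; [exact: cxk|exact: cfk].
have ct : continuous (fun t => fejer_kernel N.+1 (x - t) * (1 - cos_mode 1 (x - t))).
  move=> t; apply: cvgM; first exact: ck.
  by apply: cvgB; [exact: cvg_cst|exact: cos_mode_flip_continuous].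
apply: le_trans (circle_integral_norm (continuous_integrable cd)) _.
apply: le_trans (_ : circle_integral (fun t => (eps / 2) * fejer_kernel N.+1 (x - t) +
   C * (fejer_kernel N.+1 (x - t) * (1 - cos_mode 1 (x - t)))) <= _).
  apply: circle_integral_le.
  - exact/circle_integrable_norm/continuous_integrable.
  - by apply: circle_integrableD; apply: circle_integrableZ; exact: continuous_integrable.
  move=> t _; rewrite -mulrBl normrM (ger0_norm (fejer_kernel_ge0 _ _)).
  have -> : eps / 2 * fejer_kernel N.+1 (x - t) +
   C * (fejer_kernel N.+1 (x - t) * (1 - cos_mode 1 (x - t))) =
   (eps / 2 + C * (1 - cos_mode 1 (x - t))) * fejer_kernel N.+1 (x - t) by ring.
  by apply: ler_wpM2r; [exact: fejer_kernel_ge0|exact: hC].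
have ick := continuous_integrable ck; have ict := continuous_integrable ct.
rewrite (circle_integralD (circle_integrableZ _ ick) (circle_integrableZ _ ict)).
rewrite (circle_integralZ _ ick) (circle_integralZ _ ict).
by rewrite fejer_integral fejer_first mulr1 [leRHS]splitr lerD2l.
Qed.

(** Real Fourier coefficients; [cos_coef f n - i * sin_coef f n] is the usual
complex coefficient of order [n]. *)
Definition cos_coef f n : R := circle_integral (fun t => f t * cos_mode n t).
Definition sin_coef f n : R := circle_integral (fun t => f t * sin_mode n t).
(** The contribution of the frequencies [n] and [- n], up to a factor two if
[n != 0]. *)
Definition fourier_mode_part f n x : R := cos_coef f n * cos_mode n x + sin_coef f n * sin_mode n x.

Lemma fmode_integral f n x : circle_integrable f ->
  circle_integral (fun t => f t * cos_mode n (x - t)) = fourier_mode_part f n x.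
Proof.
move=> hf.
have c1 := circle_integrableM hf (@cos_mode_continuous n).
have c2 := circle_integrableM hf (@sin_mode_continuous n).
have -> : circle_integral (fun t => f t * cos_mode n (x - t)) =
   circle_integral (fun t => cos_mode n x * (f t * cos_mode n t) + sin_mode n x * (f t * sin_mode n t)).
  by apply: circle_integral_eq => t _; rewrite cos_modeB; ring.
rewrite circle_integralD; try exact: circle_integrableZ.
by rewrite !circle_integralZ // /fourier_mode_part mulrC [X in _ + X]mulrC.
Qed.

Lemma fejerE f N x : circle_integrable f ->
  fejer f N x = N.+1%:R^-1 * \sum_(j < N.+1) \sum_(l < N.+1) fourier_mode_part f (j%:Z - l%:Z) x.
Proof.
move=> hf; rewrite /fejer.
have cc (j l : 'I_N.+1) : circle_integrable (fun t => f t * cos_mode (j%:Z - l%:Z) (x - t)).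
  by apply: circle_integrableM => //; exact: cos_mode_flip_continuous.
have -> : circle_integral (fun t => f t * fejer_kernel N.+1 (x - t)) = circle_integral
   (fun t => N.+1%:R^-1 * \sum_(j < N.+1) \sum_(l < N.+1) f t * cos_mode (j%:Z - l%:Z) (x - t)).
  apply: circle_integral_eq => t _; rewrite fejer_kernelE mulrCA; congr (_ * _).
  by rewrite mulr_sumr; apply: eq_bigr => j _; rewrite mulr_sumr.
rewrite circle_integralZ; last first.
  by apply: circle_integrable_sum => j; apply: circle_integrable_sum => l.
rewrite sum_double_integral //; congr (_ * _).
by apply: eq_bigr => j _; apply: eq_bigr => l _; rewrite fmode_integral.
Qed.

(** By [fejerE] the Fejer means only depend on the coefficients, and they
converge to the function. *)
Lemma fourier_unique f g : continuous f -> continuous g -> periodic f 1 -> periodic g 1 ->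
  (forall n, cos_coef f n = cos_coef g n) -> (forall n, sin_coef f n = sin_coef g n) -> f = g.
Proof.
move=> cf cg pf pg ec es; apply/funext => x.
apply/eqP; rewrite -subr_eq0 -normr_le0; apply/ler_addgt0Pr => eps eps0; rewrite add0r.
pose h y := f y - g y.
have ch : continuous h by move=> y; apply: cvgB; [exact: cf|exact: cg].
have ph : periodic h 1 by move=> y; rewrite /h pf pg.
have [N hN] := fejer_approx ch ph eps0.
have := hN x; rewrite fejerE; last exact: continuous_integrable.
rewrite big1 ?mulr0 ?subr0 // => j _; rewrite big1 // => l _.
have cI := continuous_integrable cf; have cgI := continuous_integrable cg.
have e1 n : cos_coef h n = 0.
  rewrite /cos_coef /h; under eq_Rintegral do rewrite mulrBl.
  rewrite circle_integralB; try by apply: circle_integrableM => //; exact: cos_mode_continuous.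
  by rewrite -/(cos_coef f n) ec subrr.
have e2 n : sin_coef h n = 0.
  rewrite /sin_coef /h; under eq_Rintegral do rewrite mulrBl.
  rewrite circle_integralB; try by apply: circle_integrableM => //; exact: sin_mode_continuous.
  by rewrite -/(sin_coef f n) es subrr.
by rewrite /fourier_mode_part e1 e2 !mul0r addr0.
Qed.

(** The Fejer means are trigonometric polynomials with the same mean. *)
Lemma smooth_approx f : continuous f -> periodic f 1 -> circle_integral f = 0 ->
  forall eps : R, 0 < eps -> exists g g1, [/\ has_deriv g g1, continuous g1,
     periodic g 1, circle_integral g = 0 & forall x, `|f x - g x| <= eps].
Proof.
move=> cf pf If eps eps0; have [N hN] := fejer_approx cf pf eps0.
have cI := continuous_integrable cf.
have hm n : has_deriv (fourier_mode_part f n) (fun x => cos_coef f n * (- freq n * sin_mode n x) + sin_coef f n * (freq n * cos_mode n x)).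
  exact: has_derivD (has_derivZ _ (cos_mode_deriv n)) (has_derivZ _ (sin_mode_deriv n)).
have cm n := has_deriv_continuous (hm n).
pose g x := N.+1%:R^-1 * \sum_(j < N.+1) \sum_(l < N.+1) fourier_mode_part f (j%:Z - l%:Z) x.
have hg : has_deriv g (fun x => N.+1%:R^-1 * \sum_(j < N.+1) \sum_(l < N.+1)
   (cos_coef f (j%:Z - l%:Z) * (- freq (j%:Z - l%:Z) * sin_mode (j%:Z - l%:Z) x) +
    sin_coef f (j%:Z - l%:Z) * (freq (j%:Z - l%:Z) * cos_mode (j%:Z - l%:Z) x))).
  apply: has_derivZ; apply: has_deriv_sum => j; apply: has_deriv_sum => l; exact: hm.
exists g; eexists; split; first exact: hg.
- move=> x; apply: cvgM; first exact: cvg_cst.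
  move: x; apply: continuous_sum => j; apply: continuous_sum => l.
  move=> x; apply: cvgD; apply: cvgM; try exact: cvg_cst.
    by apply: cvgM; [exact: cvg_cst|exact: sin_mode_continuous].
  by apply: cvgM; [exact: cvg_cst|exact: cos_mode_continuous].
- move=> x; rewrite /g; congr (_ * _); apply: eq_bigr => j _; apply: eq_bigr => l _.
  by rewrite /fourier_mode_part cos_mode_periodic sin_mode_periodic.
- have cJ (j l : 'I_N.+1) : circle_integrable (fourier_mode_part f (j%:Z - l%:Z)).
    exact: continuous_integrable (cm _).
  rewrite /g circle_integralZ; last first.
    by apply: circle_integrable_sum => j; apply: circle_integrable_sum => l.
  rewrite sum_double_integral // big1 ?mulr0 // => j _; rewrite big1 // => l _.
  have c1 := continuous_integrable (@cos_mode_continuous (j%:Z - l%:Z)).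
  have c2 := continuous_integrable (@sin_mode_continuous (j%:Z - l%:Z)).
  rewrite /fourier_mode_part circle_integralD; try exact: circle_integrableZ.
  rewrite !circle_integralZ // cos_mode_integral sin_mode_integral mulr0 addr0.
  case: eqVneq => [->|]; rewrite ?mulr0 // mulr1 -[RHS]If.
  by apply: circle_integral_eq => t _; rewrite cos_mode0 mulr1.
- by move=> x; rewrite /g -fejerE.
Qed.

End Trigonometric.


(** * From continuous functions to periodic sets *)

Section MonotoneClass.
Variable R : realType.
Implicit Types (f g h phi : R -> R) (x y t : R) (A B : set R).
Local Notation mu := (@lebesgue_measure R).
Local Notation I01 := (`[0%R, 1%R]%classic : set R).

Lemma circle_integrable_bounded g phi : circle_integrable g ->
  measurable_fun setT phi -> (forall x, `|phi x| <= 1) ->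
  circle_integrable (fun x => g x * phi x).
Proof.
move=> hg mphi bphi; apply: (integrableMl (@measurable_I01 R) hg).
  by apply: measurable_funS mphi.
exists 1; split; first exact: num_real.
by move=> M M1 x _; apply: le_trans (bphi x) (ltW M1).
Qed.

Lemma circle_dct g (phi_ : nat -> R -> R) phi : circle_integrable g ->
  (forall n, measurable_fun setT (phi_ n)) -> (forall n x, `|phi_ n x| <= 1) ->
  (forall x, phi_ ^~ x @ \oo --> phi x) ->
  [/\ measurable_fun setT phi, forall x, `|phi x| <= 1 &
   (fun n => circle_integral (fun x => g x * phi_ n x)) @ \oo -->
     circle_integral (fun x => g x * phi x)].
Proof.
move=> hg mphi bphi cphi.
have mp : measurable_fun setT phi.
  by apply: (@measurable_fun_cvg _ _ _ _ phi_) => // x _; exact: cphi.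
have bp x : `|phi x| <= 1.
  apply: (@cvgr_to_le _ \oo _ _ (fun n => `|phi_ n x|)); last by near=> n; exact: bphi.
  by apply: cvg_norm; exact: cphi.
split => //.
have ign n := circle_integrable_bounded hg (mphi n) (bphi n).
have igp := circle_integrable_bounded hg mp bp.
have [] := @dominated_convergence _ _ _ mu I01 (@measurable_I01 R)
  (fun n => EFin \o (fun x => g x * phi_ n x)) (EFin \o (fun x => g x * phi x))
  (EFin \o (fun x => `|g x|)).
- by move=> n; exact: measurable_int (ign n).
- exact: measurable_int igp.
- apply: aeW => x _ /=; apply: cvg_EFin; first by near=> n.
  by apply: cvgM; [exact: cvg_cst|exact: cphi].
- exact: circle_integrable_norm.
- by apply: aeW => x n _ /=; rewrite lee_fin normrM ler_piMr.
move=> _ _ hc.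
rewrite /Rintegral; apply: fine_cvg; rewrite fineK //.
exact: integrable_fin_num igp.
Unshelve. all: by end_near. Qed.

Lemma indic_sub (p : bool) : `|p%:R| <= 1 :> R.
Proof. by case: p; rewrite ?normr1 ?normr0. Qed.

(** Bounded continuous functions of [v] that increase to the indicator of
[0 < v]; the positive part is written [(`|v| + v) / 2]. *)
Definition soft_pos (n : nat) (v : R) : R := let p := (`|v| + v) / 2 in p / (p + n.+1%:R^-1).

Lemma soft_posE n v : soft_pos n v = if 0 < v then v / (v + n.+1%:R^-1) else 0.
Proof.
rewrite /soft_pos; case: ltP => v0.
  by rewrite gtr0_norm //; have -> : (v + v) / 2 = v by field.
by rewrite ler0_norm // addNr !mul0r.
Qed.

Lemma soft_pos_bound n v : 0 <= soft_pos n v <= 1.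
Proof.
rewrite soft_posE; case: ltP => v0; last by rewrite lexx ler01.
have n0 : 0 < n.+1%:R^-1 :> R by rewrite invr_gt0 ltr0n.
have vn : 0 < v + n.+1%:R^-1 by rewrite addr_gt0.
by rewrite divr_ge0 ?ler_pdivrMr ?mul1r ?lerDl ?(ltW n0) ?(ltW v0) ?(ltW vn).
Qed.

Lemma soft_pos_cvg v : (fun n => soft_pos n v) @ \oo --> ((0 < v)%R%:R : R).
Proof.
under eq_fun do rewrite soft_posE.
case: ltP => v0; last exact: cvg_cst.
have l : (fun n => v / (v + n.+1%:R^-1)) @ \oo --> v / (v + 0).
  apply: cvgM; first exact: cvg_cst.
  apply: cvgV; first by rewrite addr0 gt_eqF.
  by apply: cvgD; [exact: cvg_cst|exact: cvg_harmonic].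
by rewrite addr0 divff ?gt_eqF // in l.
Qed.

Lemma soft_pos_continuous n h : continuous h -> continuous (fun x => soft_pos n (h x)).
Proof.
move=> ch; have cp : continuous (fun x => (`|h x| + h x) / 2).
  move=> x; apply: cvgM; last exact: cvg_cst.
  by apply: cvgD; [apply: cvg_norm; exact: ch|exact: ch].
have p0 x : 0 <= (`|h x| + h x) / 2.
  rewrite divr_ge0 // -lerBlDr sub0r; apply: le_trans (ler_norm _) _.
  by rewrite normrN.
have n0 : 0 < n.+1%:R^-1 :> R by rewrite invr_gt0 ltr0n.
move=> x; apply: cvgM; first exact: cp.
apply: cvgV; first by rewrite gt_eqF // ltr_wpDl.
by apply: cvgD; [exact: cp|exact: cvg_cst].
Qed.

Definition frac x : R := x - (Num.floor x)%:~R.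

Lemma measurable_frac : measurable_fun setT frac.
Proof.
apply: measurable_funB => //; apply: nondecreasing_measurable => // x y xy.
by rewrite ler_int; exact: le_floor.
Qed.

Lemma frac_periodic x (m : int) : frac (x + m%:~R) = frac x.
Proof.
rewrite /frac; have -> : Num.floor (x + m%:~R) = Num.floor x + m.
  apply/eqP; rewrite floor_eq; have := frac_bound x.
  by rewrite !intrD -[1%:~R]/(1 : R) => /andP[h1 h2]; apply/andP; split; lra.
by rewrite intrD; ring.
Qed.

(** Up to a shift, a cosine minus a constant, positive exactly on the arc from
[a] to [1]: the arc has centre [(a + 1) / 2] and half-length [(1 - a) / 2]. *)
Definition arc (a x : R) : R := cos_mode 1 (x - (a + 1) / 2) - cos (pi * (1 - a)).

Lemma arc_continuous a : continuous (arc a).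
Proof.
move=> x; apply: cvgB; last exact: cvg_cst.
apply: (continuous_comp (f := fun x => x - (a + 1) / 2)); last exact: cos_mode_continuous.
by apply: cvgB; [exact: cvg_id|exact: cvg_cst].
Qed.

Lemma arc_periodic a : periodic (arc a) 1.
Proof. by move=> x; rewrite /arc addrAC cos_mode_periodic. Qed.

Lemma arcE a y : 0 <= a < 1 -> 0 <= y < 1 -> (0 < arc a y) = (a < y).
Proof.
move=> /andP[a0 a1] /andP[y0 y1]; rewrite subr_gt0.
have p0 : 0 < pi :> R := pi_gt0 R.
set u := y - _.
have eu : cos_mode 1 u = cos (2 * pi * `|u|).
  by rewrite -[in RHS](@cos_norm R) normrM normr_id -normrM cos_norm /cos_mode /freq mulr1.
pose r := (1 - a) / 2.
have -> : pi * (1 - a) = 2 * pi * r by rewrite /r; field.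
have h (v : R) : 0 <= v -> v <= 2^-1 -> 2 * pi * v \in `[0, pi].
  move=> v0 v2; rewrite in_itv /= !mulr_ge0 ?pi_ge0 //=.
  have -> : 2 * pi * v = pi * (2 * v) by ring.
  by rewrite -[leRHS]mulr1 ler_pM2l //; lra.
have r2 : r <= 2^-1 by rewrite /r; lra.
have r0 : 0 <= r by rewrite /r; lra.
have pp : 0 < 2 * pi :> R by rewrite mulr_gt0.
rewrite eu; have [u2|u2] := leP `|u| 2^-1.
  rewrite ltr_cos ?h // ltr_pM2l // ltr_norml /u /r.
  by apply/andP/idP => [[h1 h2]|h1]; [lra|split; lra].
have yu : u < 0.
  by rewrite ltNge; apply/negP => u0; move: u2; rewrite ger0_norm // /u; lra.
have uE : `|u| = - u by rewrite ltr0_norm.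
have -> : cos (2 * pi * `|u|) = cos (2 * pi * (1 - `|u|)).
  have -> : 2 * pi * (1 - `|u|) = - (2 * pi * `|u|) + pi *+ 2 by ring.
  by rewrite cosD2pi cosN.
rewrite uE in u2 *.
have m2 : 2 * pi * (1 - - u) \in `[0, pi] by apply: h; move: u2; rewrite /u; lra.
rewrite ltr_cos //; last exact: h.
rewrite ltr_pM2l //.
by move: u2; rewrite /u /r => u2; apply/idP/idP => h1; lra.
Qed.

(** Arcs are positivity sets of continuous periodic functions, hence bounded
limits of such functions by [soft_pos]; they generate the Borel sets of the
period, and the sets on which both integrals agree are stable under
complements and disjoint unions. The two maps [h1] and [h2] allow both
invariance (a map and the identity) and vanishing of coefficients (twice the
identity). *)
Lemma monotone_class (g1 g2 h1 h2 : R -> R) :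
  circle_integrable g1 -> circle_integrable g2 ->
  continuous h1 -> continuous h2 ->
  (forall phi, continuous phi -> periodic phi 1 ->
     circle_integral (fun x => g1 x * phi (h1 x)) =
     circle_integral (fun x => g2 x * phi (h2 x))) ->
  forall A, measurable A ->
    circle_integral (fun x => g1 x * \1_A (frac (h1 x))) =
    circle_integral (fun x => g2 x * \1_A (frac (h2 x))).
Proof.
move=> i1 i2 c1 c2 H.
have mh1 := continuous_measurable_fun c1; have mh2 := continuous_measurable_fun c2.
have mind A h : measurable A -> measurable_fun setT h ->
    measurable_fun setT (fun x => \1_A (frac (h x)) : R).
  move=> mA mh; apply: (measurableT_comp (measurable_indic mA)).
  exact: measurableT_comp measurable_frac mh.
have bind A h x : `|\1_A (frac (h x)) : R| <= 1 by rewrite indicE indic_sub.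
(* Rays cut the fundamental domain along arcs. *)
have arcI (a : R) : 0 <= a < 1 ->
    circle_integral (fun x => g1 x * \1_(`]a, +oo[%classic) (frac (h1 x))) =
    circle_integral (fun x => g2 x * \1_(`]a, +oo[%classic) (frac (h2 x))).
  move=> a01.
  have aP (x : R) : (\1_(`]a, +oo[%classic) (frac x) : R) = (0 < arc a x)%R%:R.
    rewrite indicE; congr ((nat_of_bool _)%:R); rewrite -(periodicZ (@arc_periodic a) x (- Num.floor x)).
    rewrite rmorphN /= -/(frac x) arcE //; last exact: frac_bound.
    by apply/idP/idP => [|h]; [rewrite inE /= in_itv /= andbT|rewrite inE /= in_itv /= h].
  have cv g h : circle_integrable g -> continuous h ->
     (fun n => circle_integral (fun x => g x * soft_pos n (arc a (h x)))) @ \oo -->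
     circle_integral (fun x => g x * \1_(`]a, +oo[%classic) (frac (h x))).
    move=> ig ch.
    have H1 n : measurable_fun setT (fun x => soft_pos n (arc a (h x))).
      apply: continuous_measurable_fun; apply: (soft_pos_continuous (h := fun x => arc a (h x))).
      by move=> x; apply: continuous_comp; [exact: ch|exact: arc_continuous].
    have H2 n x : `|soft_pos n (arc a (h x))| <= 1.
      by have /andP[? ?] := soft_pos_bound n (arc a (h x)); rewrite ger0_norm.
    have H3 x : (fun n => soft_pos n (arc a (h x))) @ \oo -->
        (\1_(`]a, +oo[%classic) (frac (h x)) : R).
      by rewrite aP; exact: soft_pos_cvg.
    by have [_ _] := circle_dct ig H1 H2 H3.
  have E n : circle_integral (fun x => g1 x * soft_pos n (arc a (h1 x))) =
             circle_integral (fun x => g2 x * soft_pos n (arc a (h2 x))).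
    apply: (H (fun y => soft_pos n (arc a y))).
      exact: soft_pos_continuous (@arc_continuous a).
    by move=> y; rewrite arc_periodic.
  have l1 := cv _ _ i1 c1; have l2 := cv _ _ i2 c2.
  move: l1; under eq_fun do rewrite E; move=> l1.
  exact: cvg_unique _ l1 l2.
have tot : circle_integral g1 = circle_integral g2.
  have e g : circle_integral (fun x => g x * 1) = circle_integral g.
    by apply: circle_integral_eq => x _; rewrite mulr1.
  have c1' : continuous (fun _ : R => 1 : R) by move=> x; exact: cvg_cst.
  by have := H (fun=> 1) c1' (fun x => erefl); rewrite /= !e.
have allI g h : circle_integral (fun x => g x * \1_[set: R] (frac (h x))) = circle_integral g.
  by apply: circle_integral_eq => x _; rewrite indicE in_setT mulr1.
have GE : @measurable _ (measurableTypeR R) = <<s @RGenOInfty.G R >>.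
  exact: RGenOInfty.measurableE.
move=> A mA; have {mA} GA : <<s @RGenOInfty.G R >> A by rewrite -GE.
move: A GA; apply: (@dynkin_induction _ (measurableTypeR R) (@RGenOInfty.G R) (fun A =>
    circle_integral (fun x => g1 x * \1_A (frac (h1 x))) =
    circle_integral (fun x => g2 x * \1_A (frac (h2 x)))) GE).
- move=> _ _ [a ->] [b ->]; exists (Order.max a b).
  apply/seteqP; split => x /=; rewrite !in_itv /= !andbT gt_max => /andP //.
- by rewrite !allI.
- move=> _ [a ->]; have [a0|a0] := ltP a 0.
    have e g h : circle_integral (fun x => g x * \1_(`]a, +oo[%classic) (frac (h x))) = circle_integral g.
      apply: circle_integral_eq => x _; rewrite indicE mem_set ?mulr1 //=.
      by rewrite in_itv /= andbT; apply: lt_le_trans a0 _; case/andP: (frac_bound (h x)).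
    by rewrite !e.
  have [a1|a1] := ltP a 1; first by apply: arcI; rewrite a0.
  have e g h : circle_integral (fun x => g x * \1_(`]a, +oo[%classic) (frac (h x))) = 0.
    rewrite -[RHS](@circle_integral_cst R 0).
    apply: circle_integral_eq => x _; rewrite indicE memNset ?mulr0 //=.
    rewrite in_itv /= andbT => h'; have /andP[_ h1'] := frac_bound (h x).
    by have := lt_trans h' h1'; rewrite ltNge a1.
  by rewrite !e.
- move=> A mA E.
  have e g h : circle_integrable g -> continuous h ->
     circle_integral (fun x => g x * \1_(~` A) (frac (h x))) =
     circle_integral g - circle_integral (fun x => g x * \1_A (frac (h x))).
    move=> ig ch; have mh := continuous_measurable_fun ch.
    rewrite -circle_integralB //; last first.
      exact: circle_integrable_bounded ig (mind A h mA mh) (bind A h).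
    apply: circle_integral_eq => x _; rewrite !indicE in_setC.
    by case: (_ \in A); rewrite /= ?mulr1 ?mulr0 ?subrr ?subr0.
  by rewrite !e // E tot.
move=> F mF tF EF.
have cvF g h : circle_integrable g -> continuous h ->
    (fun n => \sum_(k < n) circle_integral (fun x => g x * \1_(F k) (frac (h x)))) @ \oo -->
    circle_integral (fun x => g x * \1_(\bigcup_k F k) (frac (h x))).
  move=> ig ch; have mh := continuous_measurable_fun ch.
  pose S n x : R := \1_(\big[setU/set0]_(k < n) F k) (frac (h x)).
  have mS n : measurable (\big[setU/set0]_(k < n) F k).
    by apply: bigsetU_measurable => k _; exact: mF.
  have eS n : circle_integral (fun x => g x * S n x) =
      \sum_(k < n) circle_integral (fun x => g x * \1_(F k) (frac (h x))).
    rewrite -circle_integral_sum; last first.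
      by move=> k; exact: circle_integrable_bounded ig (mind _ h (mF k) mh) (bind _ h).
    apply: circle_integral_eq => x _; rewrite -mulr_sumr; congr (_ * _).
    rewrite /S; move: (frac (h x)) => y.
    elim: n => [|n IHn]; first by rewrite !big_ord0 indicE memNset.
    rewrite !big_ord_recr /= -IHn !indicE in_setU.
    have [yn|yn] := boolP (y \in F n); last by rewrite orbF addr0.
    suff -> : (y \in \big[setU/set0]_(k < n) F k) = false by rewrite add0r.
    apply: memNset; rewrite -bigcup_mkord => -[k /= kn Fk].
    have kE : k = n by apply: tF => //; exists y; split => //; rewrite inE in yn.
    by rewrite kE ltnn in kn.
  have H3 x : S ^~ x @ \oo --> (\1_(\bigcup_k F k) (frac (h x)) : R).
    rewrite /S; move: (frac (h x)) => y; have [[k _ Fk]|nF] := pselect ((\bigcup_k F k) y).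
      have -> : \1_(\bigcup_k F k) y = 1 :> R by rewrite indicE mem_set //; exists k.
      apply: cvg_near_cst; near=> n; rewrite indicE mem_set //.
      rewrite -bigcup_mkord; exists k => //=.
      by near: n; exact: nbhs_infty_gt.
    have -> : \1_(\bigcup_k F k) y = 0 :> R by rewrite indicE memNset.
    apply: cvg_near_cst; near=> n.
    rewrite indicE memNset //; rewrite -bigcup_mkord => -[k _ Fk].
    by apply: nF; exists k.
  have [_ _] := circle_dct ig (fun n => mind _ h (mS n) mh) (fun n => bind _ h) H3.
  by under eq_fun do rewrite eS.
have l1 := cvF _ _ i1 c1; have l2 := cvF _ _ i2 c2.
have e n : \sum_(k < n) circle_integral (fun x => g1 x * \1_(F k) (frac (h1 x))) =
  \sum_(k < n) circle_integral (fun x => g2 x * \1_(F k) (frac (h2 x))).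
  by apply: eq_bigr => k _; exact: EF.
move: l1; under eq_fun do rewrite e; move=> l1.
exact: cvg_unique _ l1 l2.
Unshelve. all: by end_near. Qed.

End MonotoneClass.


(** * Fixed points of the transfer operator and invariant densities *)

Section InvariantDensities.
Variable R : realType.
Implicit Types (f g h phi : R -> R) (x y t : R) (A B : set R).
Local Notation mu := (@lebesgue_measure R).
Local Notation I01 := (`[0%R, 1%R]%classic : set R).

Lemma EFin_circle_integral g : circle_integrable g ->
  (\int[mu]_(x in I01) (g x)%:E)%E = (circle_integral g)%:E.
Proof. by move=> ig; rewrite /Rintegral fineK //; exact: integrable_fin_num ig. Qed.

Lemma integral_restrict g A : circle_integrable (fun x => g x * \1_A x) ->
  (\int[mu]_(x in I01 `&` A) (g x)%:E)%E = (circle_integral (fun x => g x * \1_A x))%:E.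
Proof.
move=> ig; rewrite -EFin_circle_integral // integral_mkcondr.
apply: eq_integral => x _; rewrite /patch indicE; case: (x \in A); first by rewrite mulr1.
by rewrite mulr0.
Qed.

(** An antiderivative is nondecreasing and periodic, hence constant. *)
Lemma continuous_integral_eq0 h : continuous h -> periodic h 1 -> (forall x, 0 <= h x) ->
  circle_integral h = 0 -> forall x, h x = 0.
Proof.
move=> ch ph h0 Ih; have [F hF] := antiderivative ch.
have mono := has_deriv_nondecr hF h0.
have pF : periodic F 1.
  have hd : forall z, is_derive z (1 : R) (fun z => F (z + 1) - F z) 0.
    by move=> z; have := has_derivB (has_deriv_shift 1 hF) hF z; rewrite ph subrr.
  move=> y; apply/eqP; rewrite -subr_eq0.
  rewrite (is_derive_0_is_cst y 0 hd) add0r -(circle_integral_deriv hF ch) Ih //.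
have cF x y : x <= y -> F x = F y.
  move=> xy; apply/eqP; rewrite eq_le mono //=.
  have yx : 0 <= y - x by rewrite subr_ge0.
  have := archi_boundP yx; set n := Num.bound _ => hn.
  rewrite -(periodicZ pF x n); apply: mono.
  by rewrite -lerBlDl ltW.
have F0 x : F x = F 0.
  by case: (leP x 0) => [/cF //|/ltW /cF ->].
have e := has_deriv_uniq (has_deriv_ext (has_deriv_cst (F 0)) (fun x => esym (F0 x)) (fun=> erefl)) hF.
by move=> x; rewrite -e.
Qed.

(** Such a function is orthogonal to trigonometric polynomials, hence to
continuous functions by uniform approximation, hence to indicators of periodic
sets by [monotone_class], in particular to those of its positivity set and the
complement. *)
Lemma fourier_zero g : circle_integrable g -> periodic g 1 ->
  (forall n, cos_coef g n = 0) -> (forall n, sin_coef g n = 0) ->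
  circle_integral (fun x => `|g x|) = 0.
Proof.
move=> ig pg gc gs.
have Iphi phi : continuous phi -> periodic phi 1 -> circle_integral (fun x => g x * phi x) = 0.
  move=> cphi pphi; apply/eqP; rewrite -normr_le0; apply/ler_addgt0Pr => eps eps0.
  rewrite add0r; pose G := circle_integral (fun x => `|g x|).
  have G0 : 0 <= G by exact: circle_integral_ge0.
  have d0 : 0 < eps / (G + 1) by rewrite divr_gt0 // ltr_wpDl.
  have [N hN] := fejer_approx cphi pphi d0.
  have igp := circle_integrableM ig cphi.
  have cm n : continuous (fourier_mode_part phi n).
    move=> x; apply: cvgD; apply: cvgM; try exact: cvg_cst.
      exact: cos_mode_continuous.
    exact: sin_mode_continuous.
  have fE := fejerE N _ (continuous_integrable cphi).
  have cfe : continuous (fejer phi N).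
    have -> : fejer phi N = fun x => N.+1%:R^-1 *
        \sum_(j < N.+1) \sum_(l < N.+1) fourier_mode_part phi (j%:Z - l%:Z) x by apply/funext.
    move=> x; apply: cvgM; first exact: cvg_cst.
    by move: x; apply: continuous_sum => j; apply: continuous_sum => l; exact: cm.
  have igm n := circle_integrableM ig (cm n).
  have igf := circle_integrableM ig cfe.
  have Igm n : circle_integral (fun x => g x * fourier_mode_part phi n x) = 0.
    have i1 := circle_integrableM ig (@cos_mode_continuous R n).
    have i2 := circle_integrableM ig (@sin_mode_continuous R n).
    have -> : circle_integral (fun x => g x * fourier_mode_part phi n x) = circle_integral
       (fun x => cos_coef phi n * (g x * cos_mode n x) + sin_coef phi n * (g x * sin_mode n x)).
      by apply: circle_integral_eq => x _; rewrite /fourier_mode_part; ring.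
    rewrite circle_integralD; try exact: circle_integrableZ.
    by rewrite !circle_integralZ // -/(cos_coef g n) -/(sin_coef g n) gc gs !mulr0 addr0.
  have If : circle_integral (fun x => g x * fejer phi N x) = 0.
    have -> : circle_integral (fun x => g x * fejer phi N x) = circle_integral
       (fun x => N.+1%:R^-1 * \sum_(j < N.+1) \sum_(l < N.+1) g x * fourier_mode_part phi (j%:Z - l%:Z) x).
      apply: circle_integral_eq => x _; rewrite fE mulrCA; congr (_ * _).
      by rewrite mulr_sumr; apply: eq_bigr => j _; rewrite mulr_sumr.
    rewrite circle_integralZ; last first.
      by apply: circle_integrable_sum => j; apply: circle_integrable_sum => l.
    by rewrite sum_double_integral // big1 ?mulr0 // => j _; rewrite big1.
  have -> : circle_integral (fun x => g x * phi x) =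
      circle_integral (fun x => g x * phi x) - circle_integral (fun x => g x * fejer phi N x).
    by rewrite If subr0.
  rewrite -circle_integralB //.
  apply: le_trans (circle_integral_norm (circle_integrableB igp igf)) _.
  apply: le_trans (_ : circle_integral (fun x => eps / (G + 1) * `|g x|) <= _).
    apply: circle_integral_le.
    - exact/circle_integrable_norm/circle_integrableB.
    - exact/circle_integrableZ/circle_integrable_norm.
    by move=> x _; rewrite -mulrBr normrM mulrC ler_wpM2r.
  rewrite circle_integralZ -/G; last exact: circle_integrable_norm.
  rewrite mulrAC ler_pdivrMr ?ltr_wpDl // ler_pM2l // lerDl ler01 //.
have mc := @monotone_class R g (fun=> 0) id id ig (continuous_integrable (fun x => cvg_cst _))
  (fun x => cvg_id) (fun x => cvg_id).
have {}mc A : measurable A -> circle_integral (fun x => g x * \1_A (frac x)) = 0.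
  move=> mA; rewrite mc //; last first.
    move=> phi cphi pphi; rewrite Iphi // -[LHS](@circle_integral_cst R 0).
    by apply: circle_integral_eq => x _; rewrite mul0r.
  rewrite -[RHS](@circle_integral_cst R 0).
  by apply: circle_integral_eq => x _; rewrite mul0r.
have mg : measurable_fun I01 g by apply/measurable_EFinP; exact: measurable_int ig.
pose gI := g \_ I01.
have mgI : measurable_fun setT gI by apply/(measurable_restrictT _ _).1.
(* [g] itself is only known to be measurable on a period, so that its
positivity set is read off from the restriction. *)
pose A := gI @^-1` `]0, +oo[%classic.
have mA : measurable A by rewrite /A -[X in measurable X]setTI; exact: mgI.
have mnA := measurableC mA.
have AE x : (frac x \in A) = (0 < g x).
  have /andP[f0 f1] := frac_bound x.
  have -> : g x = gI (frac x).
    rewrite /gI /patch mem_set; last by rewrite /= in_itv /= f0 ltW.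
    by rewrite /frac -rmorphN /= periodicZ.
  by apply/idP/idP => [|h]; [rewrite inE /A /= in_itv /= andbT|rewrite inE /A /= in_itv /= h].
have mfr := @measurable_frac R.
have ib B : measurable B -> circle_integrable (fun x => g x * \1_B (frac x)).
  move=> mB; apply: circle_integrable_bounded => //.
    exact: measurableT_comp (measurable_indic mB) mfr.
  by move=> x; rewrite indicE indic_sub.
have -> : circle_integral (fun x => `|g x|) =
   circle_integral (fun x => g x * \1_A (frac x) - g x * \1_(~` A) (frac x)).
  apply: circle_integral_eq => x _; rewrite !indicE in_setC AE.
  by case: ltP => gx /=; rewrite ?mulr1 ?mulr0 ?subr0 ?sub0r ?(gtr0_norm gx) ?(ler0_norm gx).
by rewrite circle_integralB ?mc ?subrr //; exact: ib.
Qed.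

Lemma circle_integral_abs0_ae g : circle_integrable g -> circle_integral (fun x => `|g x|) = 0 ->
  ae_eq mu I01 (EFin \o g) (cst 0%E).
Proof.
move=> ig I0; apply/(ae_eq_integral_abs mu (@measurable_I01 R) (measurable_int _ ig)).
by have e := EFin_circle_integral (circle_integrable_norm ig); rewrite I0 in e; exact: e.
Qed.

Section Invariance.
Variables (T T1 T2 : R -> R) (d : int) (s al C : R).
Hypothesis E : expanding_lift T T1 T2 d s al C.
Local Notation psi := (lift_inv T).
Local Notation L := (Lop `|d|%N s psi (inv1 T T1)).
Let IB := inv_branch E.

Lemma periodic_lift phi : periodic phi 1 -> periodic (fun x => phi (T x)) 1.
Proof. by move=> pphi x; rewrite (lift_shift E) periodicZ. Qed.

(** Since [T (psi (x + j)) = x + j] and [phi] is periodic, [phi] comes out of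
the sum defining [L (f * (phi \o T))]. *)
Lemma transfer_duality f phi : continuous f -> periodic f 1 -> continuous phi ->
  periodic phi 1 ->
  circle_integral (fun x => f x * phi (T x)) = circle_integral (fun x => L f x * phi x).
Proof.
move=> cf pf cphi pphi.
have cT := has_deriv_continuous (lift_deriv E).
have cpT : continuous (fun x => phi (T x)).
  by move=> x; apply: continuous_comp; [exact: cT|exact: cphi].
have e : L (fun x => f x * phi (T x)) = fun x => L f x * phi x.
  apply/funext => x; rewrite /Lop mulr_suml; apply: eq_bigr => j _.
  by rewrite (lift_invK E) mulrA (periodicZ pphi x j).
rewrite -e (Lop_integral IB) //.
  by move=> x; apply: cvgM; [exact: cf|exact: cpT].
by move=> x; rewrite pf (periodic_lift pphi).
Qed.

Lemma periodic_indic A : (forall x, A (x + 1) <-> A x) -> forall x, \1_A x = \1_A (frac x) :> R.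
Proof.
move=> pA x; have p1 : periodic (\1_A : R -> R) 1.
  move=> y; rewrite !indicE; congr ((nat_of_bool _)%:R).
  by apply/idP/idP; rewrite !inE => /pA.
by rewrite /frac -rmorphN /= (periodicZ p1).
Qed.

Lemma transfer_duality_set f A : continuous f -> periodic f 1 -> measurable A ->
  (forall x, A (x + 1) <-> A x) ->
  (\int[mu]_(x in I01 `&` T @^-1` A) (f x)%:E)%E = (circle_integral (fun x => L f x * \1_A x))%:E.
Proof.
move=> cf pf mA pA; have cT := has_deriv_continuous (lift_deriv E).
have cL := Lop_continuous IB cf.
have mT := continuous_measurable_fun cT.
rewrite integral_restrict; last first.
  apply: circle_integrable_bounded; first exact: continuous_integrable.
    apply: measurable_indic; rewrite -[X in measurable X]setTI; exact: mT.
  by move=> x; rewrite indicE indic_sub.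
congr (_%:E).
have -> : circle_integral (fun x => f x * \1_(T @^-1` A) x) =
    circle_integral (fun x => f x * \1_A (frac (T x))).
  by apply: circle_integral_eq => x _; rewrite -periodic_indic.
have -> : circle_integral (fun x => L f x * \1_A x) =
    circle_integral (fun x => L f x * \1_A (frac (id x))).
  by apply: circle_integral_eq => x _; rewrite -periodic_indic.
apply: monotone_class => //.
- exact: continuous_integrable.
- exact: continuous_integrable.
- by move=> x; exact: cvg_id.
- by move=> phi cphi pphi; exact: transfer_duality.
Qed.

(** By duality invariance says that [L f - f] has zero integral on each
periodic measurable set. Taking its positivity set and that of its opposite, a
continuous such function vanishes. *)
Lemma invariant_densityP f : continuous f -> periodic f 1 ->
  invariant_density T f <->
  [/\ forall x, 0 <= f x, circle_integral f = 1 & forall x, L f x = f x].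
Proof.
move=> cf pf; have cI := continuous_integrable cf.
have cL := Lop_continuous IB cf; have pL := Lop_periodic IB pf.
split=> [[f0 If inv]|[f0 If Lf]]; split => //.
- by apply: EFin_inj; rewrite -EFin_circle_integral.
- pose h x := L f x - f x.
  have ch : continuous h by move=> x; apply: cvgB; [exact: cL|exact: cf].
  have ph : periodic h 1 by move=> x; rewrite /h pL pf.
  have Ih A : measurable A -> (forall x, A (x + 1) <-> A x) ->
      circle_integral (fun x => h x * \1_A x) = 0.
    move=> mA pA.
    have iA g : continuous g -> circle_integrable (fun x => g x * \1_A x).
      move=> cg; apply: circle_integrable_bounded; first exact: continuous_integrable.
        exact: measurable_indic.
      by move=> x; rewrite indicE indic_sub.
    have -> : circle_integral (fun x => h x * \1_A x) =
      circle_integral (fun x => L f x * \1_A x - f x * \1_A x).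
      by apply: circle_integral_eq => x _; rewrite /h mulrBl.
    rewrite circle_integralB; try exact: iA.
    have := inv A mA pA; rewrite transfer_duality_set // integral_restrict; last exact: iA.
    by move=> [->]; rewrite subrr.
  have pos g : continuous g -> periodic g 1 ->
      (forall A, measurable A -> (forall x, A (x + 1) <-> A x) ->
      circle_integral (fun x => g x * \1_A x) = 0) -> forall x, g x <= 0.
    move=> cg pg Ig x; rewrite leNgt; apply/negP => gx.
    pose A := [set y | 0 < g y].
    have mg := continuous_measurable_fun cg.
    have mA : measurable A.
      have -> : A = setT `&` g @^-1` `]0, +oo[%classic.
        by apply/seteqP; split => y; rewrite /A /= in_itv /= andbT // => -[].
      exact: mg.
    have pA y : A (y + 1) <-> A y by rewrite /A /= pg.
    pose gp y := (`|g y| + g y) / 2.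
    have cgp : continuous gp.
      move=> y; apply: cvgM; last exact: cvg_cst.
      by apply: cvgD; [apply: cvg_norm; exact: cg|exact: cg].
    have gpE y : gp y = g y * \1_A y.
      rewrite indicE /gp; case: (ltP 0 (g y)) => gy.
        by rewrite mem_set // gtr0_norm // mulr1; field.
      rewrite memNset ?mulr0; first by rewrite ler0_norm // addNr mul0r.
      by rewrite /A /= ltNge gy.
    have gp0 y : 0 <= gp y.
      rewrite gpE indicE; have [yA|yA] := boolP (y \in A); last by rewrite mulr0.
      by rewrite mulr1 ltW //; rewrite inE in yA.
    have := @continuous_integral_eq0 gp cgp _ gp0 _ x.
    rewrite {3}/gp gtr0_norm // => H.
    have : (g x + g x) / 2 = 0.
      apply: H; first by move=> y; rewrite /gp pg.
      by apply: etrans _ (Ig A mA pA); apply: circle_integral_eq => y _; rewrite gpE.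
    by lra.
  move=> x; apply/eqP; rewrite -subr_eq0 -/(h x) eq_le; apply/andP; split.
    exact: pos.
  rewrite -oppr_le0; apply: (pos (fun x => - h x)).
  + by move=> y; apply: cvgN; exact: ch.
  + by move=> y; rewrite ph.
  + move=> A mA pA; have hA := Ih A mA pA.
    have -> : circle_integral (fun x0 => - h x0 * \1_A x0) =
       circle_integral (fun x0 => -1 * (h x0 * \1_A x0)).
      by apply: circle_integral_eq => y _; ring.
    rewrite circle_integralZ ?hA ?mulr0 //.
    apply: circle_integrable_bounded; first exact: continuous_integrable.
      exact: measurable_indic.
    by move=> y; rewrite indicE indic_sub.
- by rewrite EFin_circle_integral // If.
- move=> A mA pA; rewrite transfer_duality_set // integral_restrict; last first.
    apply: circle_integrable_bounded; first exact: cI.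
      exact: measurable_indic.
    by move=> y; rewrite indicE indic_sub.
  by congr (_%:E); apply: circle_integral_eq => x _; rewrite Lf.
Qed.

End Invariance.
End InvariantDensities.


(** * Lebesgue spaces and weak derivatives *)

Section Sobolev.
Variable R : realType.
Implicit Types (f g h phi : R -> R) (x y t : R).
Local Notation mu := (@lebesgue_measure R).
Local Notation I01 := (`[0%R, 1%R]%classic : set R).

Lemma circle_integrable_restrict f : circle_integrable f <->
  measurable_fun setT (f \_ I01) /\ (\int[mu]_x (`|(f \_ I01) x|)%:E < +oo)%E.
Proof.
have e : (EFin \o f) \_ I01 = EFin \o (f \_ I01) := restrict_EFin _ _.
split.
  move/(integrable_mkcond _ (@measurable_I01 R)); rewrite e => /integrableP[mf nf].
  by split=> //; apply/measurable_EFinP.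
move=> [mf nf]; apply/(integrable_mkcond _ (@measurable_I01 R)); rewrite e.
by apply/integrableP; split => //; apply/measurable_EFinP.
Qed.

(** The restriction to a period is extended by zero to the line, where the
norm is taken. *)
Lemma Lp1P f : Lp 1%:E f <-> periodic f 1 /\ circle_integrable f.
Proof.
split=> -[pf hf]; split => //.
- have /andP[mf /[!inE] nf] := hf; rewrite inE in mf.
  by apply/circle_integrable_restrict; move: nf; rewrite /= /finite_norm Lnorm1.
- move/circle_integrable_restrict: hf => [mf nf].
  apply/andP; split; rewrite inE; first exact: mf.
  by rewrite /= /finite_norm Lnorm1.
Qed.

Lemma Lnorm2_lty (u : R -> R) : finite_norm mu 2%:E u <->
  (\int[mu]_x (`|u x| ^+ 2)%:E < +oo)%E.
Proof.
have e : (\int[mu]_x `|(u x)%:E| `^ 2 = \int[mu]_x (`|u x| ^+ 2)%:E)%E.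
  by apply: eq_integral => x _; rewrite abse_EFin poweR_EFin powR_mulrn.
rewrite /finite_norm unlock /= e; split; last exact: poweR_lty.
by apply: lty_poweRy; rewrite invr_neq0.
Qed.

Lemma restrict_sqr f x : `|(f \_ I01) x| ^+ 2 = `|((fun x => f x ^+ 2) \_ I01) x|.
Proof.
rewrite /patch; case: ifP => _; first by rewrite normrX.
by rewrite !normr0 expr0n.
Qed.

Lemma Lp2P f : Lp 2%:E f <-> [/\ periodic f 1, circle_integrable f &
  circle_integrable (fun x => f x ^+ 2)].
Proof.
split=> [[pf hf]|[pf hf hf2]].
- have /andP[mf /[!inE] nf] := hf; rewrite inE in mf; move/Lnorm2_lty in nf.
  have mfI : measurable_fun I01 f by apply/(measurable_restrictT _ (@measurable_I01 R)).
  have sq : circle_integrable (fun x => f x ^+ 2).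
    apply/circle_integrable_restrict; split.
      by apply/(measurable_restrictT _ (@measurable_I01 R)); exact: measurable_funX.
    by under eq_integral do rewrite -restrict_sqr.
  split => //.
  apply: (@le_integrable _ _ _ mu I01 (@measurable_I01 R) _ (EFin \o (fun x => 1 + f x ^+ 2))).
  + exact/measurable_EFinP.
  + move=> x _ /=; rewrite lee_fin (ger0_norm (_ : 0 <= 1 + f x ^+ 2)).
      rewrite -(real_normK (num_real (f x))); have := normr_ge0 (f x).
      by move: `|f x| => u u0; nra.
    by rewrite addr_ge0 // sqr_ge0.
  + by apply: circle_integrableD => //; apply: continuous_integrable => x; exact: cvg_cst.
- move/circle_integrable_restrict: hf => [mf _].
  move/circle_integrable_restrict: hf2 => [_ nf].
  split => //; apply/andP; split; rewrite inE; first exact: mf.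
  by apply/Lnorm2_lty; under eq_integral do rewrite restrict_sqr.
Qed.

Lemma continuous_Lp1 f : continuous f -> periodic f 1 -> Lp 1%:E f.
Proof. by move=> cf pf; apply/Lp1P; split=> //; exact: continuous_integrable. Qed.

Lemma continuous_Lp2 f : continuous f -> periodic f 1 -> Lp 2%:E f.
Proof.
move=> cf pf; apply/Lp2P; split => //; apply: continuous_integrable => //.
by move=> x; apply: cvgM; exact: cf.
Qed.

Lemma Lpoo_bound c : Lp +oo%E c -> measurable_fun I01 c /\
  exists2 M : R, 0 <= M & {ae mu, forall x, I01 x -> `|c x| <= M}.
Proof.
move=> [pc /andP[mc /[!inE] nc]]; rewrite inE in mc.
split; first by apply/(measurable_restrictT _ (@measurable_I01 R)).
move: nc; rewrite /= /finite_norm unlock /Lnorm.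
case: ifPn => [m0|/negP m0]; last first.
  exfalso; apply: m0; apply: (@lt_le_trans _ _ (mu I01)).
    by rewrite lebesgue_I01 lte01.
  by apply: le_measure; rewrite ?inE.
move=> nc; set S := ess_sup _ _ in nc.
have S0 : (0 <= S)%E by apply: ess_sup_gee => //; apply/nearW => x /=.
have Sf : S \is a fin_num by rewrite ge0_fin_numE.
exists (fine S); first exact: fine_ge0.
have := @ess_sup_ge _ _ _ mu (abse \o (EFin \o (c \_ I01))).
apply: filterS => x; rewrite -/S => h xI.
rewrite -lee_fin fineK //; apply: le_trans h.
by rewrite /= /patch mem_set.
Qed.

(** Observables are bounded almost everywhere only. *)
Lemma circle_integrable_ess c g : Lp +oo%E c -> circle_integrable g ->
  circle_integrable (fun x => c x * g x).
Proof.
move=> /Lpoo_bound[mc [M M0 cM]] ig.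
have mg : measurable_fun I01 g by apply/measurable_EFinP; exact: measurable_int ig.
have iMg := circle_integrableZ M (circle_integrable_norm ig).
apply/integrableP; split; first by apply/measurable_EFinP; exact: measurable_funM.
have /integrableP[_] := iMg; apply: le_lt_trans.
apply: ae_ge0_le_integral => //.
- apply: measurableT_comp => //; apply/measurable_EFinP; exact: measurable_funM.
- apply: measurableT_comp => //; apply/measurable_EFinP; apply: measurable_funM => //.
  exact: measurableT_comp.
apply: (@filterS _ _ (ae_filter_ringOfSetsType mu) _ _ _ cM) => x h xI /=; rewrite lee_fin normrM [leRHS]ger0_norm ?mulr_ge0 //.
by apply: ler_wpM2r => //; exact: h.
Qed.

Lemma ess_integral_bound c : Lp +oo%E c -> exists2 M : R, 0 <= M &
  forall g, circle_integrable g ->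
    `|circle_integral (fun x => c x * g x)| <= M * circle_integral (fun x => `|g x|).
Proof.
move=> hc; have [mc [M M0 cM]] := Lpoo_bound hc.
exists M => // g ig; have icg := circle_integrable_ess hc ig.
apply: le_trans (circle_integral_norm icg) _.
rewrite -circle_integralZ; last exact: circle_integrable_norm.
have iMg := circle_integrableZ M (circle_integrable_norm ig).
rewrite -lee_fin -!EFin_circle_integral //; last exact: circle_integrable_norm.
apply: ae_ge0_le_integral => //.
- exact: measurable_int (circle_integrable_norm icg).
- by move=> x _; rewrite lee_fin mulr_ge0.
- exact: measurable_int iMg.
apply: (@filterS _ _ (ae_filter_ringOfSetsType mu) _ _ _ cM) => x h xI /=; rewrite lee_fin normrM.
by apply: ler_wpM2r => //; exact: h.
Qed.

Lemma class_C_deriv k f j : class_C k f -> (j < k)%N ->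
  has_deriv (derive1n j f) (derive1n j.+1 f).
Proof.
move=> [df _] jk x; rewrite derive1nS derive1E.
exact/derivableP/df.
Qed.

Lemma tower_derive1n (F : nat -> R -> R) k : (forall j, (j < k)%N -> has_deriv (F j) (F j.+1)) ->
  forall j, (j <= k)%N -> derive1n j (F 0%N) = F j.
Proof.
move=> hF; elim=> [//|j IHj] jk; rewrite derive1nS IHj ?(ltnW jk) //.
exact/has_deriv_derive1/hF.
Qed.

Lemma tower_class_C (F : nat -> R -> R) k : (forall j, (j < k)%N -> has_deriv (F j) (F j.+1)) ->
  continuous (F k) -> class_C k (F 0%N).
Proof.
move=> hF cF; have dF := tower_derive1n hF; split; last by rewrite dF.
move=> j x jk; rewrite dF ?(ltnW jk) //; have := hF j jk x; by case.
Qed.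

Lemma class_C_continuous k f : class_C k f -> forall j, (j <= k)%N -> continuous (derive1n j f).
Proof.
move=> cf j; rewrite leq_eqVlt => /orP[/eqP ->|jk]; first by case: cf.
exact: has_deriv_continuous (class_C_deriv cf jk).
Qed.

Lemma class_C_periodic k f : class_C k f -> periodic f 1 ->
  forall j, (j <= k)%N -> periodic (derive1n j f) 1.
Proof.
move=> cf pf; elim=> [//|j IHj] jk.
exact: has_deriv_periodic (class_C_deriv cf jk) (IHj (ltnW jk)).
Qed.

(** Integration by parts, once for each order. *)
Lemma class_C_weak_derivative k f j : class_C k f -> periodic f 1 -> (j <= k)%N ->
  weak_derivative j f (derive1n j f).
Proof.
move=> cf pf; elim: j => [|j IHj] jk phi pphi cphi.
  by rewrite expr0 mul1r.
have c1 : forall m, class_C m (derive1 phi).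
  move=> m; have := tower_class_C (F := fun j => derive1n j.+1 phi) (k := m).
  by apply => [i im|]; [exact: class_C_deriv (cphi m.+1) _|case: (cphi m.+1)].
have h1 : has_deriv phi (derive1 phi) by exact: (@class_C_deriv 1 phi 0 (cphi 1%N) isT).
have p1 := has_deriv_periodic h1 pphi.
have -> : derive1n j.+1 phi = derive1n j (derive1 phi) by rewrite /derive1n iterSr.
rewrite IHj ?(ltnW jk) // exprS mulN1r mulNr -mulrN; congr (_ * _).
apply: circle_by_parts.
- exact: class_C_deriv cf jk.
- exact: h1.
- exact: class_C_continuous cf _ jk.
- by case: (c1 0%N).
- exact: class_C_periodic cf pf _ (ltnW jk).
- exact: pphi.
Qed.

Lemma class_C_sobolev k f p : class_C k f -> periodic f 1 ->
  (forall g, continuous g -> periodic g 1 -> Lp p g) -> sobolev k p f.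
Proof.
move=> cf pf hp; split => //; first exact: (class_C_continuous cf (leq0n k)).
move=> j jk; exists (derive1n j f); last exact: class_C_weak_derivative cf pf jk.
by apply: hp; [exact: class_C_continuous cf _ jk|exact: class_C_periodic cf pf _ jk].
Qed.

(** Coefficients of the [j]-th derivative of
[p.1 * cos_mode n + p.2 * sin_mode n]: a rotation by a quarter turn and a
dilation by the frequency, iterated. *)
Definition rot (n : int) j (p : R * R) : R * R :=
  iter j (fun q => (freq R n * q.2, - freq R n * q.1)) p.

Lemma trig_tower n (p : R * R) j : has_deriv
  (fun x => (rot n j p).1 * cos_mode n x + (rot n j p).2 * sin_mode n x)
  (fun x => (rot n j.+1 p).1 * cos_mode n x + (rot n j.+1 p).2 * sin_mode n x).
Proof.
apply: has_deriv_ext (has_derivD (has_derivZ (rot n j p).1 (@cos_mode_deriv R n))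
  (has_derivZ (rot n j p).2 (@sin_mode_deriv R n))) _ _ => // x /=.
by ring.
Qed.

Lemma trig_class_C n (p : R * R) m :
  class_C m (fun x => p.1 * cos_mode n x + p.2 * sin_mode n x) /\
  forall j, derive1n j (fun x => p.1 * cos_mode n x + p.2 * sin_mode n x) =
    fun x => (rot n j p).1 * cos_mode n x + (rot n j p).2 * sin_mode n x.
Proof.
pose F j x := (rot n j p).1 * cos_mode n x + (rot n j p).2 * sin_mode n x.
have hF j : has_deriv (F j) (F j.+1) by exact: trig_tower.
split; last by move=> j; exact: (tower_derive1n (F := F) (k := j) (fun i _ => hF i) (leqnn j)).
apply: (tower_class_C (F := F)); first by move=> j _; exact: hF.
exact: has_deriv_continuous (hF m).
Qed.

Lemma mode_class_C n m : class_C m (@cos_mode R n) /\ class_C m (@sin_mode R n).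
Proof.
split.
- have [h _] := trig_class_C n (1 : R, 0 : R) m.
  have -> : @cos_mode R n = fun x => 1 * cos_mode n x + 0 * sin_mode n x.
    by apply/funext => x; rewrite mul1r mul0r addr0.
  exact: h.
- have [h _] := trig_class_C n (0 : R, 1 : R) m.
  have -> : @sin_mode R n = fun x => 0 * cos_mode n x + 1 * sin_mode n x.
    by apply/funext => x; rewrite mul1r mul0r add0r.
  exact: h.
Qed.

Lemma rot_quarter n j : rot n j (0, 1) = (- (rot n j (1, 0)).2, (rot n j (1, 0)).1).
Proof.
elim: j => [|j IHj] /=; first by rewrite oppr0.
by rewrite -/(rot n j (0, 1)) -/(rot n j (1, 0)) IHj /=; congr (_, _); ring.
Qed.

Lemma rot_norm n j : (rot n j (1, 0)).1 ^+ 2 + (rot n j (1, 0)).2 ^+ 2 = freq R n ^+ 2 ^+ j.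
Proof.
elim: j => [|j IHj] /=; first by rewrite expr1n expr0n addr0 expr0.
rewrite -/(rot n j (1, 0)) (exprS (freq R n ^+ 2) j) -IHj; ring.
Qed.

Lemma weak_derivative_trig k f g n (p : R * R) : weak_derivative k f g ->
  circle_integrable f -> circle_integrable g ->
  (rot n k p).1 * cos_coef f n + (rot n k p).2 * sin_coef f n = (-1) ^+ k * (p.1 * cos_coef g n + p.2 * sin_coef g n).
Proof.
move=> wg iF iG; have [_ dE] := trig_class_C n p k.
have lin h (a b : R) : circle_integrable h ->
  circle_integral (fun x => h x * (a * cos_mode n x + b * sin_mode n x)) = a * cos_coef h n + b * sin_coef h n.
  move=> ih; have i1 := circle_integrableM ih (@cos_mode_continuous R n).
  have i2 := circle_integrableM ih (@sin_mode_continuous R n).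
  rewrite -(circle_integralZ a i1) -(circle_integralZ b i2) -circle_integralD;
    try exact: circle_integrableZ.
  by apply: circle_integral_eq => x _; ring.
rewrite -!lin // -wg; first by rewrite dE.
  by move=> x; rewrite cos_mode_periodic sin_mode_periodic.
by move=> m; exact: (trig_class_C n p m).1.
Qed.

(** Testing against the two trigonometric functions of frequency [n], whose
derivatives of order [k] are obtained by [rot], which scales the Euclidean
norm by the frequency. *)
Lemma weak_derivative_fourier k f g n : weak_derivative k f g ->
  circle_integrable f -> circle_integrable g ->
  cos_coef g n ^+ 2 + sin_coef g n ^+ 2 = freq R n ^+ 2 ^+ k * (cos_coef f n ^+ 2 + sin_coef f n ^+ 2).
Proof.
move=> wg iF iG.
have h1 := weak_derivative_trig n (1, 0) wg iF iG.
have h2 := weak_derivative_trig n (0, 1) wg iF iG.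
rewrite rot_quarter /= in h2; rewrite /= in h1.
rewrite mul1r mul0r addr0 in h1; rewrite mul0r mul1r add0r in h2.
have sq : (-1) ^+ k * (-1) ^+ k = 1 :> R by rewrite -expr2 sqrr_sign.
rewrite -rot_norm.
have -> : cos_coef g n ^+ 2 = ((-1) ^+ k * cos_coef g n) ^+ 2 by rewrite exprMn sqrr_sign mul1r.
have -> : sin_coef g n ^+ 2 = ((-1) ^+ k * sin_coef g n) ^+ 2 by rewrite exprMn sqrr_sign mul1r.
by rewrite -h1 -h2; ring.
Qed.

(** The Fourier coefficients of two weak derivatives coincide, and
[fourier_zero] applies to the difference. *)
Lemma weak_derivative_unique k f g g' : weak_derivative k f g -> weak_derivative k f g' ->
  Lp 1%:E g -> Lp 1%:E g' -> circle_integrable f -> ae_eq mu I01 (EFin \o g) (EFin \o g').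
Proof.
move=> wg wg' /Lp1P[pg ig] /Lp1P[pg' ig'] iF.
pose h x := g x - g' x.
have ih : circle_integrable h by exact: circle_integrableB.
have ph : periodic h 1 by move=> x; rewrite /h pg pg'.
have sgn : (-1) ^+ k != 0 :> R by rewrite signr_eq0.
have z n (p : R * R) : p.1 * cos_coef h n + p.2 * sin_coef h n = 0.
  have e : cos_coef h n = cos_coef g n - cos_coef g' n.
    rewrite /cos_coef -circle_integralB; try by apply: circle_integrableM => //; exact: cos_mode_continuous.
    by apply: circle_integral_eq => x _; rewrite /h mulrBl.
  have e' : sin_coef h n = sin_coef g n - sin_coef g' n.
    rewrite /sin_coef -circle_integralB; try by apply: circle_integrableM => //; exact: sin_mode_continuous.
    by apply: circle_integral_eq => x _; rewrite /h mulrBl.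
  apply: (mulfI sgn); rewrite mulr0 e e'.
  have := weak_derivative_trig n p wg iF ig; rewrite (weak_derivative_trig n p wg' iF ig') => E.
  have -> : p.1 * (cos_coef g n - cos_coef g' n) + p.2 * (sin_coef g n - sin_coef g' n) =
    (p.1 * cos_coef g n + p.2 * sin_coef g n) - (p.1 * cos_coef g' n + p.2 * sin_coef g' n) by ring.
  by rewrite mulrBr E subrr.
have := circle_integral_abs0_ae ih (fourier_zero ih ph _ _).
case.
- by move=> n; have := z n (1, 0); rewrite /= mul1r mul0r addr0.
- by move=> n; have := z n (0, 1); rewrite /= mul1r mul0r add0r.
move=> N [mN N0 sub]; exists N; split => // x /= nx; apply: sub => /= hx; apply: nx => xI.
by have /eqP := hx xI; rewrite eqe subr_eq0 => /eqP ->.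
Qed.

Lemma wderivP k f g : Lp 1%:E g -> weak_derivative k f g -> circle_integrable f ->
  [/\ Lp 1%:E (wderiv k f), weak_derivative k f (wderiv k f) &
   ae_eq mu I01 (EFin \o wderiv k f) (EFin \o g)].
Proof.
move=> lg wg iF; rewrite /wderiv; case: xgetP => [h -> [lh wh]|/(_ g)]; last by case.
by split => //; exact: weak_derivative_unique wh wg lh lg iF.
Qed.

Lemma ae_eq_circle_integral g g' : measurable_fun I01 g -> measurable_fun I01 g' ->
  ae_eq mu I01 (EFin \o g) (EFin \o g') -> circle_integral g = circle_integral g'.
Proof.
move=> mg mg' h; rewrite /Rintegral; congr fine.
by apply: ae_eq_integral => //; exact/measurable_EFinP.
Qed.

(** The choice made among the weak derivatives does not affect the norm. *)
Lemma wderiv_energy k f g : Lp 2%:E g -> weak_derivative k f g -> circle_integrable f ->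
  circle_integral (fun x => `|wderiv k f x| ^+ 2) = circle_integral (fun x => g x ^+ 2).
Proof.
move=> /Lp2P[pg ig ig2] wg iF; have lg : Lp 1%:E g by apply/Lp1P.
have [/Lp1P[_ iw] _ ae] := wderivP lg wg iF.
have mw : measurable_fun I01 (wderiv k f) by apply/measurable_EFinP; exact: measurable_int iw.
have mg : measurable_fun I01 g by apply/measurable_EFinP; exact: measurable_int ig.
apply: ae_eq_circle_integral.
- by apply: measurable_funX; exact: measurableT_comp.
- exact: measurable_funX.
case: ae => N [mN N0 sub]; exists N; split => // x /= nx; apply: sub => /= hx; apply: nx => xI.
by have := hx xI => -[->]; rewrite real_normK ?num_real.
Qed.

End Sobolev.


(** * Fourier series of functions in H^4 *)

Section FourierSeries.
Variable R : realType.
Implicit Types (f g h phi : R -> R) (x y t : R) (A B : nat -> R) (n : nat).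

(** Multiplicity of the frequency [n] among the integers of absolute value
[n], so that symmetric sums over the integers become sums over the
naturals. *)
Definition mult n : R := if n == 0%N then 1 else 2.

Lemma mult_gt0 n : 0 < mult n.
Proof. by rewrite /mult; case: eqP. Qed.

Lemma mult_le2 n : mult n <= 2.
Proof. by rewrite /mult; case: eqP => _; lra. Qed.

(** The [j]-th derivative of the [n]-th term of a real Fourier series with
coefficients [A] and [B]. *)
Definition trig_term A B j n x : R :=
  mult n * ((rot n%:Z j (A n, B n)).1 * cos_mode n%:Z x + (rot n%:Z j (A n, B n)).2 * sin_mode n%:Z x).

Definition trig_poly A B N x : R := \sum_(n < N) trig_term A B 0 n x.

Lemma trig_term_deriv A B j n : has_deriv (trig_term A B j n) (trig_term A B j.+1 n).
Proof. exact/has_derivZ/trig_tower. Qed.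

Lemma trig_term_continuous A B j n : continuous (trig_term A B j n).
Proof. exact: has_deriv_continuous (trig_term_deriv A B j n). Qed.

Lemma trig_term_periodic A B j n : periodic (trig_term A B j n) 1.
Proof. by move=> x; rewrite /trig_term cos_mode_periodic sin_mode_periodic. Qed.

Lemma freq_ge0 n : 0 <= freq R n%:Z.
Proof. by rewrite /freq mulr_ge0 ?ler0z // mulr_ge0 // pi_ge0. Qed.

Lemma rot_l1 n j (p : R * R) : `|(rot n%:Z j p).1| + `|(rot n%:Z j p).2| =
  freq R n%:Z ^+ j * (`|p.1| + `|p.2|).
Proof.
elim: j => [|j IHj] /=; first by rewrite mul1r.
rewrite -/(rot n%:Z j p) exprS -mulrA -IHj; have := freq_ge0 n.
move: (freq R n%:Z) => F F0; rewrite !normrM normrN (ger0_norm F0).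
by rewrite -mulrDr [X in _ * X]addrC.
Qed.

Lemma trig_term_bound A B j n x :
  `|trig_term A B j n x| <= 2 * (freq R n%:Z ^+ j * (`|A n| + `|B n|)).
Proof.
rewrite /trig_term normrM (gtr0_norm (mult_gt0 n)).
apply: ler_pM; [exact: ltW (mult_gt0 n)|by []|exact: mult_le2|].
rewrite -(rot_l1 n j (A n, B n)); apply: le_trans (ler_normD _ _) _.
by rewrite !normrM; apply: lerD; rewrite -[leRHS]mulr1 ler_wpM2l // ?cos_mode_le1 ?sin_mode_le1.
Qed.

Lemma trig_orthogonality (k n : nat) :
  [/\ mult n * circle_integral (fun x => cos_mode n%:Z x * cos_mode k%:Z x : R) = (n == k)%:R,
   mult n * circle_integral (fun x => sin_mode n%:Z x * sin_mode k%:Z x : R) = ((n == k) && (k != 0%N))%:R,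
   circle_integral (fun x => cos_mode n%:Z x * sin_mode k%:Z x : R) = 0 &
   circle_integral (fun x => sin_mode n%:Z x * cos_mode k%:Z x : R) = 0].
Proof.
have ic (z : int) := continuous_integrable (@cos_mode_continuous R z).
have is_ (z : int) := continuous_integrable (@sin_mode_continuous R z).
have e0 : (n%:Z + k%:Z == 0) = (n == 0%N) && (k == 0%N) by lia.
have e1 : (n%:Z - k%:Z == 0) = (n == k) by lia.
have M : mult n = if n == 0%N then 1 else 2 by [].
have z1 : circle_integral (fun x => cos_mode n%:Z x * sin_mode k%:Z x : R) = 0.
  have -> : circle_integral (fun x => cos_mode n%:Z x * sin_mode k%:Z x : R) =
     circle_integral (fun x => 2^-1 * (sin_mode (k%:Z + n%:Z) x + sin_mode (k%:Z - n%:Z) x)).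
    by apply: circle_integral_eq => x _; rewrite cos_sin_modeM.
  rewrite circle_integralZ ?circle_integralD ?sin_mode_integral ?addr0 ?mulr0 //.
  exact: circle_integrableD.
have z2 : circle_integral (fun x => sin_mode n%:Z x * cos_mode k%:Z x : R) = 0.
  have -> : circle_integral (fun x => sin_mode n%:Z x * cos_mode k%:Z x : R) =
     circle_integral (fun x => 2^-1 * (sin_mode (n%:Z + k%:Z) x + sin_mode (n%:Z - k%:Z) x)).
    by apply: circle_integral_eq => x _; rewrite mulrC cos_sin_modeM.
  rewrite circle_integralZ ?circle_integralD ?sin_mode_integral ?addr0 ?mulr0 //.
  exact: circle_integrableD.
split => //.
- have -> : circle_integral (fun x => cos_mode n%:Z x * cos_mode k%:Z x : R) =
     circle_integral (fun x => 2^-1 * (cos_mode (n%:Z - k%:Z) x + cos_mode (n%:Z + k%:Z) x)).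
    by apply: circle_integral_eq => x _; rewrite cos_modeM.
  rewrite circle_integralZ ?circle_integralD ?cos_mode_integral //; last exact: circle_integrableD.
  rewrite e0 e1 M; case: (eqVneq n k) => [<-|nk]; case: (eqVneq n 0%N) => n0 /=; try lra.
  have -> : (k == 0%N) = false by move: nk; rewrite n0 eq_sym => /negbTE.
  by rewrite /=; lra.
- have -> : circle_integral (fun x => sin_mode n%:Z x * sin_mode k%:Z x : R) =
     circle_integral (fun x => 2^-1 * (cos_mode (n%:Z - k%:Z) x - cos_mode (n%:Z + k%:Z) x)).
    by apply: circle_integral_eq => x _; rewrite sin_modeM.
  rewrite circle_integralZ ?circle_integralB ?cos_mode_integral //; last exact: circle_integrableB.
  rewrite e0 e1 M; case: (eqVneq n k) => [<-|nk]; case: (eqVneq n 0%N) => n0 /=; try lra.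
  have -> : (k == 0%N) = false by move: nk; rewrite n0 eq_sym => /negbTE.
  by rewrite /=; lra.
Qed.

Lemma trig_poly_continuous A B N : continuous (trig_poly A B N).
Proof. by apply: continuous_sum => n; exact: trig_term_continuous. Qed.

Lemma trig_poly_integral A B N f : circle_integrable f ->
  circle_integral (fun x => f x * trig_poly A B N x) =
  \sum_(n < N) mult n * (A n * cos_coef f n%:Z + B n * sin_coef f n%:Z).
Proof.
move=> hf.
have i1 (n : nat) := circle_integrableM hf (@cos_mode_continuous R n%:Z).
have i2 (n : nat) := circle_integrableM hf (@sin_mode_continuous R n%:Z).
have it (n : 'I_N) : circle_integrable (fun x => f x * trig_term A B 0 n x).
  by apply: circle_integrableM => //; exact: trig_term_continuous.
have -> : circle_integral (fun x => f x * trig_poly A B N x) =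
   circle_integral (fun x => \sum_(n < N) f x * trig_term A B 0 n x).
  by apply: circle_integral_eq => x _; rewrite mulr_sumr.
rewrite circle_integral_sum //; apply: eq_bigr => n _.
have -> : circle_integral (fun x => f x * trig_term A B 0 n x) = circle_integral
   (fun x => mult n * (A n * (f x * cos_mode n%:Z x) + B n * (f x * sin_mode n%:Z x))).
  by apply: circle_integral_eq => x _; rewrite /trig_term /=; ring.
rewrite circle_integralZ; last by apply: circle_integrableD; exact: circle_integrableZ.
by rewrite circle_integralD ?circle_integralZ //; exact: circle_integrableZ.
Qed.

Lemma sum_delta N k (c : nat -> R) : \sum_(n < N) ((n : nat) == k)%:R * c n = (k < N)%N%:R * c k.
Proof.
case: (ltnP k N) => kN.
  rewrite (bigD1 (Ordinal kN)) //= eqxx !mul1r big1 ?addr0 // => i.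
  by rewrite -val_eqE /= => /negPf ->; rewrite mul0r.
rewrite mul0r big1 // => i _; rewrite ltn_eqF ?mul0r //.
exact: leq_trans (ltn_ord i) kN.
Qed.

Lemma trig_poly_coef A B N k : B 0%N = 0 ->
  cos_coef (trig_poly A B N) k%:Z = (k < N)%N%:R * A k /\
  sin_coef (trig_poly A B N) k%:Z = (k < N)%N%:R * B k.
Proof.
move=> B0; split.
  have -> : cos_coef (trig_poly A B N) k%:Z = circle_integral (fun x => cos_mode k%:Z x * trig_poly A B N x).
    by apply: circle_integral_eq => x _; rewrite mulrC.
  rewrite trig_poly_integral; last exact: continuous_integrable (@cos_mode_continuous _ _).
  rewrite -sum_delta; apply: eq_bigr => n _.
  have [e1 _ _ e4] := trig_orthogonality k n.
  rewrite /cos_coef /sin_coef -e1 mulrDr mulrCA.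
  have -> : circle_integral (fun t => cos_mode k%:Z t * cos_mode n%:Z t : R) =
     circle_integral (fun x => cos_mode n%:Z x * cos_mode k%:Z x) by apply: circle_integral_eq => x _; rewrite mulrC.
  have -> : circle_integral (fun t => cos_mode k%:Z t * sin_mode n%:Z t : R) = 0.
    by rewrite -[RHS]e4; apply: circle_integral_eq => x _; rewrite mulrC.
  by rewrite !mulr0 addr0; ring.
have -> : sin_coef (trig_poly A B N) k%:Z = circle_integral (fun x => sin_mode k%:Z x * trig_poly A B N x).
  by apply: circle_integral_eq => x _; rewrite mulrC.
rewrite trig_poly_integral; last exact: continuous_integrable (@sin_mode_continuous _ _).
rewrite -sum_delta; apply: eq_bigr => n _.
have [_ e2 e3 _] := trig_orthogonality k n.
rewrite /cos_coef /sin_coef.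
have -> : circle_integral (fun t => sin_mode k%:Z t * cos_mode n%:Z t : R) = 0.
  by rewrite -[RHS]e3; apply: circle_integral_eq => x _; rewrite mulrC.
have -> : circle_integral (fun t => sin_mode k%:Z t * sin_mode n%:Z t : R) =
   circle_integral (fun x => sin_mode n%:Z x * sin_mode k%:Z x) by apply: circle_integral_eq => x _; rewrite mulrC.
rewrite mulr0 add0r mulrCA e2; case: (eqVneq (n : nat) k) => [->|]; last by rewrite /= mulr0 mul0r.
by case: (eqVneq k 0%N) => [->|_] /=; rewrite ?B0 ?mulr0 ?mulr1 ?mul1r.
Qed.

Lemma sin_coef0 f : sin_coef f 0 = 0.
Proof.
rewrite -[RHS](@circle_integral_cst R 0); apply: circle_integral_eq => x _.
by rewrite sin_mode0 mulr0.
Qed.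

(** The square of [g] minus its Fourier partial sum has nonnegative
integral. *)
Lemma bessel g N : circle_integrable g -> circle_integrable (fun x => g x ^+ 2) ->
  \sum_(n < N) mult n * (cos_coef g n%:Z ^+ 2 + sin_coef g n%:Z ^+ 2) <= circle_integral (fun x => g x ^+ 2).
Proof.
move=> ig ig2; pose A n := cos_coef g n%:Z; pose B n := sin_coef g n%:Z.
pose P := trig_poly A B N; have cP := @trig_poly_continuous A B N.
have iP := continuous_integrable cP.
have iP2 := circle_integrableM iP cP; have igP := circle_integrableM ig cP.
have B0 : B 0%N = 0 by exact: sin_coef0.
have sE : \sum_(n < N) mult n * (cos_coef g n%:Z ^+ 2 + sin_coef g n%:Z ^+ 2) =
    circle_integral (fun x => g x * P x).
  by rewrite trig_poly_integral //; apply: eq_bigr => n _; rewrite /A /B !expr2.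
have sE2 : circle_integral (fun x => P x * P x) = circle_integral (fun x => g x * P x).
  rewrite !trig_poly_integral //; apply: eq_bigr => n _.
  by have [-> ->] := @trig_poly_coef A B N n B0; rewrite ltn_ord !mul1r.
have sq : 0 <= circle_integral (fun x => (g x ^+ 2 - 2 * (g x * P x)) + P x * P x).
  by apply: circle_integral_ge0 => x; have := sqr_ge0 (g x - P x); nra.
rewrite circle_integralD // in sq; last by apply: circle_integrableB => //; exact: circle_integrableZ.
rewrite circle_integralB // in sq; last exact: circle_integrableZ.
rewrite circle_integralZ // sE2 in sq.
by rewrite sE; lra.
Qed.

Section Synthesis.
Variables (A B : nat -> R) (K : nat) (e : nat -> R).
Hypotheses (B0 : B 0%N = 0)
  (dec : forall j n, (j <= K)%N -> freq R n%:Z ^+ j * (`|A n| + `|B n|) <= e n)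
  (ce : cvgn (series e)).

(** The sum of the series of [j]-th derivatives; the hypothesis [B0] fixes the
coefficient of the zero function [sin_mode 0]. *)
Definition synth j : R -> R := fsum (trig_term A B j).

Lemma synth_majorised j : (j <= K)%N -> majorised (trig_term A B j) (fun n => 2 * e n).
Proof.
move=> jK; split=> [n x|].
  by apply: le_trans (trig_term_bound A B j n x) _; rewrite ler_pM2l //; exact: dec.
have -> : series (fun n => 2 * e n) = 2 *: series e.
  by apply/funext => n; rewrite /series /= -mulr_sumr.
exact: is_cvgZr.
Qed.

Lemma synth_deriv j : (j < K)%N -> has_deriv (synth j) (synth j.+1).
Proof.
move=> jK; apply: fsum_deriv (synth_majorised (ltnW jK)) (synth_majorised jK) _ _ => n.
  exact: trig_term_deriv.
exact: trig_term_continuous.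
Qed.

Lemma synth_continuous j : (j <= K)%N -> continuous (synth j).
Proof.
by move=> jK; apply: fsum_continuous (synth_majorised jK) _ => n; exact: trig_term_continuous.
Qed.

Lemma synth_class_C : class_C K (synth 0).
Proof. by apply: tower_class_C => [j|]; [exact: synth_deriv|exact: synth_continuous]. Qed.

Lemma synth_derive1n j : (j <= K)%N -> derive1n j (synth 0) = synth j.
Proof. by apply: tower_derive1n => i; exact: synth_deriv. Qed.

Lemma synth_periodic j : periodic (synth j) 1.
Proof. by apply: fsum_periodic => n; exact: trig_term_periodic. Qed.

Lemma synth_coef n : cos_coef (synth 0) n%:Z = A n /\ sin_coef (synth 0) n%:Z = B n.
Proof.
have mj := synth_majorised (leq0n K).
have cP N := @trig_poly_continuous A B N.
have lim phi : continuous phi -> (forall x, `|phi x| <= 1) ->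
    (fun N => circle_integral (fun x => trig_poly A B N x * phi x)) @ \oo -->
    circle_integral (fun x => synth 0 x * phi x).
  move=> cphi bphi.
  apply: (@uniform_circle_integral R _ _ (tail (fun n => 2 * e n))).
  - by move=> N x; apply: cvgM; [exact: cP|exact: cphi].
  - move=> N x; rewrite -mulrBl normrM.
    apply: le_trans (_ : `|trig_poly A B N x - synth 0 x| * 1 <= _).
      by apply: ler_wpM2l.
    by rewrite mulr1; exact: majorised_tail mj.
  - exact: tail_cvg0 mj.
have ev c : (fun N => (n < N)%N%:R * c) @ \oo --> (c : R).
  apply: cvg_near_cst; near=> N.
  rewrite (_ : (n < N)%N = true) ?mul1r //; near: N; exact: nbhs_infty_gt.
split.
  have l := lim _ (@cos_mode_continuous R n%:Z) (cos_mode_le1 n%:Z).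
  have E N : circle_integral (fun x => trig_poly A B N x * cos_mode n%:Z x) = (n < N)%N%:R * A n.
    by have [] := @trig_poly_coef A B N n B0.
  move: l; under eq_fun do rewrite E; move=> l.
  exact: cvg_unique _ l (ev (A n)).
have l := lim _ (@sin_mode_continuous R n%:Z) (sin_mode_le1 n%:Z).
have E N : circle_integral (fun x => trig_poly A B N x * sin_mode n%:Z x) = (n < N)%N%:R * B n.
  by have [] := @trig_poly_coef A B N n B0.
move: l; under eq_fun do rewrite E; move=> l.
exact: cvg_unique _ l (ev (B n)).
Unshelve. all: by end_near. Qed.

Lemma rot_l2 n j (p : R * R) : (rot n%:Z j p).1 ^+ 2 + (rot n%:Z j p).2 ^+ 2 =
  freq R n%:Z ^+ 2 ^+ j * (p.1 ^+ 2 + p.2 ^+ 2).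
Proof.
elim: j => [|j IHj] /=; first by rewrite mul1r.
rewrite -/(rot n%:Z j p) (exprS (freq R n%:Z ^+ 2) j) -mulrA -IHj; ring.
Qed.

Lemma rot_snd0 j : (rot 0 j (A 0%N, B 0%N)).2 = 0.
Proof.
elim: j => [|j IHj] /=; first exact: B0.
by rewrite freq0 oppr0 mul0r.
Qed.

(** Parseval: partial sums converge uniformly, hence in mean square, and the
energy of a trigonometric polynomial is computed by orthogonality. *)
Lemma synth_energy j : (j <= K)%N ->
  (fun N => \sum_(n < N) mult n * (freq R n%:Z ^+ 2 ^+ j * (A n ^+ 2 + B n ^+ 2))) @ \oo -->
  circle_integral (fun x => synth j x ^+ 2).
Proof.
move=> jK; have mj := synth_majorised jK.
pose A' n := (rot n%:Z j (A n, B n)).1; pose B' n := (rot n%:Z j (A n, B n)).2.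
have B'0 : B' 0%N = 0 by exact: rot_snd0.
have cP N := @trig_poly_continuous A' B' N.
have cS := synth_continuous jK.
have E N : \sum_(n < N) mult n * (freq R n%:Z ^+ 2 ^+ j * (A n ^+ 2 + B n ^+ 2)) =
    circle_integral (fun x => trig_poly A' B' N x ^+ 2).
  have -> : circle_integral (fun x => trig_poly A' B' N x ^+ 2) =
      circle_integral (fun x => trig_poly A' B' N x * trig_poly A' B' N x).
    by apply: circle_integral_eq => x _; rewrite expr2.
  rewrite trig_poly_integral; last exact: continuous_integrable.
  apply: eq_bigr => n _; have [-> ->] := @trig_poly_coef A' B' N n B'0.
  by rewrite ltn_ord !mul1r -!expr2 rot_l2.
under eq_fun do rewrite E.
have [C0 hC] : exists C, forall x, `|synth j x| <= C.
  by have [C _ hC] := periodic_bounded cS (@synth_periodic j); exists C.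
pose t := tail (fun n => 2 * e n).
have t0 : t @ \oo --> 0 := tail_cvg0 mj.
have bt N x : `|trig_poly A' B' N x - synth j x| <= t N by exact: majorised_tail mj.
apply: (@uniform_circle_integral R _ _ (fun N => t N * (t N + 2 * C0))).
- by move=> N x; apply: cvgM; exact: cP.
- move=> N x; rewrite subr_sqr normrM; apply: ler_pM => //.
  have -> : trig_poly A' B' N x + synth j x = (trig_poly A' B' N x - synth j x) + 2 * synth j x by ring.
  apply: le_trans (ler_normD _ _) _; apply: lerD => //.
  by rewrite normrM (ger0_norm (ler0n R 2)) ler_pM2l.
- rewrite -[X in _ --> X](mul0r (0 + 2 * C0)); apply: cvgM => //.
  by apply: cvgD => //; exact: cvg_cst.
Qed.

End Synthesis.

(** Negative frequencies carry no new information. *)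
Lemma fourier_unique_nat f g : continuous f -> continuous g -> periodic f 1 -> periodic g 1 ->
  (forall n : nat, cos_coef f n%:Z = cos_coef g n%:Z /\ sin_coef f n%:Z = sin_coef g n%:Z) -> f = g.
Proof.
move=> cf cg pf pg h.
have cos_modeN (m : int) x : cos_mode (- m) x = cos_mode m x :> R by rewrite /cos_mode freqN mulNr cosN.
have sin_modeN (m : int) x : sin_mode (- m) x = - sin_mode m x :> R by rewrite /sin_mode freqN mulNr sinN.
have cos_coefN (u : R -> R) (m : int) : cos_coef u (- m) = cos_coef u m.
  by apply: circle_integral_eq => x _; rewrite cos_modeN.
have sin_coefN (u : R -> R) (m : int) : continuous u -> sin_coef u (- m) = -1 * sin_coef u m.
  move=> cu; rewrite /sin_coef -circle_integralZ; last first.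
    by apply: circle_integrableM; [exact: continuous_integrable|exact: sin_mode_continuous].
  by apply: circle_integral_eq => x _; rewrite sin_modeN; ring.
apply: fourier_unique => // -[n|n].
- by have [] := h n.
- by rewrite NegzE !cos_coefN; have [] := h n.+1.
- by have [] := h n.
- by rewrite NegzE !sin_coefN //; have [_ ->] := h n.+1.
Qed.

Definition weight n : R := \sum_(k < 5) freq R n%:Z ^+ 2 ^+ k.

(** Bessel inequality for the weak derivatives up to order four, summed. *)
Lemma H4_bessel f N : H4 f ->
  \sum_(n < N) mult n * (weight n * (cos_coef f n%:Z ^+ 2 + sin_coef f n%:Z ^+ 2)) <= H4norm f ^+ 2.
Proof.
move=> [cf pf wf]; have iF := continuous_integrable cf.
rewrite /H4norm sqr_sqrtr; last first.
  by apply: sumr_ge0 => k _; apply: circle_integral_ge0 => x; rewrite exprn_ge0.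
have -> : \sum_(n < N) mult n * (weight n * (cos_coef f n%:Z ^+ 2 + sin_coef f n%:Z ^+ 2)) =
  \sum_(k < 5) \sum_(n < N) mult n * (freq R n%:Z ^+ 2 ^+ k * (cos_coef f n%:Z ^+ 2 + sin_coef f n%:Z ^+ 2)).
  rewrite exchange_big /=; apply: eq_bigr => n _.
  by rewrite -mulr_sumr /weight mulr_suml.
apply: ler_sum => k _.
have k4 : (k <= 4)%N by have := ltn_ord k.
have [g /[dup] lg /Lp2P[pg ig ig2] wg] := wf k k4.
rewrite (wderiv_energy lg wg iF); apply: le_trans (bessel N ig ig2).
by apply: ler_sum => n _; rewrite -(weak_derivative_fourier n wg iF ig).
Qed.

Lemma summable_of_bounded (e : nat -> R) (M : R) : (forall n, 0 <= e n) ->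
  (forall N, \sum_(n < N) e n <= M) -> cvgn (series e).
Proof.
move=> e0 eM; apply: nondecreasing_is_cvgn.
  by apply/nondecreasing_seqP => n; rewrite /series /= big_nat_recr //= lerDl.
by exists M => _ [N _ <-]; rewrite /series /= big_mkord.
Qed.

Lemma freq_ge_n n : n%:R <= freq R n%:Z.
Proof.
rewrite /freq -[leLHS]mul1r; apply: ler_wpM2r; first by [].
have := pi_ge2 R; lra.
Qed.

Lemma weight_ge j n : (j <= 3)%N -> freq R n%:Z ^+ 2 ^+ j * (1 + n%:R ^+ 2) <= weight n.
Proof.
move=> j3; rewrite /weight; set F := freq R n%:Z ^+ 2.
have F0 : 0 <= F by exact: sqr_ge0.
have nF : n%:R ^+ 2 <= F by rewrite /F lerXn2r ?nnegrE ?freq_ge0 ?freq_ge_n.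
apply: le_trans (_ : F ^+ j * (1 + F) <= _).
  by apply: ler_wpM2l; [exact: exprn_ge0|rewrite lerD2l].
rewrite mulrDr mulr1 -exprSr.
rewrite !big_ord_recr big_ord0 /= add0r.
have p i : 0 <= F ^+ i := exprn_ge0 i F0.
have := p 0%N; have := p 1%N; have := p 2; have := p 3; have := p 4.
by case: j j3 => [|[|[|[|]]]] // _; lra.
Qed.

(** A summable sequence, the second term in the Young inequalities below. *)
Definition inv_sq n : R := (1 + n%:R ^+ 2)^-1.

(** The bound [4 - 4 / (N + 1)] telescopes. *)
Lemma inv_sq_sum N : \sum_(n < N) inv_sq n <= 4.
Proof.
suff h : \sum_(n < N) inv_sq n <= 4 - 4 / N.+1%:R.
  by apply: le_trans h _; rewrite gerBl divr_ge0.
elim: N => [|N IHN]; first by rewrite big_ord0 divr1 subrr.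
rewrite big_ord_recr /=; apply: le_trans (lerD IHN (lexx _)) _.
rewrite /inv_sq -[N.+2%:R]natr1 -[N.+1%:R]natr1; have : 0 <= N%:R :> R by [].
move: (N%:R : R) => u u0.
have -> : 4 - 4 / (u + 1 + 1) = 4 - 4 / (u + 1) + 4 / ((u + 1) * (u + 1 + 1)).
  by field; rewrite ?gt_eqF //; lra.
rewrite lerD2l -[leLHS]mul1r ler_pdivlMr; last by nra.
rewrite mul1r mulrC ler_pdivrMr; nra.
Qed.

Lemma inv_sq_gt0 n : 0 < inv_sq n.
Proof. by rewrite invr_gt0 ltr_wpDr ?sqr_ge0. Qed.

(** Dominates the terms of the Fourier series of the first three derivatives:
by [weighted_young] a term of order [n ^+ 3 * a] costs part of the energy
[weight n * a ^+ 2] plus a summable sequence. *)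
Definition H4_majorant f n : R :=
  mult n * (weight n * (cos_coef f n%:Z ^+ 2 + sin_coef f n%:Z ^+ 2)) + inv_sq n.

Lemma weight_ge0 n : 0 <= weight n.
Proof. by apply: sumr_ge0 => k _; rewrite exprn_ge0 // sqr_ge0. Qed.

Lemma H4_majorant_cvg f : H4 f -> cvgn (series (H4_majorant f)).
Proof.
move=> hf; apply: (@summable_of_bounded _ (H4norm f ^+ 2 + 4)).
  move=> n; rewrite addr_ge0 ?(ltW (inv_sq_gt0 n)) // mulr_ge0 ?(ltW (mult_gt0 n)) //.
  by rewrite mulr_ge0 ?weight_ge0 // addr_ge0 // sqr_ge0.
move=> N; rewrite big_split /=; apply: lerD; [exact: H4_bessel|exact: inv_sq_sum].
Qed.

(** Expand the nonnegative square of [F * a - q]. *)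
Lemma weighted_young (w q F a : R) : 0 <= a -> 0 < q -> 0 <= F -> F ^+ 2 <= w * q ->
  2 * (F * a) <= w * a ^+ 2 + q.
Proof.
move=> a0 q0 F0 h; have := sqr_ge0 (F * a - q) => h2.
have h3 : F ^+ 2 * a ^+ 2 <= w * q * a ^+ 2 by apply: ler_wpM2r => //; exact: sqr_ge0.
rewrite -(ler_pM2l q0).
have : 0 <= F ^+ 2 * a ^+ 2 - 2 * q * (F * a) + q ^+ 2.
  by move: h2; congr (_ <= _); ring.
by move=> h4; nra.
Qed.

Lemma H4_majorant_dec f j n : (j <= 3)%N ->
  freq R n%:Z ^+ j * (`|cos_coef f n%:Z| + `|sin_coef f n%:Z|) <= H4_majorant f n.
Proof.
move=> j3; have w := weight_ge n j3; have q0 := inv_sq_gt0 n.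
have F0 : 0 <= freq R n%:Z ^+ j by rewrite exprn_ge0 // freq_ge0.
have h : (freq R n%:Z ^+ j) ^+ 2 <= weight n * inv_sq n.
  by rewrite /inv_sq -exprM mulnC exprM ler_pdivlMr // ltr_wpDr ?sqr_ge0.
have h1 := weighted_young (normr_ge0 (cos_coef f n%:Z)) q0 F0 h.
have h2 := weighted_young (normr_ge0 (sin_coef f n%:Z)) q0 F0 h.
rewrite !real_normK ?num_real // in h1 h2.
have m1 : 1 <= mult n by rewrite /mult; case: eqP => _; lra.
have s0 : 0 <= weight n * (cos_coef f n%:Z ^+ 2 + sin_coef f n%:Z ^+ 2).
  by rewrite mulr_ge0 ?weight_ge0 // addr_ge0 // sqr_ge0.
rewrite /H4_majorant; have := ler_wpM2r s0 m1; rewrite mul1r.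
by move: h1 h2; rewrite !mulrDr; lra.
Qed.

(** The Fourier series converges in C^3 by [H4_majorant_dec], and its sum has
the same coefficients as [f]. *)
Lemma H4_fourier f : H4 f -> f = synth (fun n => cos_coef f n%:Z) (fun n => sin_coef f n%:Z) 0.
Proof.
move=> hf; have [cf pf _] := hf.
have dec j n := @H4_majorant_dec f j n.
have ce := H4_majorant_cvg hf.
have B0 : (fun n : nat => sin_coef f n%:Z) 0%N = 0 by exact: sin_coef0.
apply: fourier_unique_nat => //.
- exact: (synth_continuous dec ce).
- exact: synth_periodic.
- by move=> n; have [-> ->] := synth_coef B0 dec ce n.
Qed.

Lemma H4_class_C f : H4 f -> class_C 3 f.
Proof.
move=> hf; rewrite (H4_fourier hf); apply: synth_class_C (H4_majorant_cvg hf).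
by move=> j n; exact: H4_majorant_dec.
Qed.

End FourierSeries.


(** * The invariant density and the resolvent in closed form *)

Section Acip.
Variable R : realType.
Variables (T T1 T2 : R -> R) (d : int) (s al C : R).
Hypothesis E : expanding_lift T T1 T2 d s al C.
Implicit Types (f g h q : R -> R) (x y : R).
Local Notation psi := (lift_inv T).
Local Notation psi1 := (inv1 T T1).
Local Notation psi2 := (inv2 T T1 T2).
Local Notation L := (Lop `|d|%N s psi psi1).
Local Notation neu := (neumann `|d|%N s psi psi1).
Let IB := inv_branch E.
Variable a : R.
Hypothesis (a_gt0 : 0 < a) (aK : C * al ^+ 2 <= tau al * a).

Lemma zero_mean_fixed_eq0 f : continuous f -> periodic f 1 -> circle_integral f = 0 ->
  (forall x, L f x = f x) -> forall x, f x = 0.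
Proof.
move=> cf pf If Lf; apply: (fixed_point_eq0 IB a_gt0 aK Lf) => eps eps0.
exact: smooth_approx.
Qed.

(** The difference of two solutions is a zero-mean fixed point. Uniqueness
among all continuous functions matters because [acip] and [resolvent] select
Sobolev functions, which need not be of class C^1 a priori. *)
Lemma resolvent_unique f g : continuous f -> periodic f 1 -> circle_integral f = 0 ->
  continuous g -> periodic g 1 -> circle_integral g = 0 ->
  (forall x, f x - L f x = g x - L g x) -> f = g.
Proof.
move=> cf pf If cg pg Ig e; apply/funext => x; apply/eqP; rewrite -subr_eq0; apply/eqP.
apply: (@zero_mean_fixed_eq0 (fun y => f y - g y)).
- by move=> y; apply: cvgB; [exact: cf|exact: cg].
- by move=> y; rewrite pf pg.
- by rewrite circle_integralB ?If ?Ig ?subrr //; exact: continuous_integrable.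
- by move=> y; rewrite LopB; have := e y; lra.
Qed.

Definition defect x : R := L (fun=> 1) x - 1.

Lemma defect_deriv : has_deriv defect (Lop1 `|d|%N s psi psi1 psi2 (fun=> 1) (fun=> 0)).
Proof.
apply: has_deriv_ext (has_derivB (has_deriv_Lop IB (has_deriv_cst 1)) (has_deriv_cst 1)) _ _ => // x.
by rewrite subr0.
Qed.

Lemma defect_deriv_continuous :
  continuous (Lop1 `|d|%N s psi psi1 psi2 (fun=> 1) (fun=> 0) : R -> R).
Proof. by apply: (Lop1_continuous IB) => x; exact: cvg_cst. Qed.

Lemma defect_periodic : periodic defect 1.
Proof. by move=> x; rewrite /defect (Lop_periodic IB (f := fun=> 1)). Qed.

Lemma defect_integral : circle_integral defect = 0.
Proof.
have c1 : continuous (fun _ : R => (1 : R)) by move=> x; exact: cvg_cst.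
rewrite /defect circle_integralB; try exact: continuous_integrable.
  by rewrite (Lop_integral IB) // subrr.
by apply: continuous_integrable; exact: Lop_continuous IB _ c1.
Qed.

(** The invariant density is the limit of the iterates of the constant one,
written as a telescoping series. *)
Definition invariant x : R := 1 + neu defect x.

Lemma invariant_spec : [/\ exists2 f1, has_deriv invariant f1 & continuous f1,
  periodic invariant 1, circle_integral invariant = 1, forall x, 0 <= invariant x &
  forall x, L invariant x = invariant x].
Proof.
have [m [A [m0 Am qA q1A]]] := decay_scale a_gt0 defect_deriv
  defect_deriv_continuous defect_periodic.
have [[h1 hh ch1] ph Ih eh _] := resolvent1 IB a_gt0 aK defect_deriv
  defect_deriv_continuous defect_periodic defect_integral m0 qA Am q1A.
have hinv : has_deriv invariant h1.
  by apply: has_deriv_ext (has_derivD (has_deriv_cst 1) hh) _ _ => // x; rewrite add0r.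
have c1 : continuous (fun _ : R => (1 : R)) by move=> x; exact: cvg_cst.
have ch := has_deriv_continuous hh.
split.
- by exists h1.
- by move=> x; rewrite /invariant ph.
- rewrite /invariant circle_integralD; try exact: continuous_integrable.
  by rewrite Ih circle_integral_cst addr0.
- move=> x.
  have dec := decay1 IB a_gt0 aK defect_deriv defect_deriv_continuous defect_periodic
    defect_integral m0 qA Am q1A.
  have bd n y : `|iter n L defect y| <= m * expR a * (1 - kappa al a) ^+ n.
    by have [u [_ _ h _]] := dec n; exact: h.
  have [mj _] := geometric_majorised (theta_bound IB a_gt0) bd.
  have lim : (fun n => 1 + \sum_(k < n) iter k L defect x) @ \oo --> invariant x.
    by apply: cvgD; [exact: cvg_cst|exact: majorised_cvg mj].
  (* The partial sums are the iterates of the constant one, which are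
  nonnegative. *)
  have key n : 0 <= 1 + \sum_(k < n) iter k L defect x.
    have -> : 1 + \sum_(k < n) iter k L defect x = iter n L (fun=> 1) x.
      rewrite {1}(@telescope_iter _ `|d|%N s psi psi1 (fun=> 1) n x c1).
      rewrite addrAC -big_split /= big1 ?add0r // => k _.
      have -> : defect = fun y => -1 * (1 - L (fun=> 1) y).
        by apply/funext => y; rewrite /defect mulN1r opprB.
      by rewrite Lop_iterZ mulN1r subrr.
    elim: n (x) => [|n IHn] y /=; first by [].
    exact: (Lop_ge0 IB).
  by apply: (cvgr_to_ge lim); near=> n; exact: key.
- move=> x; have := eh x.
  have -> : L invariant x = L (fun=> 1) x + L (neu defect) x.
    by rewrite /invariant LopD.
  by rewrite /invariant /defect; lra.
Unshelve. all: by end_near. Qed.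

Lemma C1_sobolev f f1 : has_deriv f f1 -> continuous f1 -> periodic f 1 -> sobolev 1 1%:E f.
Proof.
move=> hf cf1 pf; apply: class_C_sobolev => //; last exact: continuous_Lp1.
apply: (tower_class_C (F := fun j => if j == 0%N then f else f1)) => //.
by case.
Qed.

(** The density selected by [acip] is continuous and fixed by the transfer
operator, as is [invariant]; both have integral one. *)
Lemma acipE : acip T = invariant.
Proof.
have [[f1 hf cf1] pf If f0 Lf] := invariant_spec.
have cf := has_deriv_continuous hf.
rewrite /acip; case: xgetP => [g _ [[cg pg _] ig]|/(_ invariant)]; last first.
  by case; split; [exact: C1_sobolev hf cf1 pf|apply/(invariant_densityP E cf pf)].
have [g0 Ig Lg] := (invariant_densityP E cg pg).1 ig.
apply/funext => x; apply/eqP; rewrite -subr_eq0; apply/eqP.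
apply: (@zero_mean_fixed_eq0 (fun y => g y - invariant y)).
- by move=> y; apply: cvgB; [exact: cg|exact: cf].
- by move=> y; rewrite pg pf.
- by rewrite circle_integralB ?If ?Ig ?subrr //; exact: continuous_integrable.
- by move=> y; rewrite LopB Lg Lf.
Qed.

(** A map of class C^3 is needed for this: the weight of the transfer operator
involves one derivative of the map. *)
Lemma invariant_C2 (T3 : R -> R) (C3 : R) : has_deriv T2 T3 -> continuous T3 ->
  (forall x, `|T3 x| <= C3) ->
  exists f1 f2, [/\ has_deriv invariant f1, has_deriv f1 f2 & continuous f2].
Proof.
move=> h3 c3 b3; have [psi3 [K2 [hp3 cp3 bp3]]] := inv_third E h3 c3 b3.
have z1 := has_deriv_Lop1 IB hp3 (has_deriv_cst 1) (has_deriv_cst 0).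
have cc k : continuous (fun _ : R => (k : R)) by move=> x; exact: cvg_cst.
have c2 : continuous (Lop2 `|d|%N s psi psi1 psi2 psi3 (fun=> 1) (fun=> 0) (fun=> 0) : R -> R).
  exact: Lop2_continuous IB _ cp3 _ _ _ (cc 1) (cc 0) (cc 0).
have [h1 [h2 [H1 H2 H3]]] := resolvent2 IB a_gt0 aK hp3 cp3 bp3 defect_deriv z1 c2
  defect_periodic defect_integral.
exists h1, h2; split => //.
by apply: has_deriv_ext (has_derivD (has_deriv_cst 1) H1) _ _ => // x; rewrite add0r.
Qed.

Definition C1_zero_mean q := (exists2 q1, has_deriv q q1 & continuous q1) /\
  periodic q 1 /\ circle_integral q = 0.

(** By [resolvent_unique] these properties determine [neu q]. *)
Lemma neumann_spec q : C1_zero_mean q ->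
  [/\ C1_zero_mean (neu q) & forall x, neu q x - L (neu q) x = q x].
Proof.
move=> [[q1 hq cq1] [pq Iq]].
have [m [A [m0 Am qA q1A]]] := decay_scale a_gt0 hq cq1 pq.
by have [? ? ? ? _] := resolvent1 IB a_gt0 aK hq cq1 pq Iq m0 qA Am q1A.
Qed.

Lemma resolventE (g : R -> R[i]) :
  C1_zero_mean (fun x => complex.Re (g x)) -> C1_zero_mean (fun x => complex.Im (g x)) ->
  resolvent T g = fun x => Complex (neu (fun y => complex.Re (g y)) x)
                                   (neu (fun y => complex.Im (g y)) x).
Proof.
move=> hr hi; have [[[u1 hu cu1] [pu Iu]] eu] := neumann_spec hr.
have [[[v1 hv cv1] [pv Iv]] ev] := neumann_spec hi.
have cu := has_deriv_continuous hu; have cv := has_deriv_continuous hv.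
rewrite /resolvent; set H := (fun x => Complex _ _).
case: xgetP => [h _ [[wr wi] Ih eh]|/(_ H)]; last first.
  case; split.
  - by split; [exact: C1_sobolev hu cu1 pu|exact: C1_sobolev hv cv1 pv].
  - by rewrite /complex_integral /H /= Iu Iv.
  - move=> x; rewrite (transferE E); last by move=> y; rewrite /H pu pv.
    have -> : g x = Complex (complex.Re (g x)) (complex.Im (g x)) by case: (g x).
    by rewrite -eu -ev.
have [cr pr _] := wr; have [ci pi _] := wi.
move: Ih; rewrite /complex_integral => -[Ir Ii].
have ph y : h (y + 1) = h y.
  by have := pr y; have := pi y; case: (h y) => ? ?; case: (h (y + 1)) => ? ? /= -> ->.
have er x : complex.Re (h x) - L (fun y => complex.Re (h y)) x = complex.Re (g x).
  by rewrite -eh (transferE E) //; case: (h x).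
have ei x : complex.Im (h x) - L (fun y => complex.Im (h y)) x = complex.Im (g x).
  by rewrite -eh (transferE E) //; case: (h x).
have e1 : (fun x => complex.Re (h x)) = neu (fun y => complex.Re (g y)).
  by apply: resolvent_unique => // x; rewrite er eu.
have e2 : (fun x => complex.Im (h x)) = neu (fun y => complex.Im (g y)).
  by apply: resolvent_unique => // x; rewrite ei ev.
apply/funext => x; rewrite /H -e1 -e2 /=; by case: (h x).
Qed.

End Acip.

(** Periodic sets do not see integer translations, so that invariance depends
on the map modulo one. This allows the perturbed maps to be replaced by lifts
given by a formula. *)
Lemma acip_mod1 (R : realType) (T T' : R -> R) :
  (forall x, exists m : int, T x = T' x + m%:~R) -> acip T = acip T'.
Proof.
move=> h.
have pA (A : set R) : (forall x, A (x + 1) <-> A x) -> forall x (m : int), A (x + m%:~R) <-> A x.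
  move=> pA x m; have := periodic_indic pA (x + m%:~R).
  rewrite frac_periodic -(periodic_indic pA) !indicE => e.
  have {}e : (x + m%:~R \in A) = (x \in A).
    by have /eqP := e; rewrite eqr_nat; case: (_ + _ \in A); case: (x \in A).
  by split => /mem_set; [rewrite e|rewrite -e]; rewrite inE.
have e f : invariant_density T f <-> invariant_density T' f.
  have eA (A : set R) : (forall x, A (x + 1) <-> A x) -> T @^-1` A = T' @^-1` A.
    move=> hA; apply/seteqP; split => x /=; have [m ->] := h x; by move/(pA _ hA).
  by split=> -[f0 If inv]; split=> // A mA hA; rewrite -(inv A mA hA) eA.
rewrite /acip; congr (xget _ _); apply/seteqP; split=> f /= [sf /e idf]; by split.
Qed.


(** * Uniform orders of magnitude *)

Section UniformOrders.
Variable R : realType.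
Variable del0 : R.
Hypothesis del0_le1 : del0 <= 1.
Implicit Types (u v : R -> R -> R).

(** [u del y = O(del^k)] uniformly in [y], for [0 < del < del0]. *)
Definition unif_O k u := exists c : R, forall del y, 0 < del < del0 -> `|u del y| <= c * del ^+ k.

Lemma unif_O_ext k u v : (forall del y, 0 < del < del0 -> v del y = u del y) -> unif_O k u -> unif_O k v.
Proof. by move=> e [c hc]; exists c => del y hd; rewrite e // hc. Qed.

Lemma unif_O_weak k l u : (k <= l)%N -> unif_O l u -> unif_O k u.
Proof.
move=> kl [c hc]; exists `|c| => del y hd; have /andP[d0 d1] := hd.
apply: le_trans (hc del y hd) _; apply: le_trans (_ : `|c| * del ^+ l <= _).
  by apply: ler_wpM2r; [rewrite exprn_ge0 // ltW|exact: ler_norm].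
apply: ler_wpM2l => //; apply: ler_wiXn2l => //; first exact: ltW.
by apply: ltW; apply: lt_le_trans d1 del0_le1.
Qed.

Lemma unif_OD k u v : unif_O k u -> unif_O k v -> unif_O k (fun del y => u del y + v del y).
Proof.
move=> [c hc] [c' hc']; exists (c + c') => del y hd; rewrite mulrDl.
by apply: le_trans (ler_normD _ _) _; apply: lerD; auto.
Qed.

Lemma unif_ON k u : unif_O k u -> unif_O k (fun del y => - u del y).
Proof. by move=> [c hc]; exists c => del y hd; rewrite normrN hc. Qed.

Lemma unif_OB k u v : unif_O k u -> unif_O k v -> unif_O k (fun del y => u del y - v del y).
Proof. by move=> hu /unif_ON; exact: unif_OD. Qed.

Lemma unif_OM k l u v : unif_O k u -> unif_O l v -> unif_O (k + l) (fun del y => u del y * v del y).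
Proof.
move=> [c hc] [c' hc']; exists (c * c') => del y hd; rewrite normrM exprD mulrACA.
by apply: ler_pM => //; auto.
Qed.

Lemma unif_O_M0 k u v : unif_O 0 u -> unif_O k v -> unif_O k (fun del y => u del y * v del y).
Proof. by move=> hu hv; have := unif_OM hu hv. Qed.

Lemma unif_O_del : unif_O 1 (fun del _ => del).
Proof. by exists 1 => del y /andP[d0 _]; rewrite gtr0_norm // mul1r expr1. Qed.

Lemma unif_O_fun (g : R -> R) (p : R -> R -> R) (B : R) : (forall x, `|g x| <= B) ->
  unif_O 0 (fun del y => g (p del y)).
Proof. by move=> hB; exists B => del y _; rewrite mulr1. Qed.

Lemma unif_O_sum n k u : unif_O k u -> unif_O k (fun del y => \sum_(j < n) u del (y + j%:R)).
Proof.
move=> [c hc]; exists (n%:R * c) => del y hd; apply: le_trans (ler_norm_sum _ _ _) _.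
apply: le_trans (_ : \sum_(j < n) c * del ^+ k <= _); last first.
  by rewrite sumr_const card_ord -mulrA mulr_natl.
by apply: ler_sum => j _; exact: hc.
Qed.

Lemma unif_O_div k u : unif_O k.+1 u -> unif_O k (fun del y => u del y / del).
Proof.
move=> [c hc]; exists c => del y hd; have /andP[d0 d1] := hd.
rewrite normrM normfV (gtr0_norm d0) ler_pdivrMr // -mulrA -exprSr; exact: hc.
Qed.

Lemma unif_O_closeM u u' v v' : unif_O 1 (fun del y => u del y - u' del y) ->
  unif_O 1 (fun del y => v del y - v' del y) -> unif_O 0 u -> unif_O 0 v' ->
  unif_O 1 (fun del y => u del y * v del y - u' del y * v' del y).
Proof.
move=> h1 h2 bu bv; apply: unif_O_ext (unif_OD (unif_O_M0 bu h2) (unif_O_M0 bv h1)) => del y _; ring.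
Qed.

Lemma unif_O_lip (g g1 : R -> R) (B : R) k u v : has_deriv g g1 -> (forall x, `|g1 x| <= B) ->
  unif_O k (fun del y => u del y - v del y) -> unif_O k (fun del y => g (u del y) - g (v del y)).
Proof.
move=> hg hB [c hc]; exists (B * c) => del y hd.
apply: le_trans (has_deriv_lip hg hB _ _) _; rewrite -mulrA; apply: ler_wpM2l; last exact: hc.
exact: le_trans (normr_ge0 _) (hB 0).
Qed.

(** The error in the first order expansion is quadratic in the increment. *)
Lemma unif_O_taylor (g g1 g2 : R -> R) (B : R) u v : has_deriv g g1 -> has_deriv g1 g2 ->
  (forall x, `|g2 x| <= B) -> unif_O 1 (fun del y => u del y - v del y) ->
  unif_O 2 (fun del y => g (u del y) - g (v del y) - g1 (v del y) * (u del y - v del y)).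
Proof.
move=> hg hg1 hB huv; have [c hc] := unif_OM huv huv; exists (B * c) => del y hd.
have [z hz ->] := mvt_between (v del y) (u del y) hg.
have B0 : 0 <= B := le_trans (normr_ge0 _) (hB 0).
rewrite -mulrBl normrM -mulrA.
apply: le_trans (_ : B * (`|u del y - v del y| * `|u del y - v del y|) <= _).
  rewrite mulrA; apply: ler_wpM2r => //; apply: le_trans (has_deriv_lip hg1 hB _ _) _.
  exact: ler_wpM2l.
by apply: ler_wpM2l => //; rewrite -normrM; exact: hc.
Qed.

(** Pairs of a periodic function and its continuous derivative; such pairs are
bounded on the line, which yields all constants below. *)
Definition periodic_C1 (g g1 : R -> R) := [/\ has_deriv g g1, continuous g1 & periodic g 1].

Lemma periodic_C1_bounded g g1 : periodic_C1 g g1 -> exists2 B : R, 0 <= B &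
  (forall x, `|g x| <= B) /\ forall x, `|g1 x| <= B.
Proof.
move=> [hg cg pg]; have [B B0 hB] := periodic_bounded (has_deriv_continuous hg) pg.
have [B' B'0 hB'] := periodic_bounded cg (has_deriv_periodic hg pg).
exists (B + B'); first exact: addr_ge0.
by split=> x; [apply: le_trans (hB x) _|apply: le_trans (hB' x) _]; lra.
Qed.

Lemma periodic_C1M g g1 h h1 : periodic_C1 g g1 -> periodic_C1 h h1 ->
  periodic_C1 (fun x => g x * h x) (fun x => g1 x * h x + g x * h1 x).
Proof.
move=> [hg cg pg] [hh ch ph]; split; first exact: has_derivM.
- have c0 := has_deriv_continuous hg; have c1 := has_deriv_continuous hh.
  by move=> x; apply: cvgD; apply: cvgM; [exact: cg|exact: c1|exact: c0|exact: ch].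
- by move=> x; rewrite pg ph.
Qed.

Lemma periodic_C1D g g1 h h1 : periodic_C1 g g1 -> periodic_C1 h h1 ->
  periodic_C1 (fun x => g x + h x) (fun x => g1 x + h1 x).
Proof.
move=> [hg cg pg] [hh ch ph]; split; first exact: has_derivD.
- by move=> x; apply: cvgD; [exact: cg|exact: ch].
- by move=> x; rewrite pg ph.
Qed.

Lemma periodic_C1N g g1 : periodic_C1 g g1 -> periodic_C1 (fun x => - g x) (fun x => - g1 x).
Proof.
move=> [hg cg pg]; split; first exact: has_derivN.
- by move=> x; apply: cvgN; exact: cg.
- by move=> x; rewrite pg.
Qed.

End UniformOrders.


(** * Differentiating the invariant density along a family of maps *)

Section Response.
Variable R : realType.
Implicit Types (x y : R).
Variables (T0 T01 T02 T03 : R -> R) (d : int) (s al C C3 : R).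
Hypothesis E0 : expanding_lift T0 T01 T02 d s al C.
Hypotheses (h3 : has_deriv T02 T03) (c3 : continuous T03) (b3 : forall x, `|T03 x| <= C3).
Variables (S S1 S2 : R -> R).
Hypotheses (nS : periodic_C1 S S1) (nS1 : periodic_C1 S1 S2).

Let al0 : 0 < al := lift_al0 E0.
Let al1 : al < 1 := lift_al1 E0.

(** The perturbed maps expand a little less than [T0]. These relaxed constants
are valid for all of them, so that the spectral gap is uniform along the
family; [al^-1] is replaced by its average with one. *)
Definition relaxed_rate : R := 2 / (al^-1 + 1).
Definition relaxed_bound : R := C + 1.
(** An opening of the cone that suits all maps of the family. *)
Definition cone_slope : R := relaxed_bound * relaxed_rate ^+ 2 / tau relaxed_rate + 1.

Lemma al_inv_gt1 : 1 < al^-1. Proof. by rewrite invf_gt1. Qed.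
Lemma relaxed_rate_inv : relaxed_rate^-1 = (al^-1 + 1) / 2. Proof. by rewrite /relaxed_rate invf_div. Qed.
Lemma relaxed_rate_gt0 : 0 < relaxed_rate. Proof. by rewrite /relaxed_rate divr_gt0 //; have := al_inv_gt1; lra. Qed.
Lemma relaxed_rate_lt1 : relaxed_rate < 1.
Proof. by have := al_inv_gt1; rewrite /relaxed_rate => h; rewrite ltr_pdivrMr; lra. Qed.
Lemma bound2_ge0 : 0 <= C. Proof. exact: le_trans (normr_ge0 _) (lift_bound2 E0 0). Qed.
Lemma relaxed_gap_gt0 : 0 < tau relaxed_rate. Proof. by rewrite /tau; have := relaxed_rate_lt1; lra. Qed.

Lemma cone_slope_gt0 : 0 < cone_slope.
Proof.
rewrite /cone_slope ltr_wpDl // divr_ge0 ?(ltW relaxed_gap_gt0) // mulr_ge0 ?sqr_ge0 //.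
by rewrite /relaxed_bound addr_ge0 // bound2_ge0.
Qed.

Lemma cone_slope_K : relaxed_bound * relaxed_rate ^+ 2 <= tau relaxed_rate * cone_slope.
Proof.
rewrite /cone_slope mulrDr mulr1 [tau relaxed_rate * (_ / _)]mulrC divfK ?gt_eqF ?relaxed_gap_gt0 // lerDl ltW //.
exact: relaxed_gap_gt0.
Qed.

Lemma rate_le_relaxed : al <= relaxed_rate.
Proof.
rewrite -[al]invrK -[relaxed_rate]invrK lef_pV2 ?posrE ?invr_gt0 ?relaxed_rate_gt0 //.
by rewrite relaxed_rate_inv; have := al_inv_gt1; lra.
Qed.

Lemma relaxed_lift : expanding_lift T0 T01 T02 d s relaxed_rate relaxed_bound.
Proof.
case: E0 => *; split => //; try exact: relaxed_rate_gt0; try exact: relaxed_rate_lt1.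
- move=> x; apply: le_trans (lift_exp E0 x).
  by rewrite lef_pV2 ?posrE ?relaxed_rate_gt0 // rate_le_relaxed.
- by move=> x; apply: le_trans (lift_bound2 E0 x) _; rewrite /relaxed_bound lerDl.
Qed.

Local Notation D := `|d|%N.
Local Notation v := (lift_inv T0).
Local Notation L0 := (Lop D s v (inv1 T0 T01)).
Local Notation neu0 := (neumann D s v (inv1 T0 T01)).
Local Notation f0 := (invariant T0 T01 d s).
Let IB0 := inv_branch relaxed_lift.

Lemma lift_deriv_periodic : periodic_C1 T01 T02 /\ periodic_C1 T02 T03.
Proof.
have pT := circle_map_deriv_periodic (lift_deriv E0) (lift_shift E0).
have h2 := lift_deriv2 E0; have pT2 := has_deriv_periodic h2 pT.
by split; split => //; exact: lift_cont2 E0.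
Qed.

Definition inv_slope x : R := (T01 x)^-1.
Definition inv_slope1 x : R := - (T02 x * (inv_slope x * inv_slope x)).

Lemma periodic_C1_inv_slope : periodic_C1 inv_slope inv_slope1 /\ exists inv_slope2, periodic_C1 inv_slope1 inv_slope2.
Proof.
have [nT nT2] := lift_deriv_periodic; have [hT cT pT] := nT.
have n0 := lift_neq0 E0.
have hi : has_deriv inv_slope inv_slope1.
  apply: has_deriv_ext (has_derivV hT n0) _ _ => // x.
  by rewrite /inv_slope1 /inv_slope mulNr; have := n0 x; move: (T01 x) => t t0; field.
have ci := has_deriv_continuous hi.
have ni : periodic_C1 inv_slope inv_slope1.
  split => //; last by move=> x; rewrite /inv_slope pT.
  by move=> x; apply: cvgN; apply: cvgM; [exact: cT|apply: cvgM; exact: ci].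
by split => //; eexists; exact: periodic_C1N (periodic_C1M nT2 (periodic_C1M ni ni)).
Qed.

Lemma density_C2 : exists f01 f02, periodic_C1 f0 f01 /\ periodic_C1 f01 f02.
Proof.
have [f01 [f02 [hf hf1 cf2]]] := invariant_C2 relaxed_lift cone_slope_gt0 cone_slope_K h3 c3 b3.
have [_ pf _ _ _] := invariant_spec relaxed_lift cone_slope_gt0 cone_slope_K.
exists f01, f02; split; split => //; first exact: has_deriv_continuous hf1.
exact: has_deriv_periodic hf pf.
Qed.

(** The right-hand side of the response equation
[r - L0 r = - L0 ((f0 * S / T0')')]; its argument is the derivative of
[f0 * S / T0']. *)
Definition source (flux1 : R -> R) x : R := - L0 flux1 x.

Definition response (flux1 : R -> R) : R -> R := neu0 (source flux1).

(** The derivative of a periodic function has zero mean, and the transfer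
operator preserves this. *)
Lemma source_spec (EE flux1 E2 : R -> R) : periodic_C1 EE flux1 -> periodic_C1 flux1 E2 ->
  has_deriv (source flux1) (fun x => - Lop1 D s v (inv1 T0 T01) (inv2 T0 T01 T02) flux1 E2 x) /\
  C1_zero_mean (source flux1).
Proof.
move=> [hE cE pE] [hE1 cE1 pE1].
have hs : has_deriv (source flux1) (fun x => - Lop1 D s v (inv1 T0 T01) (inv2 T0 T01 T02) flux1 E2 x).
  exact: has_derivN (has_deriv_Lop IB0 hE1).
split => //; split; [eexists; first exact: hs|split].
- by move=> x; apply: cvgN; exact: (Lop1_continuous IB0 cE cE1).
- by move=> x; rewrite /source (Lop_periodic IB0 pE1).
- rewrite /source.
  have -> : circle_integral (fun x => - L0 flux1 x) = circle_integral (fun x => -1 * L0 flux1 x).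
    by apply: circle_integral_eq => x _; rewrite mulN1r.
  rewrite circle_integralZ; last exact: continuous_integrable (Lop_continuous IB0 cE).
  by rewrite (Lop_integral IB0 cE pE1) (circle_integral_deriv0 hE cE pE) mulr0.
Qed.

Section Family.
Variables (F F1 F2 : R -> R -> R) (dbar M : R).
Hypotheses (dbar0 : 0 < dbar) (M0 : 0 <= M).
Hypotheses (hF : forall del, 0 < del < dbar -> has_deriv (F del) (F1 del))
  (hF1 : forall del, 0 < del < dbar -> has_deriv (F1 del) (F2 del))
  (cF2 : forall del, 0 < del < dbar -> continuous (F2 del))
  (pF : forall del, 0 < del < dbar -> periodic (F del) 1)
  (bF : forall del x, 0 < del < dbar ->
     [/\ `|F del x| <= M * del ^+ 2, `|F1 del x| <= M * del ^+ 2 & `|F2 del x| <= M * del ^+ 2]).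

Definition perturbed del x : R := T0 x + del * S x + F del x.
Definition perturbed1 del x : R := T01 x + del * S1 x + F1 del x.
Definition perturbed2 del x : R := T02 x + del * S2 x + F2 del x.

(** The perturbation is O(del) in C^2, hence below any given threshold once
[del] is small. *)
Lemma family_lift : exists2 del0 : R, 0 < del0 & del0 <= 1 /\ del0 <= dbar /\
  forall del, 0 < del < del0 -> expanding_lift (perturbed del) (perturbed1 del) (perturbed2 del) d s relaxed_rate relaxed_bound.
Proof.
have [B B0 [_ hB1]] := periodic_C1_bounded nS; have [B' B'0 [_ hB2]] := periodic_C1_bounded nS1.
pose c := Order.min ((al^-1 - 1) / 2) 1.
have c0 : 0 < c by rewrite lt_min ltr01 andbT; have := al_inv_gt1; lra.
pose Q := B + B' + M + 1; have Q0 : 0 < Q by rewrite /Q ltr_wpDl // !addr_ge0.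
pose del0 := Order.min (Order.min 1 dbar) (c / Q).
have d00 : 0 < del0 by rewrite !lt_min ltr01 dbar0 divr_gt0.
have d01 : del0 <= 1 by rewrite !ge_min lexx.
have d0d : del0 <= dbar by rewrite !ge_min lexx orbT.
exists del0 => //; split => //; split => // del /andP[dp dd].
have db : 0 < del < dbar by rewrite dp (lt_le_trans dd).
have dQ : del * Q <= c.
  by rewrite -ler_pdivlMr //; apply: le_trans (ltW dd) _; rewrite ge_min lexx orbT.
have d1 : del <= 1 by apply: le_trans (ltW dd) d01.
have dsq : del ^+ 2 <= del by rewrite expr2 ler_piMr // ltW.
have pert x : `|del * S1 x + F1 del x| <= c /\ `|del * S2 x + F2 del x| <= c.
  have [_ q1 q2] := bF x db.
  have h1 := hB1 x; have h2 := hB2 x.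
  have m1 : M * del ^+ 2 <= M * del by apply: ler_wpM2l.
  have e1 : `|del * S1 x| <= del * B by rewrite normrM gtr0_norm // ler_pM2l.
  have e2 : `|del * S2 x| <= del * B' by rewrite normrM gtr0_norm // ler_pM2l.
  have db1 : 0 <= del * B by rewrite mulr_ge0 // ltW.
  have db2 : 0 <= del * B' by rewrite mulr_ge0 // ltW.
  move: dQ; rewrite /Q !mulrDr mulr1 [del * M]mulrC => dQ.
  by split; apply: le_trans (ler_normD _ _) _; lra.
have hS : has_deriv S S1 by case: nS.
have hS1 : has_deriv S1 S2 by case: nS1.
have cS2 : continuous S2 by case: nS1.
have pS : periodic S 1 by case: nS.
split.
- exact: has_derivD (has_derivD (lift_deriv E0) (has_derivZ del hS)) (hF db).
- exact: has_derivD (has_derivD (lift_deriv2 E0) (has_derivZ del hS1)) (hF1 db).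
- move=> x; apply: cvgD; last exact: cF2.
  by apply: cvgD; [exact: lift_cont2 E0 _|apply: cvgM; [exact: cvg_cst|exact: cS2]].
- by move=> x; rewrite /perturbed (lift_shift E0) pS (pF db); ring.
- exact: lift_sign E0.
- exact: relaxed_rate_gt0.
- exact: relaxed_rate_lt1.
- move=> x; rewrite relaxed_rate_inv /perturbed1 -addrA mulrDr.
  have [h _] := pert x; have hl := lift_exp E0 x.
  have hc : c <= (al^-1 - 1) / 2 by rewrite ge_min lexx.
  have : `|s * (del * S1 x + F1 del x)| <= (al^-1 - 1) / 2.
    by rewrite normrM (lift_sign_norm E0) mul1r; apply: le_trans hc.
  by rewrite ler_norml => /andP[]; lra.
- move=> x; rewrite /perturbed2 -addrA; apply: le_trans (ler_normD _ _) _.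
  rewrite /relaxed_bound; apply: lerD; first exact: lift_bound2 E0 x.
  by have [_ h] := pert x; apply: le_trans h _; rewrite ge_min lexx orbT.
Qed.

Section SmallParameter.
Variable del0 : R.
Hypotheses (d01 : del0 <= 1) (d0d : del0 <= dbar).
Hypothesis EL : forall del, 0 < del < del0 -> expanding_lift (perturbed del) (perturbed1 del) (perturbed2 del) d s relaxed_rate relaxed_bound.

Local Notation u := (fun del => lift_inv (perturbed del)).
Local Notation O := (unif_O del0).

Lemma del_dbar del : 0 < del < del0 -> 0 < del < dbar.
Proof. by move=> /andP[dp dd]; rewrite dp (lt_le_trans dd). Qed.

Lemma O_remainder : [/\ O 2 (fun del y => F del (u del y)), O 2 (fun del y => F1 del (u del y)) &
  O 2 (fun del y => F2 del (u del y))].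
Proof.
by split; exists M => del y /del_dbar db; have [] := bF (u del y) db.
Qed.

Lemma O_pert (g : R -> R) (G : R -> R -> R) (B : R) : (forall x, `|g x| <= B) ->
  O 2 (fun del y => G del (u del y)) ->
  O 1 (fun del y => del * g (u del y) + G del (u del y)).
Proof.
move=> hB hG; apply: unif_OD; last exact: (unif_O_weak d01 (k := 1) (l := 2)).
exact: (unif_OM (k := 1) (l := 0) (unif_O_del del0) (unif_O_fun del0 u hB)).
Qed.

Lemma perturbed_inv_eq del y : 0 < del < del0 ->
  T0 (u del y) + (del * S (u del y) + F del (u del y)) = y.
Proof. by move=> hd; rewrite addrA; exact: lift_invK (EL hd) y. Qed.

(** Expansion of [T0] turns closeness of the images into closeness of the
points. *)
Lemma O_inverse : O 1 (fun del y => u del y - v y).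
Proof.
have [B B0 [hB _]] := periodic_C1_bounded nS; have [ oF _ _] := O_remainder.
have [c hc] := O_pert hB oF; exists (al * c) => del y hd.
have h := lift_expands_norm E0 (u del y) (v y).
rewrite ler_pdivrMl // in h; apply: le_trans h _; rewrite -mulrA ler_pM2l //.
have e : T0 (u del y) - T0 (v y) = - (del * S (u del y) + F del (u del y)).
  by rewrite (lift_invK E0) -{2}(perturbed_inv_eq y hd); ring.
by rewrite e normrN; exact: hc.
Qed.

Let A (del y : R) := perturbed1 del (u del y).
Let b (y : R) := T01 (v y).

Lemma slope_neq0 del y : 0 < del < del0 -> A del y != 0.
Proof. by move=> hd; exact: lift_neq0 (EL hd) _. Qed.

Lemma O_inv_slope_bounded : O 0 (fun del y => (A del y)^-1).
Proof.
exists relaxed_rate => del y hd; rewrite mulr1 normfV (lift_norm1 (EL hd)).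
have h := lift_exp (EL hd) (u del y).
rewrite -[leRHS]invrK lef_pV2 ?posrE ?invr_gt0 ?relaxed_rate_gt0 //.
by apply: lt_le_trans h; rewrite invr_gt0 relaxed_rate_gt0.
Qed.

Lemma slope0_neq0 y : b y != 0. Proof. exact: lift_neq0 E0 _. Qed.

Lemma O_const (g : R -> R) (B : R) : (forall x, `|g x| <= B) -> O 0 (fun _ y => g (v y)).
Proof. by move=> hB; exact: (unif_O_fun del0 (fun _ => v) hB). Qed.

Lemma O_inv_slope0_bounded : O 0 (fun _ y => (b y)^-1).
Proof.
have [[nT _] _] := (periodic_C1_inv_slope, tt); have [B _ [hB _]] := periodic_C1_bounded nT.
exact: (O_const hB).
Qed.

Lemma O_slope : O 1 (fun del y => A del y - b y).
Proof.
have [[hT1 cT2 pT] nT2] := lift_deriv_periodic.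
have [B B0 [hB _]] := periodic_C1_bounded nS1; have [_ oF1 _] := O_remainder.
have h1 := unif_O_lip hT1 (lift_bound2 E0) O_inverse.
apply: unif_O_ext (unif_OD h1 (O_pert hB oF1)) => del y hd.
by rewrite /A /b /perturbed1; ring.
Qed.

Lemma O_inv_slope : O 1 (fun del y => (A del y)^-1 - (b y)^-1).
Proof.
apply: unif_O_ext (unif_ON (unif_O_M0 O_inv_slope_bounded (unif_O_M0 O_inv_slope0_bounded O_slope))) => del y hd.
by have := slope_neq0 y hd; have := slope0_neq0 y; move: (A del y) (b y) => p q p0 q0; field; apply/andP.
Qed.

(** The implicit function theorem by hand: expand
[T0 (u) + del * S (u) + F (u) = T0 (v)] to first order at [v]. *)
Lemma O_branch : O 2 (fun del y => u del y - v y + del * S (v y) / b y).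
Proof.
have [hS cS pS] := nS; have [BS BS0 [_ hBS]] := periodic_C1_bounded nS.
have [ oF _ _] := O_remainder.
have t := unif_O_taylor (lift_deriv E0) (lift_deriv2 E0) (lift_bound2 E0) O_inverse.
have dS := unif_OM (unif_O_del del0) (unif_O_lip hS hBS O_inverse).
have sum := unif_O_M0 O_inv_slope0_bounded (unif_ON (unif_OD (unif_OD t oF) dS)).
apply: unif_O_ext sum => del y hd.
have e := perturbed_inv_eq y hd; have e2 := lift_invK E0 y.
have h : T0 (u del y) - T0 (v y) = - (del * S (u del y) + F del (u del y)).
  by rewrite e2 -{2}e; ring.
rewrite h; have := slope0_neq0 y; rewrite /b; move: (T01 (v y)) => q q0; field => //.
Qed.

Section Density.
Variables (g g1 g2 : R -> R).
Hypotheses (ng : periodic_C1 g g1) (ng1 : periodic_C1 g1 g2).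

Definition quotient x : R := g x * inv_slope x.
Definition quotient1 x : R := g1 x * inv_slope x + g x * inv_slope1 x.
Definition flux1 x : R := quotient1 x * S x + quotient x * S1 x.

Lemma periodic_C1_flux : exists E2, periodic_C1 (fun x => quotient x * S x) flux1 /\ periodic_C1 flux1 E2.
Proof.
have [ni [inv_slope2 ni1]] := periodic_C1_inv_slope.
have nH : periodic_C1 quotient quotient1 := periodic_C1M ng ni.
have nH1 := periodic_C1D (periodic_C1M ng1 ni) (periodic_C1M ng ni1).
have nE1 := periodic_C1D (periodic_C1M nH1 nS) (periodic_C1M nH nS1).
by eexists; split; [exact: periodic_C1M nH nS|exact: nE1].
Qed.

(** The pointwise form of the response formula: the weighted density at the
moving preimage, to first order in [del], changes by minus the derivative of
[g * S / T0'], divided by [T0']. The change of the slope and the displacement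
of the preimage combine into a single derivative. *)
Lemma O_density : O 2 (fun del y => g (u del y) / A del y - g (v y) / b y +
  del * (flux1 (v y) / b y)).
Proof.
have [ni [inv_slope2 ni1]] := periodic_C1_inv_slope.
have nH : periodic_C1 quotient quotient1 := periodic_C1M ng ni.
have nH1 := periodic_C1D (periodic_C1M ng1 ni) (periodic_C1M ng ni1).
have [BH _ [hBH _]] := periodic_C1_bounded nH.
have [BH1 _ [hBH1 hBH2]] := periodic_C1_bounded nH1.
have nG := periodic_C1M nH (periodic_C1M nS1 ni).
have [BG _ [_ hBG]] := periodic_C1_bounded nG.
have [BS1 _ [hBS1 _]] := periodic_C1_bounded nS1.
have [Bi _ [hBi _]] := periodic_C1_bounded ni.
have [_ oF1 _] := O_remainder.
have oH := unif_O_fun del0 u hBH; have oS1 := unif_O_fun del0 u hBS1; have oi := unif_O_fun del0 u hBi.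
(* Expansion of the inverse slope at a fixed point, written with the exact
remainder. *)
have W1 : O 2 (fun del y => quotient (u del y) * (- F1 del (u del y) * (A del y)^-1 +
   (del * (del * S1 (u del y) + F1 del (u del y))) *
     (S1 (u del y) * (inv_slope (u del y) * (A del y)^-1)))).
  apply: unif_O_M0 oH _; apply: unif_OD.
    exact: (unif_OM (k := 2) (l := 0) (unif_ON oF1) O_inv_slope_bounded).
  apply: (unif_OM (k := 2) (l := 0)).
    exact: (unif_OM (k := 1) (l := 1) (unif_O_del del0) (O_pert hBS1 oF1)).
  exact: unif_O_M0 oS1 (unif_O_M0 oi O_inv_slope_bounded).
have [hH _ _] := nH; have [hH1 _ _] := nH1; have [hG _ _] := nG.
have W2 := unif_O_taylor hH hH1 hBH2 O_inverse.
have oH1v := O_const (g := quotient1) hBH1.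
have W3 := unif_O_M0 oH1v O_branch.
have W4 := unif_OM (unif_O_del del0) (unif_O_lip hG hBG O_inverse).
apply: unif_O_ext (unif_OD (unif_OB W1 W4) (unif_OD W2 W3)) => del y hd /=.
have A0 := slope_neq0 y hd; have b0 := slope0_neq0 y; have t0 := lift_neq0 E0 (u del y).
rewrite /flux1; move: (quotient1 (v y)) => h1v; rewrite /quotient /inv_slope.
rewrite /b in b0 *; rewrite /A /perturbed1 in A0 *.
move: (F1 del _) (S1 (lift_inv (perturbed del) y)) (T01 (lift_inv (perturbed del) y)) (T01 (v y)) t0 b0 A0.
by move=> fu su t q t0 q0 A0; field; rewrite ?t0 ?q0 ?A0.
Qed.

End Density.

Lemma O_transported (r r1 : R -> R) : periodic_C1 r r1 ->
  O 1 (fun del y => r (u del y) / A del y - r (v y) / b y).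
Proof.
move=> nr; have [hr _ _] := nr; have [B _ [hB hB1]] := periodic_C1_bounded nr.
by apply: unif_O_closeM (unif_O_lip hr hB1 O_inverse) O_inv_slope (unif_O_fun del0 u hB) O_inv_slope0_bounded.
Qed.

(** Closeness of the weights in C^1 is needed only to bound the derivative of
the residual, as required by [inverse_bound]. *)
Lemma O_inv2 : O 1 (fun del y => inv2 (perturbed del) (perturbed1 del) (perturbed2 del) y - inv2 T0 T01 T02 y) /\
  O 0 (fun del y => inv2 (perturbed del) (perturbed1 del) (perturbed2 del) y).
Proof.
have [_ [hT2 cT3 pT2]] := lift_deriv_periodic; have [_ _ oF2] := O_remainder.
have [B _ [_ hB]] := periodic_C1_bounded nS1.
have o2 : O 1 (fun del y => perturbed2 del (u del y) - T02 (v y)).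
  apply: unif_O_ext (unif_OD (unif_O_lip hT2 b3 O_inverse) (O_pert hB oF2)) => del y hd.
  by rewrite /perturbed2; ring.
have b2 : O 0 (fun del y => perturbed2 del (u del y)).
  by exists relaxed_bound => del y hd; rewrite mulr1; exact: lift_bound2 (EL hd) _.
have i2 := unif_O_closeM O_inv_slope O_inv_slope O_inv_slope_bounded O_inv_slope0_bounded.
have i3 := unif_O_closeM O_inv_slope i2 O_inv_slope_bounded (unif_O_M0 O_inv_slope0_bounded O_inv_slope0_bounded).
have bi3 := unif_O_M0 O_inv_slope0_bounded (unif_O_M0 O_inv_slope0_bounded O_inv_slope0_bounded).
split.
- apply: unif_O_ext (unif_ON (unif_O_closeM o2 i3 b2 bi3)) => del y hd.
  by rewrite /inv2 /inv1 -/(A del y) -/(b y); ring.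
- apply: unif_O_ext (unif_ON (unif_O_M0 b2 (unif_O_M0 O_inv_slope_bounded (unif_O_M0 O_inv_slope_bounded O_inv_slope_bounded)))) => del y hd.
  by rewrite /inv2 /inv1 -/(A del y); ring.
Qed.

Lemma O_inv2_0 : O 0 (fun _ y => inv2 T0 T01 T02 y).
Proof.
have [h1 h2] := O_inv2; apply: unif_O_ext (unif_OB h2 (unif_O_weak d01 (leq0n 1) h1)) => del y hd; ring.
Qed.

Lemma O_sign k w : O k w -> O k (fun del y => s * w del y).
Proof.
have os : O 0 (fun _ _ => s) by exists 1 => del y _; rewrite mulr1 (lift_sign_norm E0).
by move=> hw; exact: unif_O_M0 os hw.
Qed.

Local Notation Lt := (fun del => Lop D s (lift_inv (perturbed del)) (inv1 (perturbed del) (perturbed1 del))).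
Local Notation Lt1 := (fun del => Lop1 D s (lift_inv (perturbed del)) (inv1 (perturbed del) (perturbed1 del))
  (inv2 (perturbed del) (perturbed1 del) (perturbed2 del))).
Local Notation L01 := (Lop1 D s v (inv1 T0 T01) (inv2 T0 T01 T02)).

Lemma O_Lop1 (r r1 : R -> R) : periodic_C1 r r1 ->
  (O 0 (fun del y => Lt1 del r r1 y) /\ O 0 (fun _ y => L01 r r1 y)) /\
  (forall r2, periodic_C1 r1 r2 -> O 1 (fun del y => Lt1 del r r1 y - L01 r r1 y)).
Proof.
move=> nr; have [hr _ _] := nr; have [Br _ [hBr hBr1]] := periodic_C1_bounded nr.
have oR := unif_O_fun del0 u hBr; have or1 := unif_O_fun del0 u hBr1.
have orv := O_const hBr; have or1v := O_const hBr1.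
have [ o2 b2] := O_inv2; have b20 := O_inv2_0.
split; first split.
- have t := unif_OD (unif_O_M0 (O_sign b2) oR) (unif_O_M0 (O_sign O_inv_slope_bounded) (unif_O_M0 or1 O_inv_slope_bounded)).
  exact: (unif_O_sum D t).
- have t := unif_OD (unif_O_M0 (O_sign b20) orv) (unif_O_M0 (O_sign O_inv_slope0_bounded) (unif_O_M0 or1v O_inv_slope0_bounded)).
  exact: (unif_O_sum D t).
move=> r2 nr1; have [hr1 _ _] := nr1; have [Br2 _ [_ hBr2]] := periodic_C1_bounded nr1.
have lr := unif_O_lip hr hBr1 O_inverse; have lr1 := unif_O_lip hr1 hBr2 O_inverse.
have t := O_sign (unif_OD (unif_O_closeM o2 lr b2 orv)
  (unif_O_closeM O_inv_slope (unif_O_closeM lr1 O_inv_slope or1 O_inv_slope0_bounded) O_inv_slope_bounded (unif_O_M0 or1v O_inv_slope0_bounded))).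
apply: unif_O_ext (unif_O_sum D t) => del y hd.
rewrite /Lop1 -sumrB; apply: eq_bigr => j _.
by rewrite -/(A del (y + j%:R)) /inv1 -/(A del (y + j%:R)) -/(b (y + j%:R)); ring.
Qed.

(** The residual of the response equation for the perturbed operator [Lt]: by
[O_density] the first two terms cancel up to O(del), and [Lt r] is close to
[L0 r]. *)
Lemma O_residual (g g1 g2 r r1 : R -> R) : periodic_C1 g g1 -> periodic_C1 g1 g2 -> periodic_C1 r r1 ->
  O 1 (fun del y => (Lt del g y - L0 g y) / del + L0 (flux1 g g1) y + (Lt del r y - L0 r y)).
Proof.
move=> ng ng1 nr.
have t := O_sign (unif_OD (unif_O_div (O_density ng ng1)) (O_transported nr)).
apply: unif_O_ext (unif_O_sum D t) => del y hd; have /andP[dp _] := hd.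
rewrite /Lop -!sumrB mulr_suml -!big_split /=; apply: eq_bigr => j _.
rewrite /inv1 -/(A del (y + j%:R)) -/(b (y + j%:R)).
have d_neq0 : del != 0 by rewrite gt_eqF.
have A0 := slope_neq0 (y + j%:R) hd; have b0 := slope0_neq0 (y + j%:R).
move: (A del _) (b _) (g _) (g _) (flux1 _ _ _) (r _) (r _) A0 b0 => p q w1 w2 w3 w4 w5 p0 q0.
by field; rewrite ?p0 ?q0 ?d_neq0.
Qed.

End SmallParameter.

(** The difference [e] between the quotient [(f_del - f0) / del] and the
candidate response satisfies [e - Lt e = residual], where the residual is
O(del) in the sup norm and bounded in C^1 uniformly. The spectral gap is
uniform along the family, so [inverse_bound] makes [e] uniformly small. *)
Lemma response_limit (f01 f02 E2 : R -> R) : periodic_C1 f0 f01 -> periodic_C1 f01 f02 ->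
  periodic_C1 (fun x => quotient f0 x * S x) (flux1 f0 f01) -> periodic_C1 (flux1 f0 f01) E2 ->
  forall eps : R, 0 < eps -> exists2 del1 : R, 0 < del1 & forall del, 0 < del < del1 ->
  del < dbar /\ forall x,
  `|(acip (perturbed del) x - f0 x) / del - response (flux1 f0 f01) x| <= eps.
Proof.
move=> nf nf1 nEE nE1 eps eps0.
have [del0 d00 [d01 [d0d EL]]] := family_lift.
set q := source (flux1 f0 f01); set r := response (flux1 f0 f01).
have [hq zq] := source_spec nEE nE1; rewrite -/q in hq zq.
have [[[r1 hr cr1] [pr Ir]] er] := neumann_spec relaxed_lift cone_slope_gt0 cone_slope_K zq.
rewrite -/(response (flux1 f0 f01)) -/r in hr pr Ir er.
have nr : periodic_C1 r r1 by [].
have [[f0' hf0' _] pf If _ Lf] := invariant_spec relaxed_lift cone_slope_gt0 cone_slope_K.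
have [hf cf1 _] := nf.
have [c hc] := O_residual d01 d0d EL nf nf1 nr.
have [_ LF] := O_Lop1 d01 d0d EL nf; have LF1 := LF _ nf1.
have [[ oLr oL0r] _] := O_Lop1 d01 d0d EL nr.
have [[_ oL0E] _] := O_Lop1 d01 d0d EL nE1.
have [B1 hB1] := unif_OD (unif_OD (unif_O_div LF1) oL0E) (unif_OB oLr oL0r).
have c0 : 0 <= c.
  have hd : 0 < del0 / 2 < del0 by apply/andP; split; lra.
  have /andP[hd1 _] := hd.
  by have := le_trans (normr_ge0 _) (hc _ 0 hd); rewrite expr1 pmulr_lge0.
have B0 : 0 <= B1.
  have hd : 0 < del0 / 2 < del0 by apply/andP; split; lra.
  by have := le_trans (normr_ge0 _) (hB1 _ 0 hd); rewrite expr0 mulr1.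
pose a := cone_slope; have a0 : 0 < a := cone_slope_gt0.
pose m := c + B1 / a + 1.
have Ba : 0 <= B1 / a by rewrite divr_ge0 // ltW.
have m0 : 0 < m by rewrite /m; lra.
pose th := 1 - kappa relaxed_rate a.
have /andP[th0 th1] : 0 <= th < 1 := theta_bound IB0 a0.
(* First choose the number of terms of the Neumann series, then [del] small
depending on it. *)
have [N hN] : exists N, m * expR a * th ^+ N / (1 - th) <= eps / 2.
  have lim : (fun n => m * expR a * th ^+ n / (1 - th)) @ \oo --> m * expR a * 0 / (1 - th).
    apply: cvgM; last exact: cvg_cst.
    by apply: cvgM; [exact: cvg_cst|apply: cvg_expr; rewrite ger0_norm].
  rewrite mulr0 mul0r in lim; move/cvgrPdist_le : lim => /(_ (eps / 2)) [].
    by lra.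
  move=> N _ /(_ N (leqnn N)) /=; rewrite sub0r normrN => h; exists N.
  exact: le_trans (ler_norm _) h.
pose Q := N%:R * (expR a * c) + 1.
have Q0 : 0 < Q.
  by rewrite /Q ltr_wpDl // mulr_ge0 // mulr_ge0 // expR_ge0.
exists (Order.min del0 (eps / 2 / Q)); first by rewrite lt_min d00 divr_gt0 // divr_gt0.
move=> del /andP[dp]; rewrite lt_min => /andP[dd dQ].
have hd : 0 < del < del0 by rewrite dp.
split; first exact: lt_le_trans dd d0d.
have Ed := EL _ hd; have IBd := inv_branch Ed.
rewrite (acipE Ed cone_slope_gt0 cone_slope_K).
set fd := invariant (perturbed del) (perturbed1 del) d s.
have [[fd1 hfd cfd1] pfd Ifd _ Lfd] := invariant_spec Ed cone_slope_gt0 cone_slope_K.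
rewrite -/fd in hfd pfd Ifd Lfd.
pose Ld := Lop D s (lift_inv (perturbed del)) (inv1 (perturbed del) (perturbed1 del)).
pose e x := (fd x - f0 x) / del - r x.
pose e1 x := (fd1 x - f01 x) / del - r1 x.
have he : has_deriv e e1.
  apply: has_deriv_ext (has_derivB (has_derivZ del^-1 (has_derivB hfd hf)) hr) _ _ => x.
    by rewrite /e mulrC.
  by rewrite /e1 mulrC.
have ce1 : continuous e1.
  move=> x; apply: cvgB; last exact: cr1.
  by apply: cvgM; [apply: cvgB; [exact: cfd1|exact: cf1]|exact: cvg_cst].
have pe : periodic e 1 by move=> x; rewrite /e pfd pf pr.
have cfd := has_deriv_continuous hfd; have cf := has_deriv_continuous hf.
have cr := has_deriv_continuous hr.
have Ie : circle_integral e = 0.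
  have iff : circle_integrable (fun x => fd x - f0 x).
    by apply: circle_integrableB; exact: continuous_integrable.
  have -> : circle_integral e = circle_integral (fun x => del^-1 * (fd x - f0 x) - r x).
    by apply: circle_integral_eq => x _; rewrite /e mulrC.
  rewrite circle_integralB; [|exact: circle_integrableZ|exact: continuous_integrable].
  rewrite circle_integralZ // circle_integralB; try exact: continuous_integrable.
  by rewrite Ifd If Ir subrr mulr0 subrr.
(* The fixed point equations of [fd] and [f0] and the equation of [r] turn
[e - Ld e] into the residual. *)
have pE x : e x - Ld e x =
    (Ld f0 x - L0 f0 x) / del + L0 (flux1 f0 f01) x + (Ld r x - L0 r x).
  have -> : Ld e x = (Ld fd x - Ld f0 x) / del - Ld r x.
    have -> : e = fun y => del^-1 * (fd y - f0 y) - r y.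
      by apply/funext => y; rewrite /e mulrC.
    by rewrite /Ld LopB LopZ LopB mulrC.
  rewrite /Ld Lfd Lf /e.
  have -> : L0 (flux1 f0 f01) x = L0 r x - r x by have := er x; rewrite /q /source; lra.
  by field; rewrite gt_eqF.
pose Ld1 := Lop1 D s (lift_inv (perturbed del)) (inv1 (perturbed del) (perturbed1 del)) (inv2 (perturbed del) (perturbed1 del) (perturbed2 del)).
pose L01 := Lop1 D s v (inv1 T0 T01) (inv2 T0 T01 T02).
pose p1 x := (Ld1 f0 f01 x - L01 f0 f01 x) / del + L01 (flux1 f0 f01) E2 x + (Ld1 r r1 x - L01 r r1 x).
have hp : has_deriv (fun x => e x - Ld e x) p1.
  have hLf := has_derivB (has_deriv_Lop IBd hf) (has_deriv_Lop IB0 hf).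
  have hLr := has_derivB (has_deriv_Lop IBd hr) (has_deriv_Lop IB0 hr).
  have hLE : has_deriv (L0 (flux1 f0 f01)) (L01 (flux1 f0 f01) E2).
    by apply: (has_deriv_Lop IB0); case: nE1.
  apply: has_deriv_ext (has_derivD (has_derivD (has_derivZ del^-1 hLf) hLE) hLr) _ _ => x.
    by rewrite pE mulrC.
  by rewrite /p1 mulrC.
have cp1 : continuous p1.
  have cE1 : continuous (flux1 f0 f01) by case: nE1 => /has_deriv_continuous.
  have cE2 : continuous E2 by case: nE1.
  have k1 := Lop1_continuous IBd cf cf1; have k2 := Lop1_continuous IB0 cf cf1.
  have k3 := Lop1_continuous IBd cr cr1; have k4 := Lop1_continuous IB0 cr cr1.
  have k5 := Lop1_continuous IB0 cE1 cE2.
  move=> x; apply: cvgD; last by apply: cvgB; [exact: k3|exact: k4].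
  apply: cvgD; last exact: k5.
  by apply: cvgM; [apply: cvgB; [exact: k1|exact: k2]|exact: cvg_cst].
have bp x : `|e x - Ld e x| <= c * del by rewrite pE; have := hc del x hd; rewrite expr1.
have d1 : del <= 1 by apply: le_trans (ltW dd) d01.
have bp' x : `|e x - Ld e x| <= c by apply: le_trans (bp x) _; rewrite ler_piMr.
have cm : c <= m by rewrite /m; lra.
have bp1 x : `|p1 x| <= a * (m - c).
  have -> : a * (m - c) = B1 + a.
    by rewrite /m; field; rewrite gt_eqF.
  by have := hB1 del x hd; rewrite expr0 mulr1 => h; apply: le_trans h _; rewrite lerDl ltW.
move=> x; have := inverse_bound IBd a0 cone_slope_K N he ce1 pe Ie hp cp1 bp m0 bp' cm bp1 x.
move=> h; apply: le_trans h _.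
have h1 : N%:R * (expR a * (c * del)) <= eps / 2.
  have -> : N%:R * (expR a * (c * del)) = (N%:R * (expR a * c)) * del by ring.
  apply: le_trans (_ : Q * del <= _); first by rewrite ler_pM2r // /Q lerDl.
  by rewrite mulrC -ler_pdivlMr // ltW.
by rewrite [leRHS]splitr; exact: lerD.
Qed.

End Family.
End Response.


(** * Maps of the circle, their lifts and their perturbations *)

Section LiftOfMap.
Variable R : realType.
Implicit Types (T f : R -> R) (x y : R).

(** A change of sign would produce a zero, by the intermediate value
theorem. *)
Lemma nonvanishing_sign f : continuous f -> (forall x, f x != 0) ->
  exists s : R, (s = 1 \/ s = -1) /\ forall x, `|f x| = s * f x.
Proof.
move=> cf f0.
have pos (g : R -> R) : continuous g -> (forall x, g x != 0) -> 0 < g 0 -> forall x, 0 < g x.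
  move=> cg g0 gp x; rewrite ltNge; apply/negP => gx.
  have iv (a b : R) : a <= b -> Order.min (g a) (g b) <= 0 <= Order.max (g a) (g b) -> False.
    move=> ab h; have [z _ /eqP] := IVT ab (continuous_subspaceT cg) h.
    by rewrite (negPf (g0 z)).
  by case: (leP 0 x) => [x0|/ltW x0]; apply: (iv _ _ x0);
    rewrite ge_min le_max gx (ltW gp) ?orbT.
have [p|n] := ltrP 0 (f 0).
  by exists 1; split; [left|move=> x; rewrite mul1r gtr0_norm //; exact: pos].
exists (-1); split; [by right|move=> x]; rewrite mulN1r ltr0_norm // -oppr_gt0.
apply: (pos (fun y => - f y)) => //.
- by move=> y; apply: cvgN; exact: cf.
- by move=> y; rewrite oppr_eq0.
- by rewrite oppr_gt0 lt_neqAle n f0.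
Qed.

Lemma expanding_lift_of T : circle_map T -> class_C 3 T -> expanding T ->
  exists d s al C, expanding_lift T (derive1n 1 T) (derive1n 2 T) d s al C /\
  exists C3, forall x, `|derive1n 3 T x| <= C3.
Proof.
move=> [d hd] cT [al [/andP[al0 al1] hal]].
have h0 : has_deriv T (derive1n 1 T) := class_C_deriv cT (isT : (0 < 3)%N).
have h1 : has_deriv (derive1n 1 T) (derive1n 2 T) := class_C_deriv cT (isT : (1 < 3)%N).
have h2 : has_deriv (derive1n 2 T) (derive1n 3 T) := class_C_deriv cT (isT : (2 < 3)%N).
have p1 := circle_map_deriv_periodic h0 hd.
have p2 := has_deriv_periodic h1 p1; have p3 := has_deriv_periodic h2 p2.
have c1 := has_deriv_continuous h1; have c2 := has_deriv_continuous h2.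
have c3 : continuous (derive1n 3 T) := class_C_continuous cT (leqnn 3).
have [C _ hC] := periodic_bounded c2 p2.
have [C3 _ hC3] := periodic_bounded c3 p3.
have n0 x : derive1n 1 T x != 0.
  by rewrite -normr_gt0; apply: lt_le_trans (hal x); rewrite invr_gt0.
have [s [hs es]] := nonvanishing_sign c1 n0.
exists d, s, al, C; split; last by exists C3.
by split => //; move=> x; rewrite -es; exact: hal.
Qed.

Lemma class_C_le (k l : nat) f : (k <= l)%N -> class_C l f -> class_C k f.
Proof.
move=> kl cf; split; last exact: (class_C_continuous cf).
by move=> j x jk; case: cf => + _; apply; exact: leq_trans jk kl.
Qed.

(** The suprema in the norm are over bounded sets, by periodicity. *)
Lemma C3norm_ge f j x : class_C 3 f -> periodic f 1 -> (j < 4)%N ->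
  `|derive1n j f x| <= C3norm f.
Proof.
move=> cf pf j4.
have sub i : (i < 4)%N -> has_sup (range (fun x => `|derive1n i f x|)).
  move=> i4; split; first by exists `|derive1n i f 0|, 0.
  have [B _ hB] := periodic_bounded (class_C_continuous cf (i4 : (i <= 3)%N))
    (class_C_periodic cf pf i4).
  by exists B => _ [y _ <-].
have h i y (i4 : (i < 4)%N) : `|derive1n i f y| <= sup (range (fun x => `|derive1n i f x|)).
  by apply: sup_upper_bound; [exact: sub|exists y].
apply: le_trans (h j x j4) _; rewrite /C3norm (bigD1 (Ordinal j4)) //= lerDl.
by apply: sumr_ge0 => i _; apply: le_trans (h i 0 (ltn_ord i)).
Qed.

(** This holds whether or not a density exists, by the default value. *)
Lemma acip_continuous T : continuous (acip T).
Proof.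
rewrite /acip; case: xgetP => [f -> [[cf _ _] _]|_]; first exact: cf.
by move=> x; exact: cvg_cst.
Qed.

Lemma C3norm0 : C3norm (fun _ : R => 0 : R) = 0.
Proof.
rewrite /C3norm big1 // => j _.
have -> : derive1n j (fun _ : R => 0 : R) = fun=> 0.
  apply: (@tower_derive1n R (fun _ _ => 0) j (fun i _ => has_deriv_cst 0) j (leqnn j)).
have -> : range (fun _ : R => `|0 : R|) = [set (0 : R)] :> set R.
  by apply/seteqP; split => [_ [y _ <-]|_ ->]; rewrite ?normr0 //; exists 0; rewrite ?normr0.
exact: sup1.
Qed.

Lemma class_C_cst0 k : class_C k (fun _ : R => 0 : R).
Proof.
apply: (@tower_class_C R (fun _ _ => 0) k (fun i _ => has_deriv_cst 0)) => x.
exact: cvg_cst.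
Qed.

Lemma class_C_lin k f g (a b : R) : class_C k f -> class_C k g ->
  class_C k (fun x => a * f x + b * g x) /\
  forall j, (j <= k)%N ->
    derive1n j (fun x => a * f x + b * g x) = fun x => a * derive1n j f x + b * derive1n j g x.
Proof.
move=> cf cg; pose F j x := a * derive1n j f x + b * derive1n j g x.
have hF j : (j < k)%N -> has_deriv (F j) (F j.+1).
  by move=> jk; exact: has_derivD (has_derivZ a (class_C_deriv cf jk)) (has_derivZ b (class_C_deriv cg jk)).
split; last exact: (tower_derive1n hF).
apply: (tower_class_C hF) => x; apply: cvgD; apply: cvgM; try exact: cvg_cst.
  exact: (class_C_continuous cf).
exact: (class_C_continuous cg).
Qed.

Lemma class_C_periodic_C1 k f j : class_C k f -> periodic f 1 -> (j < k)%N ->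
  periodic_C1 (derive1n j f) (derive1n j.+1 f).
Proof.
move=> cf pf jk; split; first exact: class_C_deriv cf jk.
  exact: (class_C_continuous cf).
exact: (@class_C_periodic _ _ _ cf pf j (ltnW jk)).
Qed.

End LiftOfMap.


Lemma circle_integral_lin (R : realType) (p q : R) (u v : R -> R) :
  circle_integrable u -> circle_integrable v ->
  circle_integral (fun x => p * u x + q * v x) = p * circle_integral u + q * circle_integral v.
Proof.
move=> iu iv; have e := circle_integralD (circle_integrableZ p iu) (circle_integrableZ q iv).
by apply: (etrans e); congr (_ + _); exact: circle_integralZ.
Qed.

Lemma circle_integral_lin0 (R : realType) (p q : R) (u v : R -> R) :
  circle_integrable u -> circle_integrable v -> circle_integral u = 0 -> circle_integral v = 0 ->
  circle_integral (fun x => p * u x + q * v x) = 0.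
Proof.
by move=> iu iv Iu Iv; rewrite (circle_integral_lin p q iu iv) Iu Iv !mulr0 addr0.
Qed.

(** * The response as a bounded linear operator *)

Section ResponseOperator.
Variable R : realType.
Implicit Types (x y : R) (S : R -> R).
Variables (T0 T01 T02 T03 : R -> R) (d : int) (s al C C3 : R).
Hypothesis E0 : expanding_lift T0 T01 T02 d s al C.
Hypotheses (h3 : has_deriv T02 T03) (c3 : continuous T03) (b3 : forall x, `|T03 x| <= C3).
Local Notation f0 := (invariant T0 T01 d s).
Variables (f01 f02 : R -> R).
Hypotheses (nf : periodic_C1 f0 f01) (nf1 : periodic_C1 f01 f02).
Local Notation L0 := (Lop `|d|%N s (lift_inv T0) (inv1 T0 T01)).
Let IB0 := inv_branch (relaxed_lift E0).
Let a0 := cone_slope_gt0 E0.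
Let aK := cone_slope_K E0.

Lemma Lop_lin (p q : R) (u v : R -> R) x :
  L0 (fun y => p * u y + q * v y) x = p * L0 u x + q * L0 v x.
Proof. by rewrite LopD !LopZ. Qed.

(** The derivative of [f0 * S / T0']. *)
Definition flux_deriv S : R -> R := flux1 T01 T02 S (derive1n 1 S) f0 f01.
(** The response to the direction [S], as
[- (I - L0)^-1 L0 ((f0 * S / T0')')]. *)
Definition direction_response S : R -> R := response T0 T01 d s (flux_deriv S).

Section Direction.
Variable S : R -> R.
Hypotheses (cS : class_C 2 S) (pS : periodic S 1).

Lemma direction_C1 : periodic_C1 S (derive1n 1 S) /\ periodic_C1 (derive1n 1 S) (derive1n 2 S).
Proof. by split; [exact: (class_C_periodic_C1 (j := 0) cS pS)|exact: (class_C_periodic_C1 (j := 1) cS pS)]. Qed.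

Lemma direction_response_spec : C1_zero_mean (direction_response S) /\
  forall x, direction_response S x - L0 (direction_response S) x = - L0 (flux_deriv S) x.
Proof.
have [n1 n2] := direction_C1.
have [E2 [nEE nE1]] := periodic_C1_flux E0 h3 c3 n1 n2 nf nf1.
have [_ zq] := source_spec E0 nEE nE1.
have [z e] := neumann_spec (relaxed_lift E0) a0 aK zq; split; [exact: z|exact: e].
Qed.

Lemma direction_response_continuous : continuous (direction_response S).
Proof. by have [[[r1 hr _] _] _] := direction_response_spec; exact: has_deriv_continuous hr. Qed.

Lemma direction_response_periodic : periodic (direction_response S) 1.
Proof. by have [[_ [pr _]] _] := direction_response_spec. Qed.

End Direction.

(** Linearity follows from uniqueness of zero-mean solutions, rather than from
the series. *)
Lemma direction_response_lin S S' (p q : R) : class_C 2 S -> periodic S 1 -> class_C 2 S' -> periodic S' 1 ->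
  direction_response (fun x => p * S x + q * S' x) = fun x => p * direction_response S x + q * direction_response S' x.
Proof.
move=> cS pS cS' pS'; have [cL dL] := class_C_lin p q cS cS'.
have pL : periodic (fun x => p * S x + q * S' x) 1 by move=> x; rewrite pS pS'.
have [[[r1 hr _] [pr Ir]] er] := direction_response_spec cL pL.
have [[[u1 hu _] [pu Iu]] eu] := direction_response_spec cS pS.
have [[[v1 hv _] [pv Iv]] ev] := direction_response_spec cS' pS'.
have cu := has_deriv_continuous hu; have cv := has_deriv_continuous hv.
have clin : continuous (fun x => p * direction_response S x + q * direction_response S' x).
  by move=> x; apply: cvgD; apply: cvgM; [exact: cvg_cst|exact: cu|exact: cvg_cst|exact: cv].
apply: (resolvent_unique (relaxed_lift E0) a0 aK (has_deriv_continuous hr) pr Ir clin).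
- by move=> x; rewrite pu pv.
- have iu := continuous_integrable cu; have iv := continuous_integrable cv.
  exact: (circle_integral_lin0 p q iu iv Iu Iv).
- move=> x; rewrite er (Lop_lin p q (direction_response S) (direction_response S')).
  have -> : flux_deriv (fun x => p * S x + q * S' x) =
      fun y => p * flux_deriv S y + q * flux_deriv S' y.
    by apply/funext => y; rewrite /flux_deriv /flux1 dL //; ring.
  rewrite Lop_lin.
  have alg (u w z u' w' z' : R) : u - w = - z -> u' - w' = - z' ->
      - (p * z + q * z') = p * u + q * u' - (p * w + q * w').
    by move=> e e'; rewrite opprD -!mulrN -e -e'; ring.
  exact: alg (eu x) (ev x).
Qed.

(** The response is controlled by the C^2 norm of the direction: two
derivatives of [S] are needed to bound the source in C^1, as in [decay1]. *)
Lemma direction_response_bound : exists2 K : R, 0 <= K & forall S (t : R), class_C 2 S -> periodic S 1 ->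
  (forall x, [/\ `|S x| <= t, `|derive1n 1 S x| <= t & `|derive1n 2 S x| <= t]) ->
  forall x, `|direction_response S x| <= K * t.
Proof.
have [ni [inv_slope2 ni1]] := periodic_C1_inv_slope E0 h3 c3.
have nH : periodic_C1 (quotient T01 f0) (quotient1 T01 T02 f0 f01) := periodic_C1M nf ni.
have [H2 nH1] : exists H2, periodic_C1 (quotient1 T01 T02 f0 f01) H2.
  by eexists; exact: periodic_C1D (periodic_C1M nf1 ni) (periodic_C1M nf ni1).
have [B B0 [bH _]] := periodic_C1_bounded nH; have [B1 B10 [bH1 bH2]] := periodic_C1_bounded nH1.
have ps1 : 0 <= relaxed_rate al by exact: ltW (relaxed_rate_gt0 E0).
pose K0 := relaxed_bound C * relaxed_rate al ^+ 2.
have K00 : 0 <= K0.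
  by rewrite mulr_ge0 ?sqr_ge0 // /relaxed_bound addr_ge0 // (bound2_ge0 E0).
have p1 x : `|s * inv1 T0 T01 x| <= relaxed_rate al.
  by rewrite gtr0_norm; [exact: (branch_contr IB0)|exact: (branch_gt0 IB0)].
have sn := lift_sign_norm E0.
have p1' x : `|inv1 T0 T01 x| <= relaxed_rate al by have := p1 x; rewrite normrM sn mul1r.
have p2 x : `|s * inv2 T0 T01 T02 x| <= K0 * relaxed_rate al.
  rewrite normrM sn mul1r; apply: le_trans (branch_dist IB0 x) _.
  by apply: ler_wpM2l => //; apply: le_trans (ler_norm _) (p1 x).
pose D : R := `|d|%N%:R.
pose k1 := B1 + B; pose k2 := B1 + B1 + B1 + B.
pose Q := D * (relaxed_rate al * k1).
pose Q1 := D * (K0 * relaxed_rate al * k1 + relaxed_rate al * (k2 * relaxed_rate al)).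
have k10 : 0 <= k1 by rewrite addr_ge0.
have k20 : 0 <= k2 by rewrite !addr_ge0.
have D0 : 0 <= D := ler0n _ _.
have Q0 : 0 <= Q := mulr_ge0 D0 (mulr_ge0 ps1 k10).
have Q10 : 0 <= Q1.
  exact: (mulr_ge0 D0 (addr_ge0 (mulr_ge0 (mulr_ge0 K00 ps1) k10) (mulr_ge0 ps1 (mulr_ge0 k20 ps1)))).
pose a := cone_slope al C; have ap : 0 < a := a0.
pose c := Q + Q1 / a + 1.
have c0 : 0 < c.
  by rewrite /c ltr_wpDl // addr_ge0 // divr_ge0 // ltW.
have th := theta_bound IB0 ap.
have th0 : 0 < 1 - (1 - kappa (relaxed_rate al) a) by have /andP[_] := th; rewrite subr_gt0.
pose K := c * expR a / (1 - (1 - kappa (relaxed_rate al) a)).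
exists K; first by rewrite divr_ge0 ?(ltW th0) // mulr_ge0 ?expR_ge0 ?(ltW c0).
move=> S t cS pS bS x.
have [n1 n2] := direction_C1 cS pS.
have nEE : periodic_C1 (fun y => quotient T01 f0 y * S y) (flux_deriv S) := periodic_C1M nH n1.
have nE := periodic_C1D (periodic_C1M nH1 n1) (periodic_C1M nH n2).
have [hq zq] := source_spec E0 nEE nE.
set E2 := (fun y => _ + _ + _) in nE hq.
have t0 : 0 <= t by have [h _ _] := bS 0; exact: le_trans h.
have ub (u v M : R) : `|u| <= M -> `|v| <= t -> `|u * v| <= M * t.
  by move=> h1 h2; rewrite normrM; exact: ler_pM.
have bE y : `|flux_deriv S y| <= k1 * t.
  rewrite /flux_deriv /flux1 /k1 [_ * t]mulrDl; have [s0 s1 s2] := bS y.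
  by apply: le_trans (ler_normD _ _) _; apply: lerD; exact: ub.
have bE2 y : `|E2 y| <= k2 * t.
  have [s0 s1 s2] := bS y.
  have e : k2 * t = (B1 * t + B1 * t) + (B1 * t + B * t) by rewrite /k2; ring.
  rewrite e; apply: le_trans (ler_normD _ _) (lerD _ _).
    by apply: le_trans (ler_normD _ _) (lerD _ _); exact: ub.
  by apply: le_trans (ler_normD _ _) (lerD _ _); exact: ub.
have sumD (u : nat -> R) M : (forall j, `|u j| <= M) -> `|\sum_(j < `|d|%N) u j| <= D * M.
  move=> hu; apply: le_trans (ler_norm_sum _ _ _) _.
  apply: le_trans (ler_sum _ (fun (j : 'I_`|d|%N) _ => hu j)) _.
  by rewrite sumr_const card_ord mulr_natl.
have bq y : `|source T0 T01 d s (flux_deriv S) y| <= Q * t.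
  rewrite /source normrN /Q -mulrA.
  apply: (sumD (fun j => s * inv1 T0 T01 (y + j%:R) * flux_deriv S (lift_inv T0 (y + j%:R)))).
  by move=> j; rewrite normrM -mulrA; apply: ler_pM.
have bq1 y : `|- Lop1 `|d| s (lift_inv T0) (inv1 T0 T01) (inv2 T0 T01 T02) (flux_deriv S) E2 y|
    <= Q1 * t.
  rewrite normrN /Q1 -mulrA /Lop1.
  apply: (sumD (fun j => s * inv2 T0 T01 T02 (y + j%:R) * flux_deriv S (lift_inv T0 (y + j%:R)) +
    s * inv1 T0 T01 (y + j%:R) * (E2 (lift_inv T0 (y + j%:R)) * inv1 T0 T01 (y + j%:R)))).
  move=> j; rewrite [leRHS]mulrDl; apply: le_trans (ler_normD _ _) _; apply: lerD.
    by rewrite normrM -mulrA; apply: ler_pM.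
  rewrite normrM -[_ * t]mulrA; apply: ler_pM => //; rewrite normrM mulrAC; exact: ler_pM.
have [[q1 hq' cq1] [pq Iq]] := zq.
have eq1 := has_deriv_uniq hq' hq; rewrite eq1 in cq1.
(* The resolvent bound asks for a positive scale [m], hence for an enlargement
of [t], which may be zero. *)
apply/ler_addgt0Pr => eps eps0.
have K1 : 0 < K + 1.
  by rewrite ltr_wpDl // divr_ge0 ?(ltW th0) // mulr_ge0 ?expR_ge0 ?(ltW c0).
pose t' := t + eps / (K + 1).
have t'0 : 0 < t' by rewrite ltr_wpDl // divr_gt0.
have tt' : t <= t' by rewrite lerDl ltW // divr_gt0.
have mm : 0 < c * t' by rewrite mulr_gt0.
have Am : Q * t' <= c * t'.
  rewrite ler_pM2r // /c -addrA lerDl addr_ge0 // divr_ge0 // ltW //.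
have bb y : `|- Lop1 `|d| s (lift_inv T0) (inv1 T0 T01) (inv2 T0 T01 T02) (flux_deriv S) E2 y|
    <= a * (c * t' - Q * t').
  apply: le_trans (bq1 y) _.
  have -> : a * (c * t' - Q * t') = (Q1 + a) * t'.
    by rewrite /c; field; rewrite gt_eqF.
  apply: ler_pM => //; first by rewrite lerDl ltW.
have bq' y : `|source T0 T01 d s (flux_deriv S) y| <= Q * t'.
  by apply: le_trans (bq y) _; exact: ler_wpM2l.
have [_ _ _ _ h] := resolvent1 IB0 ap aK hq cq1 pq Iq mm bq' Am bb.
apply: le_trans (h x) _.
have -> : c * t' * expR a / (1 - (1 - kappa (relaxed_rate al) a)) = K * t' by rewrite /K; ring.
rewrite /t' mulrDr lerD2l mulrCA ler_piMr ?(ltW eps0) // ler_pdivrMr // mul1r lerDl.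
by [].
Qed.

End ResponseOperator.


(** * Identification of the linear response *)

Section ResponseIsLimit.
Variable R : realType.
Implicit Types (x y : R) (S : R -> R).
Variables (T0 T01 T02 T03 : R -> R) (d : int) (s al C C3 : R).
Hypothesis E0 : expanding_lift T0 T01 T02 d s al C.
Hypotheses (h3 : has_deriv T02 T03) (c3 : continuous T03) (b3 : forall x, `|T03 x| <= C3).
Local Notation f0 := (invariant T0 T01 d s).
Variables (f01 f02 : R -> R).
Hypotheses (nf : periodic_C1 f0 f01) (nf1 : periodic_C1 f01 f02).
Local Notation direction_response := (direction_response T0 T01 T02 d s f01).

Lemma uniform_cvg_L1 (u : R -> R -> R) :
  (forall del, 0 < del -> continuous (u del)) ->
  (forall eps : R, 0 < eps -> exists2 del1 : R, 0 < del1 &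
     forall del, 0 < del < del1 -> forall x, `|u del x| <= eps) ->
  (\int[lebesgue_measure]_(x in `[0%R, 1%R]) (`|u del x|)%:E)%E @[del --> 0^'+] --> 0%E.
Proof.
move=> cu hu.
have iu del : 0 < del -> circle_integrable (fun x => `|u del x|).
  by move=> dp; apply: circle_integrable_norm; exact: continuous_integrable (cu del dp).
apply: cvg_EFin.
  near=> del; have dp : 0 < del by near: del; exact: nbhs_right_gt.
  by rewrite (EFin_circle_integral (iu del dp)).
apply/cvgrPdist_le => eps eps0; have [del1 d10 hd] := hu eps eps0.
near=> del.
have dp : 0 < del by near: del; exact: nbhs_right_gt.
have dl : del < del1 by near: del; exact: nbhs_right_lt.
rewrite sub0r normrN /=; apply: circle_integral_norm_le (iu del dp) _ => x _.
by rewrite normr_id; apply: hd; rewrite dp.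
Unshelve. all: by end_near. Qed.

Lemma acip_base : acip T0 = f0.
Proof. exact: (acipE (relaxed_lift E0) (cone_slope_gt0 E0) (cone_slope_K E0)). Qed.

Lemma direction_response_is_linear_response S : class_C 3 S -> periodic S 1 -> is_linear_response T0 S (direction_response S).
Proof.
move=> cS pS; have cS2 := class_C_le (isT : (2 <= 3)%N) cS.
have cr := direction_response_continuous E0 h3 c3 nf nf1 cS2 pS.
split.
  apply: continuous_Lp1; first exact: cr.
  exact: (direction_response_periodic E0 h3 c3 nf nf1 cS2 pS).
move=> dbar T [dbar0 T00 cT _ [F [hF eF [M hM]]]].
apply: (uniform_cvg_L1 (u := fun delta x => (acip (T delta) x - acip T0 x) / delta - direction_response S x)).
  move=> del dp x; apply: cvgB; last exact: cr.
  apply: cvgM; last exact: cvg_cst.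
  by apply: cvgB; exact: acip_continuous.
have [n1 n2] := direction_C1 cS2 pS.
have [E2 [nEE nE1]] := periodic_C1_flux E0 h3 c3 n1 n2 nf nf1.
pose M' := Order.max M 0.
have M'0 : 0 <= M' by rewrite le_max lexx orbT.
have bF del x j : (j < 4)%N -> 0 < del < dbar -> `|derive1n j (F del) x| <= M' * del ^+ 2.
  move=> j4 hd; have [pF cF] := hF del hd; have /andP[dp _] := hd.
  apply: le_trans (C3norm_ge x cF pF j4) _; rewrite -ler_pdivrMr ?exprn_gt0 //.
  by apply: le_trans (hM del hd) _; rewrite le_max lexx.
move=> eps eps0.
have [del1 d10 hd1] := @response_limit R T0 T01 T02 T03 d s al C C3 E0 h3 c3 b3 S _ _ n1 n2
  F (fun del => derive1n 1 (F del)) (fun del => derive1n 2 (F del)) dbar M' dbar0 M'0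
  (fun del hd => class_C_deriv (hF del hd).2 (isT : (0 < 3)%N))
  (fun del hd => class_C_deriv (hF del hd).2 (isT : (1 < 3)%N))
  (fun del hd => class_C_continuous (hF del hd).2 (isT : (2 <= 3)%N))
  (fun del hd => (hF del hd).1)
  (fun del x hd => And3 (bF del x 0%N isT hd) (bF del x 1%N isT hd) (bF del x 2%N isT hd))
  f01 f02 E2 nf nf1 nEE nE1 eps eps0.
exists del1 => // del hd x; have [db h] := hd1 del hd.
have hdb : 0 < del < dbar by have /andP[-> _] := hd.
have -> : acip (T del) = acip (perturbed T0 S F del) by apply: acip_mod1 => y; exact: eF.
have e0 : acip T0 x = f0 x := congr1 (fun u => u x) acip_base.
by rewrite e0; have := h x; rewrite -/(flux_deriv T0 T01 T02 d s f01 S) -/(direction_response S).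
Qed.

(** A family in the direction [S] exists, so that the linear response is not
defined by a vacuous condition. *)
Lemma direct_family S : circle_map T0 -> class_C 3 T0 -> class_C 3 S -> periodic S 1 ->
  perturbed_family T0 S 1 (fun del x => T0 x + del * S x).
Proof.
move=> [k hk] cT cS pS; split; [exact: ltr01| | |by split|].
- by apply/funext => x; rewrite mul0r addr0.
- move=> del _; split; first by exists k => x; rewrite hk pS; ring.
  have [cl _] := class_C_lin 1 del cT cS.
  have -> : (fun x => T0 x + del * S x) = fun x => 1 * T0 x + del * S x.
    by apply/funext => x; rewrite mul1r.
  exact: cl.
- exists (fun _ _ => 0); split.
  + by move=> del _; split; [move=> x|exact: class_C_cst0].
  + by move=> del x _; exists 0; rewrite !addr0.
  + by exists 0 => del _; rewrite C3norm0 mul0r.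
Qed.

(** Both functions are limits in [L^1] of the same quotients, for
[direct_family]. *)
Lemma response_unique_L1 S r r' : circle_map T0 -> class_C 3 T0 -> class_C 3 S -> periodic S 1 ->
  is_linear_response T0 S r -> is_linear_response T0 S r' ->
  circle_integral (fun x => `|r x - r' x|) = 0.
Proof.
move=> mT cT cS pS [lr hr] [lr' hr']; have fam := direct_family mT cT cS pS.
have {}hr := hr _ _ fam; have {}hr' := hr' _ _ fam.
move/Lp1P: lr => [_ ir]; move/Lp1P: lr' => [_ ir'].
pose T del x := T0 x + del * S x.
pose q del x := (acip (T del) x - acip T0 x) / del.
have iq del : circle_integrable (q del).
  apply: continuous_integrable => x; apply: cvgM; last exact: cvg_cst.
  by apply: cvgB; exact: acip_continuous.
have iqr del : circle_integrable (fun x => `|q del x - r x|).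
  by apply: circle_integrable_norm; exact: circle_integrableB.
have iqr' del : circle_integrable (fun x => `|q del x - r' x|).
  by apply: circle_integrable_norm; exact: circle_integrableB.
have irr : circle_integrable (fun x => `|r x - r' x|).
  by apply: circle_integrable_norm; exact: circle_integrableB.
have I0 : 0 <= circle_integral (fun x => `|r x - r' x|) by exact: circle_integral_ge0.
have real_limit rr : (forall del, circle_integrable (fun x => `|q del x - rr x|)) ->
    (\int[lebesgue_measure]_(x in `[0%R, 1%R]) (`|q del x - rr x|)%:E)%E @[del --> 0^'+] --> 0%E ->
    circle_integral (fun x => `|q del x - rr x|) @[del --> 0^'+] --> (0 : R).
  by move=> irr' h; exact: (fine_cvg h).
have lim : (fun del => circle_integral (fun x => `|q del x - r x|) +
    circle_integral (fun x => `|q del x - r' x|)) @ 0^'+ --> (0 + 0 : R).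
  exact: cvgD (real_limit _ iqr hr) (real_limit _ iqr' hr').
rewrite addr0 in lim. apply/eqP; rewrite eq_le I0 andbT.
apply: (cvgr_to_ge lim); near=> del.
apply: le_trans (circle_integral_le irr (circle_integrableD (iqr del) (iqr' del)) _) _.
  move=> x _; move: (q del x) => z.
  have -> : r x - r' x = (z - r' x) - (z - r x) by ring.
  by apply: le_trans (ler_normB _ _) _; rewrite addrC.
by rewrite (circle_integralD (iqr del) (iqr' del)).
Unshelve. all: by end_near. Qed.

(** The linear response is a choice among functions that agree almost
everywhere, which does not change integrals against a bounded observable. *)
Lemma response_integral (c : R -> R) S : Lp +oo%E c -> circle_map T0 -> class_C 3 T0 ->
  class_C 3 S -> periodic S 1 ->
  circle_integral (fun x => c x * linear_response T0 S x) =
  circle_integral (fun x => c x * direction_response S x).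
Proof.
move=> hc mT cT cS pS; have hr := direction_response_is_linear_response cS pS.
rewrite /linear_response; case: xgetP => [r _ hr'|/(_ _ hr)//].
have e := response_unique_L1 mT cT cS pS hr' hr.
move: hr' hr => [/Lp1P[_ ir'] _] [/Lp1P[_ ir] _].
have [M M0 hM] := ess_integral_bound hc.
have i1 := circle_integrable_ess hc ir'; have i2 := circle_integrable_ess hc ir.
apply/eqP; rewrite -subr_eq0 -normr_le0.
have := hM _ (circle_integrableB ir' ir); rewrite e mulr0; apply: le_trans.
rewrite -(circle_integralB i1 i2) le_eqVlt; apply/orP; left; apply/eqP.
by congr (`|_|); apply: circle_integral_eq => x _; rewrite mulrBr.
Qed.

End ResponseIsLimit.


(** The conjugate in the formula for the coefficients acts on a real
observable times a complex function. *)
Lemma realM_conj (R : realType) (a u v : R) :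
  a%:C%C * (Complex u v)^* = Complex (a * u) (- (a * v)).
Proof.
have -> : (Complex u v)^* = Complex u (- v) by [].
by rewrite /GRing.mul /= !mul0r subr0 addr0 mulrN.
Qed.

(** * The expected response as a functional of the direction *)

Section ExpectedResponse.
Variable R : realType.
Implicit Types (x y : R) (S : R -> R).
Variables (T0 T01 T02 T03 : R -> R) (d : int) (s al C C3 : R).
Hypothesis E0 : expanding_lift T0 T01 T02 d s al C.
Hypotheses (h3 : has_deriv T02 T03) (c3 : continuous T03) (b3 : forall x, `|T03 x| <= C3).
Local Notation f0 := (invariant T0 T01 d s).
Variables (f01 f02 : R -> R).
Hypotheses (nf : periodic_C1 f0 f01) (nf1 : periodic_C1 f01 f02).
Local Notation direction_response := (direction_response T0 T01 T02 d s f01).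
Local Notation flux_deriv := (flux_deriv T0 T01 T02 d s f01).
Local Notation L0 := (Lop `|d|%N s (lift_inv T0) (inv1 T0 T01)).
Local Notation neu0 := (neumann `|d|%N s (lift_inv T0) (inv1 T0 T01)).
Variable c : R -> R.
Hypothesis hc : Lp +oo%E c.

Definition expected_response S : R := circle_integral (fun x => c x * direction_response S x).

Lemma direction_response_integrable S : class_C 2 S -> periodic S 1 -> circle_integrable (fun x => c x * direction_response S x).
Proof.
move=> cS pS; apply: circle_integrable_ess hc _.
exact: continuous_integrable (direction_response_continuous E0 h3 c3 nf nf1 cS pS).
Qed.

Lemma expected_response_lin S S' (p q : R) : class_C 2 S -> periodic S 1 -> class_C 2 S' -> periodic S' 1 ->
  expected_response (fun x => p * S x + q * S' x) = p * expected_response S + q * expected_response S'.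
Proof.
move=> cS pS cS' pS'; rewrite /expected_response (direction_response_lin E0 h3 c3 nf nf1 p q cS pS cS' pS').
rewrite -(circle_integral_lin p q (direction_response_integrable cS pS) (direction_response_integrable cS' pS')).
apply: circle_integral_eq => x _; move: (direction_response S x) (direction_response S' x) => u v; ring.
Qed.

Lemma expected_response_bound : exists2 K : R, 0 <= K & forall S (t : R), class_C 2 S -> periodic S 1 ->
  (forall x, [/\ `|S x| <= t, `|derive1n 1 S x| <= t & `|derive1n 2 S x| <= t]) ->
  `|expected_response S| <= K * t.
Proof.
have [K K0 hK] := direction_response_bound E0 h3 c3 nf nf1.
have [M M0 hM] := ess_integral_bound hc.
exists (M * K); first exact: mulr_ge0.
move=> S t cS pS bS; have cr := direction_response_continuous E0 h3 c3 nf nf1 cS pS.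
apply: le_trans (hM _ (continuous_integrable cr)) _; rewrite -mulrA; apply: ler_wpM2l => //.
apply: (@circle_integral_le_cst R (fun x => `|direction_response S x|) (K * t)); last by move=> x; exact: hK.
by move=> x; apply: cvg_norm; exact: cr.
Qed.

Lemma objectiveE S : circle_map T0 -> class_C 3 T0 -> H4 S -> objective T0 c S = - expected_response S.
Proof.
move=> mT cT hS; have [_ pS _] := hS; congr (- _).
exact: (response_integral E0 h3 c3 b3 nf nf1 hc mT cT (H4_class_C hS) pS).
Qed.

(** Identifies the ingredients of the formula for the coefficients, for real
directions: the derivative of [S f0 / T0'], and the resolvent applied to its
image under the transfer operator. *)
Lemma flux_deriv_spec S : class_C 2 S -> periodic S 1 ->
  [/\ forall x, derive1 (fun y => S y * f0 y / T01 y) x = flux_deriv S x,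
      periodic (flux_deriv S) 1, C1_zero_mean (L0 (flux_deriv S)) &
      neu0 (L0 (flux_deriv S)) = fun x => - direction_response S x].
Proof.
move=> cS pS; have [n1 n2] := direction_C1 cS pS.
have [E2 [nEE nE1]] := periodic_C1_flux E0 h3 c3 n1 n2 nf nf1.
have [_ [[q1 hq cq] [pq Iq]]] := source_spec E0 nEE nE1.
have [hEE cE pEE] := nEE; have [_ _ pE] := nE1.
have cE1 : continuous (flux_deriv S) by case: nE1 => /has_deriv_continuous.
have IB := inv_branch (relaxed_lift E0).
have z : C1_zero_mean (L0 (flux_deriv S)).
  split; [exists (fun x => - q1 x)|split].
  - apply: has_deriv_ext (has_derivN hq) _ _ => // x.
    by rewrite /source opprK.
  - by move=> x; apply: cvgN; exact: cq.
  - exact: (Lop_periodic IB pE).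
  - exact: (etrans (Lop_integral IB cE1 pE) (circle_integral_deriv0 hEE cE1 pEE)).
split; [|exact: pE|exact: z|].
- move=> x; have <- : (fun y => quotient T01 f0 y * S y) = (fun y => S y * f0 y / T01 y).
    by apply/funext => y; rewrite /quotient /inv_slope; ring.
  by rewrite (has_deriv_derive1 hEE).
- have [[[u1 hu _] [pu Iu]] eu] := neumann_spec (relaxed_lift E0) (cone_slope_gt0 E0) (cone_slope_K E0) z.
  have [[[v1 hv _] [pv Iv]] ev] := direction_response_spec E0 h3 c3 nf nf1 cS pS.
  have cv := has_deriv_continuous hv.
  apply: (resolvent_unique (relaxed_lift E0) (cone_slope_gt0 E0) (cone_slope_K E0) (has_deriv_continuous hu) pu Iu).
  + by move=> x; apply: cvgN; exact: cv.
  + by move=> x; rewrite pv.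
  + have e := circle_integral_lin0 (-1) 0 (continuous_integrable cv) (continuous_integrable cv) Iv Iv.
    by rewrite -[RHS]e; apply: circle_integral_eq => x _; rewrite mulN1r mul0r addr0.
  + move=> x; rewrite eu.
    have -> : L0 (fun x => - direction_response S x) x = - L0 (direction_response S) x.
      have h := Lop_lin T0 T01 d s (-1) 0 (direction_response S) (direction_response S) x.
      rewrite mulN1r mul0r addr0 in h; rewrite -h; congr (Lop _ _ _ _ _ x).
      by apply/funext => y; rewrite mulN1r mul0r addr0.
    by rewrite -opprD ev opprK.
Qed.

(** Up to the factor in the denominator the coefficient is the value of the
functional, extended to complex directions, on the conjugate of [e_n]; real
and imaginary parts of [e_n] are the cosine and the sine of frequency [n]. *)
Lemma optimal_coefE (n : int) nu : derive1 T0 = T01 ->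
  optimal_coef T0 c nu n = Complex (expected_response (cos_mode n) / (2 * nu * H4weight n))
                                   (- expected_response (sin_mode n) / (2 * nu * H4weight n)).
Proof.
move=> eT; have [c1 c2] := mode_class_C R n 2.
have [dc pc zc ec] := flux_deriv_spec c1 (@cos_mode_periodic R n).
have [ds ps zs es] := flux_deriv_spec c2 (@sin_mode_periodic R n).
rewrite /optimal_coef eT (acip_base E0).
set g := complex_derive _.
have gE x : g x = Complex (flux_deriv (cos_mode n) x) (flux_deriv (sin_mode n) x).
  rewrite /g /complex_derive -dc -ds.
  by congr (Complex (derive1 _ x) (derive1 _ x)); apply/funext => y;
    rewrite divCr /= /cos_mode /sin_mode /freq; ring.
have pg x : g (x + 1) = g x by rewrite !gE pc ps.
have tE : transfer T0 g = fun x => Complex (L0 (flux_deriv (cos_mode n)) x) (L0 (flux_deriv (sin_mode n)) x).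
  apply/funext => x; rewrite (transferE (relaxed_lift E0) _ pg).
  by congr (Complex (Lop _ _ _ _ _ x) (Lop _ _ _ _ _ x)); apply/funext => y; rewrite gE.
have rE := @resolventE _ _ _ _ _ _ _ _ (relaxed_lift E0) _ (cone_slope_gt0 E0) (cone_slope_K E0)
  (fun x => Complex (L0 (flux_deriv (cos_mode n)) x) (L0 (flux_deriv (sin_mode n)) x)) zc zs.
rewrite tE rE /= ec es.
have i1 := direction_response_integrable c1 (@cos_mode_periodic R n).
have i2 := direction_response_integrable c2 (@sin_mode_periodic R n).
have -> : complex_integral (fun x => (c x)%:C%C * (Complex (- direction_response (cos_mode n) x) (- direction_response (sin_mode n) x))^* ) =
    Complex (- expected_response (cos_mode n)) (expected_response (sin_mode n)).
  rewrite /complex_integral; congr Complex; last first.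
    by apply: circle_integral_eq => x _; rewrite realM_conj /=; move: (direction_response _ x) => u; ring.
  rewrite /expected_response -[RHS]mulN1r -(circle_integralZ (-1) i1); apply: circle_integral_eq => x _.
  by rewrite realM_conj /=; move: (direction_response _ x) => u; ring.
by rewrite divCr /= opprK.
Qed.
End ExpectedResponse.


Lemma cvg_ord_sum (R : realType) m (u : nat -> nat -> R) (l : nat -> R) :
  (forall k, (k < m)%N -> u k @ \oo --> l k) ->
  (fun N => \sum_(k < m) u k N) @ \oo --> \sum_(k < m) l k.
Proof.
elim: m => [|m IHm] h.
  by rewrite big_ord0; under eq_fun do rewrite big_ord0; exact: cvg_cst.
rewrite big_ord_recr; under eq_fun do rewrite big_ord_recr /=.
by apply: cvgD; [apply: IHm => k km; exact: h (ltnW km)|exact: h].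
Qed.

(** * Maximising a linear functional on the unit ball of H^4 *)

Section LinearFunctional.
Variable R : realType.
Implicit Types (x y : R) (S : R -> R) (A B e : nat -> R) (n N : nat).
Variable ell : (R -> R) -> R.
Hypothesis ell_lin : forall S S' (p q : R), class_C 2 S -> periodic S 1 ->
  class_C 2 S' -> periodic S' 1 ->
  ell (fun x => p * S x + q * S' x) = p * ell S + q * ell S'.
Variable K : R.
Hypothesis K0 : 0 <= K.
Hypothesis ell_bound : forall S (t : R), class_C 2 S -> periodic S 1 ->
  (forall x, [/\ `|S x| <= t, `|derive1n 1 S x| <= t & `|derive1n 2 S x| <= t]) ->
  `|ell S| <= K * t.

Local Notation cn n := (ell (@cos_mode R n%:Z)).
Local Notation sn n := (ell (@sin_mode R n%:Z)).
Local Notation F n := (freq R n%:Z).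
Local Notation mult := (mult R).
Local Notation w n := (weight R n).

Lemma ell_sin_opp (n : int) : ell (@sin_mode R (- n)) = - ell (@sin_mode R n).
Proof.
have [_ h] := mode_class_C R n 2; have p := @sin_mode_periodic R n.
have -> : @sin_mode R (- n) = fun x => -1 * sin_mode n x + 0 * sin_mode n x.
  by apply/funext => x; rewrite mul0r addr0 mulN1r /sin_mode freqN mulNr sinN.
by rewrite ell_lin // mulN1r mul0r addr0.
Qed.

Lemma ell_cos_opp (n : int) : ell (@cos_mode R (- n)) = ell (@cos_mode R n).
Proof. by congr ell; apply/funext => x; rewrite /cos_mode freqN mulNr cosN. Qed.

Lemma ell_sin0 : sn 0 = 0.
Proof. by have := ell_sin_opp 0; rewrite oppr0 => h; lra. Qed.

(** The derivatives of order [j] of a mode are at most [F ^ j]. *)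
Lemma mode_bound n : `|cn n| <= K * (2 * (1 + F n ^+ 2)) /\ `|sn n| <= K * (2 * (1 + F n ^+ 2)).
Proof.
have F0 := freq_ge0 R n; set f := F n in F0 *.
have ineq j : (j < 3)%N -> f ^+ j <= 2 * (1 + f ^+ 2).
  by have := sqr_ge0 f; have := sqr_ge0 (f - 1); case: j => [|[|[|]]] // *; rewrite ?expr0 ?expr1; nra.
have bt (p : R * R) j x : `|p.1| + `|p.2| = 1 ->
    `|(rot n%:Z j p).1 * cos_mode n%:Z x + (rot n%:Z j p).2 * sin_mode n%:Z x| <= f ^+ j.
  move=> p1; rewrite -[leRHS]mulr1 -p1 -(rot_l1 n j p).
  apply: le_trans (ler_normD _ _) _.
  by rewrite !normrM; apply: lerD; rewrite -[leRHS]mulr1 ler_wpM2l // ?cos_mode_le1 ?sin_mode_le1.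
have key (p : R * R) : `|p.1| + `|p.2| = 1 ->
    `|ell (fun x => p.1 * cos_mode n%:Z x + p.2 * sin_mode n%:Z x)| <= K * (2 * (1 + f ^+ 2)).
  move=> p1; have [h dE] := trig_class_C n%:Z p 2.
  apply: ell_bound => //; first by move=> x; rewrite cos_mode_periodic sin_mode_periodic.
  by move=> x; split; rewrite ?dE;
    [apply: le_trans (bt p 0%N x p1) (ineq 0%N isT)
    |apply: le_trans (bt p 1%N x p1) (ineq 1%N isT)
    |apply: le_trans (bt p 2%N x p1) (ineq 2%N isT)].
split.
- have := key (1, 0); rewrite /= normr1 normr0 addr0 => /(_ erefl).
  have -> // : (fun x => 1 * cos_mode n%:Z x + 0 * sin_mode n%:Z x) = @cos_mode R n%:Z.
  by apply/funext => x; rewrite mul1r mul0r addr0.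
- have := key (0, 1); rewrite /= normr1 normr0 add0r => /(_ erefl).
  have -> // : (fun x => 0 * cos_mode n%:Z x + 1 * sin_mode n%:Z x) = @sin_mode R n%:Z.
  by apply/funext => x; rewrite mul1r mul0r add0r.
Qed.

Lemma ell_zero : ell (fun=> 0) = 0.
Proof.
have c0 := @class_C_cst0 R 2.
have p0 : periodic (fun _ : R => (0 : R)) 1 by [].
have := ell_lin 0 0 c0 p0 c0 p0.
have -> : (fun _ : R => 0 * 0 + 0 * 0 : R) = fun=> 0 by apply/funext => x; rewrite mul0r addr0.
by rewrite mul0r addr0.
Qed.

Lemma trig_poly_class_C A B N m : class_C m (trig_poly A B N) /\
  forall j, derive1n j (trig_poly A B N) = fun x => \sum_(n < N) trig_term A B j n x.
Proof.
pose G j x := \sum_(n < N) trig_term A B j n x.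
have hG j : has_deriv (G j) (G j.+1).
  apply: has_deriv_sum => i; exact: trig_term_deriv.
split; last by move=> j; exact: (tower_derive1n (F := G) (k := j) (fun i _ => hG i) (leqnn j)).
apply: (tower_class_C (F := G)); first by move=> j _; exact: hG.
exact: has_deriv_continuous (hG m).
Qed.

Lemma trig_poly_periodic A B N : periodic (trig_poly A B N) 1.
Proof. by move=> x; apply: eq_bigr => n _; exact: trig_term_periodic. Qed.

Lemma ell_trig_poly A B N :
  ell (trig_poly A B N) = \sum_(n < N) mult n * (A n * cn n + B n * sn n).
Proof.
elim: N => [|N IHN].
  rewrite big_ord0 -ell_zero; congr ell; apply/funext => x.
  by rewrite /trig_poly big_ord0.
have [c1 _] := trig_poly_class_C A B N 2.
have p1 := trig_poly_periodic A B N.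
have [h1 h2] := mode_class_C R N%:Z 2.
have pc := @cos_mode_periodic R N%:Z; have ps := @sin_mode_periodic R N%:Z.
rewrite big_ord_recr /= -IHN.
have -> : trig_poly A B N.+1 = fun x => 1 * trig_poly A B N x +
    mult N * (A N * cos_mode N%:Z x + B N * sin_mode N%:Z x).
  by apply/funext => x; rewrite /trig_poly big_ord_recr /= mul1r.
have [c2 _] := class_C_lin (A N) (B N) h1 h2.
rewrite (ell_lin 1 (mult N) c1 p1 c2); last by move=> x; rewrite pc ps.
by rewrite (ell_lin (A N) (B N) h1 pc h2 ps) mul1r.
Qed.

Section Series.
Variables (A B e : nat -> R).
Hypotheses (dec : forall j n, (j <= 2)%N -> F n ^+ j * (`|A n| + `|B n|) <= e n)
  (ce : cvgn (series e)).

(** Continuity of the functional for the [C^2] norm lets it act termwise on a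
series that converges in C^2. *)
Lemma ell_synth : (fun N => \sum_(n < N) mult n * (A n * cn n + B n * sn n)) @ \oo -->
  ell (synth A B 0).
Proof.
have mj j (hj : (j <= 2)%N) := synth_majorised dec ce hj.
have cS : class_C 2 (synth A B 0) := synth_class_C dec ce.
have pS : periodic (synth A B 0) 1 := synth_periodic A B 0.
have dS j (hj : (j <= 2)%N) := synth_derive1n dec ce hj.
pose t := tail (fun n => 2 * e n).
have t0 : t @ \oo --> 0 := tail_cvg0 (mj 0%N isT).
have key N : `|\sum_(n < N) mult n * (A n * cn n + B n * sn n) - ell (synth A B 0)| <= K * t N.
  have [cP dP] := trig_poly_class_C A B N 2; have pP := trig_poly_periodic A B N.
  have [cL dL] := class_C_lin 1 (-1) cP cS.
  have -> : \sum_(n < N) mult n * (A n * cn n + B n * sn n) - ell (synth A B 0) =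
      ell (fun x => 1 * trig_poly A B N x + -1 * synth A B 0 x).
    by rewrite (ell_lin 1 (-1) cP pP cS pS) ell_trig_poly mul1r mulN1r.
  apply: ell_bound => //; first by move=> x; rewrite pP pS.
  have b j x (hj : (j <= 2)%N) :
      `|derive1n j (fun x => 1 * trig_poly A B N x + -1 * synth A B 0 x) x| <= t N.
    rewrite dL // dP dS // mul1r mulN1r; exact: majorised_tail (mj j hj).
  by move=> x; split; [exact: (b 0%N)|exact: (b 1%N)|exact: (b 2%N)].
apply/cvgrPdist_le => eps eps0.
have K1 : 0 < K + 1 by rewrite ltr_wpDl.
have : 0 < eps / (K + 1) by rewrite divr_gt0.
move/cvgrPdist_le : t0 => /[apply] t0; near=> N.
rewrite distrC; apply: le_trans (key N) _.
have : `|0 - t N| <= eps / (K + 1) by near: N; exact: t0.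
rewrite sub0r normrN => h; have h2 := le_trans (ler_norm _) h.
apply: le_trans (ler_wpM2l K0 h2) _; rewrite mulrCA ler_piMr ?(ltW eps0) //.
by rewrite ler_pdivrMr // mul1r lerDl.
Unshelve. all: by end_near. Qed.

End Series.

Lemma ell_H4 S : H4 S ->
  (fun N => \sum_(n < N) mult n * (cos_coef S n%:Z * cn n + sin_coef S n%:Z * sn n)) @ \oo --> ell S.
Proof.
move=> hS; rewrite [X in _ --> ell X](H4_fourier hS); apply: ell_synth (H4_majorant_cvg hS).
by move=> j n hj; apply: H4_majorant_dec; exact: leq_trans hj _.
Qed.

Lemma weight_gt0 n : 0 < w n.
Proof.
apply: lt_le_trans (weight_ge R n (leq0n 3)); rewrite expr0 mul1r.
by rewrite ltr_wpDr ?sqr_ge0.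
Qed.

Lemma weightE n : w n = 1 + F n ^+ 2 + F n ^+ 4 + F n ^+ 6 + F n ^+ 8.
Proof. by rewrite /weight !big_ord_recr big_ord0 /=; ring. Qed.

Lemma freq_sqr n : n%:R ^+ 2 <= F n ^+ 2.
Proof. by rewrite lerXn2r ?nnegrE ?freq_ge0 ?freq_ge_n. Qed.

Section Multiplier.
Variable nu : R.
Hypothesis nu0 : 0 < nu.

(** Fourier coefficients of the Riesz representative of [ell] for the inner
product of H^4, divided by [2 * nu]. *)
Definition opt_cos n : R := cn n / (2 * nu * w n).
Definition opt_sin n : R := sn n / (2 * nu * w n).
Definition opt_sin0 : opt_sin 0 = 0. Proof. by rewrite /opt_sin ell_sin0 mul0r. Qed.

Let den n : 0 < 2 * nu * w n. Proof. by rewrite !mulr_gt0 // weight_gt0. Qed.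

(** The coefficients are of order [n^2 / n^8], so that the optimum is of class
C^4. *)
Lemma opt_decay j n : (j <= 4)%N -> F n ^+ j * (`|opt_cos n| + `|opt_sin n|) <= 4 * K / nu * inv_sq R n.
Proof.
move=> j4; have [hc hs] := mode_bound n.
rewrite /opt_cos /opt_sin !normrM normfV (gtr0_norm (den n)) -mulrDl.
have F0 := freq_ge0 R n; have nF := freq_sqr n; have wE := weightE n; have w0 := weight_gt0 n.
have q0 : 0 < 1 + n%:R ^+ 2 :> R by rewrite ltr_wpDr ?sqr_ge0.
rewrite /inv_sq [leLHS]mulrA ler_pdivrMr ?den // [leRHS]mulrAC ler_pdivlMr //.
have s2 : `|cn n| + `|sn n| <= 4 * K * (1 + F n ^+ 2) by lra.
have poly : F n ^+ j * (1 + F n ^+ 2) * (1 + n%:R ^+ 2) <= 2 * w n.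
  apply: le_trans (_ : (1 + F n ^+ 4) * (1 + F n ^+ 2) * (1 + F n ^+ 2) <= _).
    have Fj : F n ^+ j <= 1 + F n ^+ 4.
      case: (leP 1 (F n)) => F1.
        by apply: le_trans (ler_weXn2l F1 j4) _; rewrite lerDr.
      apply: le_trans (_ : 1 <= _); first by rewrite exprn_ile1 // ltW.
      by rewrite lerDl exprn_ge0.
    have p1 : 0 <= 1 + F n ^+ 2 by rewrite addr_ge0 // sqr_ge0.
    apply: ler_pM; [by rewrite mulr_ge0 // exprn_ge0|exact: ltW|by apply: ler_wpM2r|by rewrite lerD2l].
  rewrite wE; have : 0 <= F n ^+ 8 by rewrite exprn_ge0.
  have : 0 <= F n ^+ 6 by rewrite exprn_ge0.
  have : 0 <= F n ^+ 4 by rewrite exprn_ge0.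
  move=> h4 h6 h8.
  have -> : (1 + F n ^+ 4) * (1 + F n ^+ 2) * (1 + F n ^+ 2) =
    1 + 2 * F n ^+ 2 + 2 * F n ^+ 4 + 2 * F n ^+ 6 + F n ^+ 8 by ring.
  lra.
apply: le_trans (_ : F n ^+ j * (4 * K * (1 + F n ^+ 2)) * (1 + n%:R ^+ 2) <= _).
  by rewrite ler_pM2r // ler_wpM2l // exprn_ge0.
have -> : F n ^+ j * (4 * K * (1 + F n ^+ 2)) * (1 + n%:R ^+ 2) =
  4 * K * (F n ^+ j * (1 + F n ^+ 2) * (1 + n%:R ^+ 2)) by ring.
have -> : 4 * K / nu * (2 * nu * w n) = 4 * K * (2 * w n).
  by field; rewrite gt_eqF.
by apply: ler_wpM2l => //; rewrite mulr_ge0.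
Qed.

Let e n := 4 * K / nu * inv_sq R n.

Lemma opt_majorant_cvg : cvgn (series e).
Proof.
have c0 : 0 <= 4 * K / nu by rewrite divr_ge0 ?(ltW nu0) // mulr_ge0.
apply: (@summable_of_bounded _ _ (4 * K / nu * 4)) => [n|N].
  by rewrite mulr_ge0 // ltW // inv_sq_gt0.
by rewrite -mulr_sumr; apply: ler_wpM2l => //; exact: inv_sq_sum.
Qed.

Definition optimum : R -> R := synth opt_cos opt_sin 0.

Lemma optimum_class_C : class_C 4 optimum.
Proof. exact: synth_class_C opt_decay opt_majorant_cvg. Qed.

Lemma optimum_periodic : periodic optimum 1.
Proof. exact: synth_periodic. Qed.

Lemma optimum_H4 : H4 optimum.
Proof.
apply: class_C_sobolev optimum_class_C optimum_periodic _ => g cg pg.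
exact: continuous_Lp2.
Qed.

Lemma optimum_coef n : cos_coef optimum n%:Z = opt_cos n /\ sin_coef optimum n%:Z = opt_sin n.
Proof. exact: synth_coef opt_sin0 opt_decay opt_majorant_cvg n. Qed.

Lemma optimum_partial x : trig_poly opt_cos opt_sin N x @[N --> \oo] --> optimum x.
Proof. exact: majorised_cvg (synth_majorised opt_decay opt_majorant_cvg (leq0n 4)). Qed.

Definition energy N : R := \sum_(n < N) mult n * (w n * (opt_cos n ^+ 2 + opt_sin n ^+ 2)).

(** Parseval for each of the five derivatives. *)
Lemma optimum_energy : energy @ \oo --> H4norm optimum ^+ 2.
Proof.
rewrite /H4norm sqr_sqrtr; last first.
  by apply: sumr_ge0 => k _; apply: circle_integral_ge0 => x; rewrite exprn_ge0.
have -> : energy = fun N => \sum_(k < 5) \sum_(n < N)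
    mult n * (F n ^+ 2 ^+ k * (opt_cos n ^+ 2 + opt_sin n ^+ 2)).
  apply/funext => N; rewrite exchange_big /=; apply: eq_bigr => n _.
  by rewrite -mulr_sumr /weight mulr_suml.
have cO := optimum_class_C; have pO := optimum_periodic.
have lim (k : 'I_5) : (fun N => \sum_(n < N) mult n * (F n ^+ 2 ^+ k * (opt_cos n ^+ 2 + opt_sin n ^+ 2))) @ \oo
    --> circle_integral (fun x => `|wderiv k optimum x| ^+ 2).
  have k4 : (k <= 4)%N := ltn_ord k.
  have iO : circle_integrable optimum := continuous_integrable (class_C_continuous cO (leq0n 4)).
  have l2 : Lp 2%:E (derive1n k optimum).
    by apply: continuous_Lp2; [exact: (class_C_continuous cO)|exact: (@class_C_periodic _ _ _ cO pO k)].
  rewrite (wderiv_energy l2 (class_C_weak_derivative cO pO k4) iO).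
  rewrite /optimum (synth_derive1n opt_decay opt_majorant_cvg k4).
  exact: (synth_energy opt_sin0 opt_decay opt_majorant_cvg k4).
apply: (@cvg_ord_sum R 5 (fun k N => \sum_(n < N) mult n * (F n ^+ 2 ^+ k * (opt_cos n ^+ 2 + opt_sin n ^+ 2))) (fun k => circle_integral (fun x => `|wderiv k optimum x| ^+ 2)) (fun k hk => lim (Ordinal hk))).
Qed.

Hypothesis normalised : energy @ \oo --> (1 : R).

Lemma optimum_norm : H4norm optimum = 1.
Proof.
have h := cvg_unique _ normalised optimum_energy.
have p : 0 <= H4norm optimum by exact: sqrtr_ge0.
by apply/eqP; rewrite -sqrp_eq1 // -h.
Qed.

Lemma energy_le1 N : energy N <= 1.
Proof.
have h : nondecreasing_seq energy.
  apply/nondecreasing_seqP => n; rewrite /energy big_ord_recr /= lerDl.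
  by rewrite !mulr_ge0 ?(ltW (mult_gt0 R n)) ?(ltW (weight_gt0 n)) // addr_ge0 // sqr_ge0.
rewrite -(cvg_lim _ normalised) //; apply: nondecreasing_cvgn_le => //.
exact: cvgP normalised.
Qed.

(** Complete the square: since [cn n = 2 * nu * w n * opt_cos n], the linear
functional is an inner product with the optimum, and both vectors have norm at
most one. The negative term will give uniqueness. *)
Lemma ell_gap S N : H4 S -> H4norm S <= 1 ->
  \sum_(n < N) mult n * (cos_coef S n%:Z * cn n + sin_coef S n%:Z * sn n) <=
  nu * (2 - \sum_(n < N) mult n * (w n * ((cos_coef S n%:Z - opt_cos n) ^+ 2 + (sin_coef S n%:Z - opt_sin n) ^+ 2))).
Proof.
move=> hS S1.
have b1 : \sum_(n < N) mult n * (w n * (cos_coef S n%:Z ^+ 2 + sin_coef S n%:Z ^+ 2)) <= 1.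
  apply: le_trans (H4_bessel N hS) _; rewrite expr_le1 //; exact: sqrtr_ge0.
have b2 := energy_le1 N.
apply: le_trans (_ : nu * (\sum_(n < N) mult n * (w n * (cos_coef S n%:Z ^+ 2 + sin_coef S n%:Z ^+ 2)) +
  energy N - \sum_(n < N) mult n * (w n * ((cos_coef S n%:Z - opt_cos n) ^+ 2 + (sin_coef S n%:Z - opt_sin n) ^+ 2))) <= _).
  rewrite le_eqVlt; apply/orP; left; apply/eqP.
  rewrite /energy -big_split -sumrB /= mulr_sumr; apply: eq_bigr => n _.
  have e1 : cn n = 2 * nu * w n * opt_cos n by rewrite /opt_cos mulrC divfK ?gt_eqF.
  have e2 : sn n = 2 * nu * w n * opt_sin n by rewrite /opt_sin mulrC divfK ?gt_eqF.
  rewrite e1 e2; move: (opt_cos n) (opt_sin n) (cos_coef S _) (sin_coef S _) (w n) (mult n) => *; ring.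
by rewrite ler_pM2l // lerD2r; lra.
Qed.

Lemma ell_optimum : ell optimum = 2 * nu.
Proof.
have lim := ell_H4 optimum_H4.
have E N : \sum_(n < N) mult n * (cos_coef optimum n%:Z * cn n + sin_coef optimum n%:Z * sn n) =
    2 * nu * energy N.
  rewrite /energy mulr_sumr; apply: eq_bigr => n _; have [-> ->] := optimum_coef n.
  have e1 : cn n = 2 * nu * w n * opt_cos n by rewrite /opt_cos mulrC divfK ?gt_eqF.
  have e2 : sn n = 2 * nu * w n * opt_sin n by rewrite /opt_sin mulrC divfK ?gt_eqF.
  rewrite e1 e2; move: (opt_cos n) (opt_sin n) (w n) (mult n) => *; ring.
have {}lim : (fun N => 2 * nu * energy N) @ \oo --> ell optimum.
  by under eq_fun do rewrite -E; exact: lim.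
have lim2 : (fun N => 2 * nu * energy N) @ \oo --> 2 * nu * 1.
  by apply: cvgM; [exact: cvg_cst|exact: normalised].
by rewrite (cvg_unique _ lim lim2) // mulr1.
Qed.

Lemma ell_le S : H4 S -> H4norm S <= 1 -> ell S <= 2 * nu.
Proof.
move=> hS S1; apply: (cvgr_to_le (ell_H4 hS)); near=> N.
apply: le_trans (ell_gap N hS S1) _.
rewrite mulrBr [nu * 2]mulrC gerBl mulr_ge0 ?(ltW nu0) // sumr_ge0 // => n _.
by rewrite !mulr_ge0 ?(ltW (mult_gt0 R n)) ?(ltW (weight_gt0 n)) // addr_ge0 // sqr_ge0.
Unshelve. all: by end_near. Qed.

(** Equality in [ell_gap] in the limit forces each term of the square to
vanish, that is, equality of all Fourier coefficients. *)
Lemma ell_max_unique S : H4 S -> H4norm S <= 1 -> ell S = 2 * nu -> S = optimum.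
Proof.
move=> hS S1 eS.
have coef k : cos_coef S k%:Z = opt_cos k /\ sin_coef S k%:Z = opt_sin k.
  pose g n := mult n * (w n * ((cos_coef S n%:Z - opt_cos n) ^+ 2 + (sin_coef S n%:Z - opt_sin n) ^+ 2)).
  have g0 n : 0 <= g n.
    by rewrite !mulr_ge0 ?(ltW (mult_gt0 R n)) ?(ltW (weight_gt0 n)) // addr_ge0 // sqr_ge0.
  have h : ell S <= nu * (2 - g k).
    apply: (cvgr_to_le (ell_H4 hS)); near=> N.
    apply: le_trans (ell_gap N hS S1) _; rewrite ler_pM2l // lerD2l lerN2.
    have kN : (k < N)%N by near: N; exists k.+1.
    rewrite -[leLHS]/(g (Ordinal kN)) (bigD1 (Ordinal kN)) //= lerDl.
    by apply: sumr_ge0 => i _; exact: g0.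
  have gk : g k <= 0 by rewrite eS mulrC ler_pM2l // in h; lra.
  have : (cos_coef S k%:Z - opt_cos k) ^+ 2 + (sin_coef S k%:Z - opt_sin k) ^+ 2 <= 0.
    by move: gk; rewrite /g pmulr_rle0 ?mult_gt0 // pmulr_rle0 ?weight_gt0.
  have s1 := sqr_ge0 (cos_coef S k%:Z - opt_cos k); have s2 := sqr_ge0 (sin_coef S k%:Z - opt_sin k).
  move=> le0; have /eqP : (cos_coef S k%:Z - opt_cos k) ^+ 2 = 0 by lra.
  have /eqP : (sin_coef S k%:Z - opt_sin k) ^+ 2 = 0 by lra.
  by rewrite !sqrf_eq0 !subr_eq0 => /eqP -> /eqP ->.
have [cS pS _] := hS; have [cO pO _] := optimum_H4.
by apply: fourier_unique_nat => // n; have [-> ->] := coef n; have [-> ->] := optimum_coef n.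
Unshelve. all: by end_near. Qed.

End Multiplier.

(** The energy is [W / (4 * nu^2)], where [W], the squared norm of the
functional, is finite because its terms are of order [n^4 / n^8], and positive
because a functional that vanishes on all modes vanishes on H^4. *)
Lemma normalising_multiplier S : H4 S -> ell S != 0 ->
  exists2 nu : R, 0 < nu & energy nu @ \oo --> (1 : R).
Proof.
move=> hS S0.
pose g n := mult n * ((cn n ^+ 2 + sn n ^+ 2) / w n).
have g0 n : 0 <= g n.
  by rewrite mulr_ge0 ?(ltW (mult_gt0 R n)) // divr_ge0 ?(ltW (weight_gt0 n)) // addr_ge0 // sqr_ge0.
have gb n : g n <= 48 * K ^+ 2 * inv_sq R n.
  have [hc hs] := mode_bound n.
  have F0 := freq_ge0 R n; have nF := freq_sqr n; have wE := weightE n; have w0 := weight_gt0 n.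
  have q0 : 0 < 1 + n%:R ^+ 2 :> R by rewrite ltr_wpDr ?sqr_ge0.
  have p1 : 0 <= 1 + F n ^+ 2 by rewrite addr_ge0 // sqr_ge0.
  have sq (u : R) : `|u| <= K * (2 * (1 + F n ^+ 2)) -> u ^+ 2 <= 4 * K ^+ 2 * (1 + F n ^+ 2) ^+ 2.
    move=> hu; rewrite -real_normK ?num_real //.
    apply: le_trans (_ : (K * (2 * (1 + F n ^+ 2))) ^+ 2 <= _).
      by rewrite lerXn2r ?nnegrE // mulr_ge0 // mulr_ge0.
    by rewrite le_eqVlt; apply/orP; left; apply/eqP; ring.
  have s := lerD (sq _ hc) (sq _ hs).
  have poly : (1 + F n ^+ 2) ^+ 2 * (1 + n%:R ^+ 2) <= 3 * w n.
    apply: le_trans (_ : (1 + F n ^+ 2) ^+ 2 * (1 + F n ^+ 2) <= _).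
      by apply: ler_wpM2l; [exact: sqr_ge0|rewrite lerD2l].
    have h8 : 0 <= F n ^+ 8 by rewrite exprn_ge0.
    have h6 : 0 <= F n ^+ 6 by rewrite exprn_ge0.
    rewrite wE.
    have -> : (1 + F n ^+ 2) ^+ 2 * (1 + F n ^+ 2) = 1 + 3 * F n ^+ 2 + 3 * F n ^+ 4 + F n ^+ 6 by ring.
    lra.
  rewrite /g /inv_sq ler_pdivlMr // [mult n * _]mulrA [leLHS]mulrAC ler_pdivrMr //.
  have m2 := mult_le2 R n; have m0 := mult_gt0 R n.
  apply: le_trans (_ : 2 * (8 * K ^+ 2 * (1 + F n ^+ 2) ^+ 2) * (1 + n%:R ^+ 2) <= _).
    rewrite ler_pM2r //.
    apply: ler_pM => //; [exact: ltW|by rewrite addr_ge0 // sqr_ge0|lra].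
  have -> : 2 * (8 * K ^+ 2 * (1 + F n ^+ 2) ^+ 2) * (1 + n%:R ^+ 2) =
    16 * K ^+ 2 * ((1 + F n ^+ 2) ^+ 2 * (1 + n%:R ^+ 2)) by ring.
  have -> : 48 * K ^+ 2 * w n = 16 * K ^+ 2 * (3 * w n) by ring.
  by apply: ler_wpM2l => //; rewrite mulr_ge0 // sqr_ge0.
have cg : cvgn (series g).
  apply: (@summable_of_bounded _ g (48 * K ^+ 2 * 4)) => // N.
  apply: le_trans (_ : \sum_(n < N) 48 * K ^+ 2 * inv_sq R n <= _); first by apply: ler_sum.
  by rewrite -mulr_sumr; apply: ler_wpM2l; [rewrite mulr_ge0 // sqr_ge0|exact: inv_sq_sum].
pose W := limn (series g).
have limW : (fun N => \sum_(n < N) g n) @ \oo --> W.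
  have -> : (fun N => \sum_(n < N) g n) = series g.
    by apply/funext => N; rewrite /series /= big_mkord.
  exact: cg.
have gW n : g n <= W.
  apply: (cvgr_to_ge limW); near=> N.
  have kN : (n < N)%N by near: N; exists n.+1.
  rewrite -[leLHS]/(g (Ordinal kN)) (bigD1 (Ordinal kN)) //= lerDl.
  by apply: sumr_ge0 => i _; exact: g0.
have W0 : 0 < W.
  rewrite lt_neqAle (le_trans (g0 0%N) (gW 0%N)) andbT eq_sym; apply/eqP => WE.
  have z n : cn n = 0 /\ sn n = 0.
    have := gW n; rewrite WE /g pmulr_rle0 ?mult_gt0 // pmulr_lle0 ?invr_gt0 ?weight_gt0 // => h.
    have s1 := sqr_ge0 (cn n); have s2 := sqr_ge0 (sn n).
    have /eqP : cn n ^+ 2 = 0 by lra.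
    have /eqP : sn n ^+ 2 = 0 by lra.
    by rewrite !sqrf_eq0 => /eqP -> /eqP ->.
  have lim := ell_H4 hS.
  have E N : \sum_(n < N) mult n * (cos_coef S n%:Z * cn n + sin_coef S n%:Z * sn n) = 0.
    by apply: big1 => n _; have [-> ->] := z n; rewrite !mulr0 addr0 mulr0.
  have {}lim : (fun _ : nat => 0 : R) @ \oo --> ell S.
    have <- : (fun N => \sum_(n < N) mult n * (cos_coef S n%:Z * cn n + sin_coef S n%:Z * sn n)) = fun=> 0.
      by apply/funext => N; exact: E.
    exact: lim.
  by move/eqP: S0; apply; exact: (cvg_unique _ lim (cvg_cst _)).
exists (Num.sqrt W / 2); first by rewrite divr_gt0 // sqrtr_gt0.
have -> : energy (Num.sqrt W / 2) = fun N => W^-1 * \sum_(n < N) g n.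
  apply/funext => N; rewrite /energy mulr_sumr; apply: eq_bigr => n _.
  rewrite /g /opt_cos /opt_sin !expr_div_n -mulrDl; have w0 := weight_gt0 n.
  have -> : (2 * (Num.sqrt W / 2) * w n) ^+ 2 = W * w n ^+ 2.
    by rewrite [2 * _]mulrC divfK // exprMn (sqr_sqrtr (ltW W0)).
  move: (cn n ^+ 2 + sn n ^+ 2) (mult n) => u m.
  by field; rewrite !gt_eqF.
rewrite -[X in _ --> X](mulVf (lt0r_neq0 W0)).
by apply: cvgM; [exact: cvg_cst|exact: limW].
Unshelve. all: by end_near. Qed.

End LinearFunctional.


(** * Sums over the integers *)

Section TwoSidedSums.
Variable R : realType.

Lemma esum_int_split (g : int -> \bar R) : (forall n, 0 <= g n)%E ->
  (\esum_(n in [set: int]) g n =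
   \sum_(0 <= n <oo) g (Posz n) + \sum_(0 <= n <oo) g (Negz n))%E.
Proof.
move=> g0; rewrite (esumID (range Posz)); last by move=> n _; exact: g0.
rewrite !setTI; congr (_ + _)%E.
- rewrite nneseries_esum; last by move=> n _; exact: g0.
  rewrite (@reindex_esum _ _ _ [set x | xpredT x] _ Posz) //.
  split; [by move=> n _; exists n|by move=> m n _ _ []|by move=> z [n _ <-]; exists n].
- rewrite nneseries_esum; last by move=> n _; exact: g0.
  rewrite (@reindex_esum _ _ _ [set x | xpredT x] _ Negz) //.
  split; [by move=> n _ [m _]|by move=> m n _ _ []|].
  by move=> [n|n] /= h; [exfalso; apply: h; exists n|exists n].
Qed.

(** Negative indices repeat the positive ones. *)
Lemma esum_even (g : int -> R) : (forall n, 0 <= g n) -> (forall n, g (- n) = g n) ->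
  \esum_(n in [set: int]) (g n)%:E = (\sum_(0 <= n <oo) (mult R n * g n%:Z)%:E)%E.
Proof.
move=> g0 gN; rewrite esum_int_split; last by move=> n; rewrite lee_fin.
have tailE (h : nat -> R) : (forall n, 0 <= h n) ->
    (\sum_(0 <= n <oo) (h n)%:E = (h 0%N)%:E + \sum_(0 <= n <oo) (h n.+1)%:E)%E.
  move=> h0; rewrite nneseries_recl //; last by move=> n _; rewrite lee_fin.
  rewrite -(nneseries_addn 1); last by move=> n; rewrite lee_fin.
  by congr (_ + _)%E; apply: eq_eseriesr => n _; rewrite addn1.
have m0 n : 0 <= mult R n * g n%:Z by rewrite mulr_ge0 // ltW // mult_gt0.
rewrite (tailE (fun n => g n%:Z)) // (tailE (fun n => mult R n * g n%:Z)) //.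
rewrite /mult eqxx mul1r -addeA; congr (_ + _)%E.
rewrite -nneseriesD; try by move=> n _ _; rewrite lee_fin.
by apply: eq_eseriesr => n _ /=; rewrite NegzE gN -EFinD; congr EFin; ring.
Qed.

Lemma esum_even1 (g : int -> R) : (forall n, 0 <= g n) -> (forall n, g (- n) = g n) ->
  (\esum_(n in [set: int]) (g n)%:E = 1)%E <->
  (fun N => \sum_(n < N) mult R n * g n%:Z) @ \oo --> (1 : R).
Proof.
move=> g0 gN; rewrite (esum_even g0 gN).
have m0 n : (0 <= (mult R n * g n%:Z)%:E)%E by rewrite lee_fin mulr_ge0 // ltW // mult_gt0.
have E N : (\sum_(0 <= n < N) (mult R n * g n%:Z)%:E = (\sum_(n < N) mult R n * g n%:Z)%:E)%E.
  by rewrite big_mkord sumEFin.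
split=> h.
- have := is_cvg_nneseries (u_ := fun n => (mult R n * g n%:Z)%:E) (P := xpredT) (N := 0)
    (fun n _ _ => m0 n).
  rewrite h; under eq_fun do rewrite E.
  by move/fine_cvg.
- apply: cvg_lim => //; under eq_fun do rewrite E.
  by apply: cvg_EFin => //; near=> N.
Unshelve. all: by end_near. Qed.

End TwoSidedSums.

Lemma sum_symmetric (V : nmodType) (f : int -> V) N :
  \sum_(k < N.*2.+1) f (k%:Z - N%:Z) = f 0 + \sum_(n < N) (f n.+1%:Z + f (- n.+1%:Z)).
Proof.
elim: N => [|N IHN].
  by rewrite big_ord_recl !big_ord0 /= subr0.
rewrite [X in _ = _ + X]big_ord_recr /=.
rewrite [RHS](addrA (f 0)) -IHN doubleS big_ord_recl big_ord_recr /=.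
have -> : \sum_(k < N.*2.+1) f ((bump 0 (widen_ord (leqnSn N.*2.+1) k))%:Z - N.+1%:Z) =
    \sum_(k < N.*2.+1) f (k%:Z - N%:Z).
  by apply: eq_bigr => k _; congr f; rewrite /= /bump /=; lia.
have -> : (bump 0 N.*2.+1)%:Z - N.+1%:Z = N.+1%:Z by rewrite /bump /=; lia.
by rewrite sub0r addrC -addrA.
Qed.

(** * Complex Fourier sums *)

Section FourierSum.
Variable R : realType.
Implicit Types (x : R).

Lemma mul_Complex (u v u' v' : R) :
  Complex u v * Complex u' v' = Complex (u * u' - v * v') (u * v' + v * u').
Proof. by []. Qed.

Lemma add_Complex (u v u' v' : R) : Complex u v + Complex u' v' = Complex (u + u') (v + v').
Proof. by []. Qed.

Lemma cvg_complex (u : nat -> R) (l : R) : u @ \oo --> l ->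
  (fun N => ((u N)%:C%C : R[i]^o)) @ \oo --> (l%:C%C : R[i]^o).
Proof.
move=> h; apply/cvgrPdist_le => -[e i] /=; rewrite ltcE /= => /andP[/eqP i0 e0].
move/cvgrPdist_le : h => /(_ e e0); apply: filterS => N hN.
have -> : `|(l%:C%C : R[i]^o) - (u N)%:C%C| = (`|l - u N|)%:C%C.
  rewrite -rmorphB /= (normc_def (_ : R[i])) /= expr0n addr0 sqrtr_sqr.
  by [].
by rewrite lecE /= i0 eqxx.
Qed.

(** Opposite frequencies have conjugate coefficients, so that the symmetric
partial sums are the real trigonometric polynomials. *)
Lemma fourier_sum_modes (al be : nat -> R) (a : int -> R[i]) (S : R -> R) :
  (forall n : nat, a n%:Z = Complex (al n) (- be n)) ->
  (forall n : nat, a (- n%:Z) = Complex (al n) (be n)) -> be 0%N = 0 ->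
  (forall x, trig_poly al be N x @[N --> \oo] --> S x) -> fourier_sum a S.
Proof.
move=> ap an b0 lim x.
have limS : (fun N => trig_poly al be N.+1 x) @ \oo --> S x.
  by rewrite (cvg_shiftS (fun N => trig_poly al be N x)); exact: lim.
apply: cvg_trans (cvg_complex limS).
have E N : \sum_(k < N.*2.+1) a (k%:Z - N%:Z) * fourier_mode (k%:Z - N%:Z) x =
    (trig_poly al be N.+1 x)%:C%C.
  rewrite (sum_symmetric (fun n => a n * fourier_mode n x)) /trig_poly big_ord_recl rmorphD /=.
  congr (_ + _).
    rewrite (ap 0%N) /fourier_mode b0 /trig_term /mult /= /cos_mode /sin_mode -/(freq R 0) freq0 mul0r cos0 sin0.
    by rewrite mul_Complex b0; congr Complex; ring.
  rewrite rmorph_sum /=; apply: eq_bigr => n _.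
  rewrite ap an /fourier_mode /trig_term /mult /= -/(freq R n.+1%:Z) -/(freq R (- n.+1%:Z)).
  rewrite freqN mulNr cosN sinN -/(cos_mode n.+1%:Z x) -/(sin_mode n.+1%:Z x).
  by move: (cos_mode _ x) (sin_mode _ x) => u v; rewrite !mul_Complex add_Complex; congr Complex; ring.
by under eq_fun do rewrite E.
Qed.

End FourierSum.


(** * The maximiser of the expected response *)

Section CoefficientsOfFunctional.
Variable R : realType.
Variable ell : (R -> R) -> R.
Hypothesis ell_lin : forall S S' (p q : R), class_C 2 S -> periodic S 1 ->
  class_C 2 S' -> periodic S' 1 ->
  ell (fun x => p * S x + q * S' x) = p * ell S + q * ell S'.
Variables (nu : R) (a : int -> R[i]).
Hypothesis aE : forall n, a n = Complex (ell (cos_mode n) / (2 * nu * H4weight n))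
                                        (- ell (sin_mode n) / (2 * nu * H4weight n)).

Lemma H4weight_opp (n : int) : H4weight (- n) = H4weight n :> R.
Proof. by rewrite /H4weight rmorphN /= sqrrN. Qed.

Lemma H4weight_nat (n : nat) : H4weight n%:Z = weight R n.
Proof.
apply: eq_bigr => k _; congr (_ ^+ _); rewrite /freq.
by move: (n%:Z%:~R : R) (pi : R) => u v; ring.
Qed.

Lemma H4weight_ge0 (n : int) : 0 <= H4weight n :> R.
Proof.
apply: sumr_ge0 => k _; apply: exprn_ge0; rewrite mulr_ge0 ?sqr_ge0 // mulr_ge0 ?sqr_ge0 //.
Qed.

Lemma coef_nat (n : nat) : a n%:Z = Complex (opt_cos ell nu n) (- opt_sin ell nu n).
Proof. by rewrite aE H4weight_nat mulNr. Qed.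

Lemma coef_opp (n : nat) : a (- n%:Z) = Complex (opt_cos ell nu n) (opt_sin ell nu n).
Proof.
by rewrite aE H4weight_opp H4weight_nat (ell_cos_opp ell) (ell_sin_opp ell_lin) opprK.
Qed.

Lemma coef_norm (u v : R) : Normc.normc (Complex u v) ^+ 2 = u ^+ 2 + v ^+ 2.
Proof. by rewrite /Normc.normc sqr_sqrtr // addr_ge0 // sqr_ge0. Qed.

(** The normalisation of the complex coefficients over the integers is that of
the real ones, counted with multiplicity. *)
Lemma coef_normalisedE : coef_normalised a <-> energy ell nu @ \oo --> (1 : R).
Proof.
pose g n := H4weight n * Normc.normc (a n) ^+ 2 : R.
have g0 n : 0 <= g n by rewrite mulr_ge0 ?sqr_ge0 // H4weight_ge0.
have gnat (n : nat) : g (- n%:Z) = g n%:Z.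
  by rewrite /g coef_opp coef_nat H4weight_opp !coef_norm sqrrN.
have gN n : g (- n) = g n.
  by case: n => n; rewrite ?NegzE ?opprK ?gnat.
have E : (fun N => \sum_(n < N) mult R n * g n%:Z) = energy ell nu.
  apply/funext => N; apply: eq_bigr => n _; congr (_ * _).
  by rewrite /g coef_nat H4weight_nat coef_norm sqrrN.
by rewrite /coef_normalised (esum_even1 g0 gN) E.
Qed.

End CoefficientsOfFunctional.

Theorem theorem8 (R : realType) (T0 c : R -> R)
    (hT0 : circle_map T0) (A0 : class_C 4 T0) (A1 : expanding T0)
    (hc : Lp +oo%E c) :
  ((exists2 Tdot, H4 Tdot & objective T0 c Tdot <> 0) ->
     exists2 nu : R, 0 < nu & coef_normalised (optimal_coef T0 c nu)) /\
  (forall nu : R, 0 < nu -> coef_normalised (optimal_coef T0 c nu) ->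
     exists Tdot : R -> R,
       [/\ fourier_sum (optimal_coef T0 c nu) Tdot,
           H4norm Tdot = 1,
           is_minimiser T0 c Tdot &
           forall S, is_minimiser T0 c S -> S = Tdot]).
Proof.
have cT := class_C_le (isT : (3 <= 4)%N) A0.
have [d [s [al [C [E0 [C3 b3]]]]]] := expanding_lift_of hT0 cT A1.
have h3 : has_deriv (derive1n 2 T0) (derive1n 3 T0) := class_C_deriv cT (isT : (2 < 3)%N).
have c3 : continuous (derive1n 3 T0) by exact: (class_C_continuous cT (leqnn 3)).
have [f01 [f02 [nf nf1]]] := density_C2 E0 h3 c3 b3.
have lin := expected_response_lin E0 h3 c3 nf nf1 hc.
have [K K0 bound] := expected_response_bound E0 h3 c3 nf nf1 hc.
have obj S : H4 S -> _ := objectiveE E0 h3 c3 b3 nf nf1 hc hT0 cT.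
have coef nu n := @optimal_coefE R T0 _ _ _ d s al C E0 h3 c3 f01 f02 nf nf1 c hc n nu erefl.
move: (expected_response _ _ _ _ _ _ _) lin bound obj coef => l lin bound obj coef.
split=> [[S hS S0]|nu nu0].
  have lS : l S != 0 by apply/eqP => lS; apply: S0; rewrite obj // lS oppr0.
  have [nu nu0 h] := normalising_multiplier lin K0 bound hS lS.
  by exists nu => //; apply/(coef_normalisedE lin (coef nu)).
move/(coef_normalisedE lin (coef nu)) => normalised.
have H4opt := optimum_H4 K0 bound nu0.
have norm1 := optimum_norm lin K0 bound nu0 normalised.
have lopt := ell_optimum lin K0 bound nu0 normalised.
exists (optimum l nu); split=> //.
- apply: fourier_sum_modes (coef_nat (coef nu)) (coef_opp lin (coef nu)) _ _.
    exact: opt_sin0 lin nu.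
  by move=> x; exact: (@optimum_partial R l K K0 bound nu nu0 x).
- split=> // [|S hS S1]; first by rewrite norm1.
  rewrite !obj // lopt lerN2. exact: (ell_le lin K0 bound nu0 normalised hS S1).
- move=> S [hS S1 min].
  apply: (ell_max_unique lin K0 bound nu0 normalised hS S1).
  have le1 := ell_le lin K0 bound nu0 normalised hS S1.
  have := min _ H4opt; rewrite norm1 !obj // lopt lerN2 => /(_ (lexx _)) le2.
  by apply/eqP; rewrite eq_le le1 le2.
Qed.
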